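(* Let $\mathbf{X}_{n,m}$ be a random multipartite matrix with parts $V_1,\dots,V_m$ of sizes $|V_i|=n\nu_i(n)$, $m=m(n)\ge 2$, and with entry distributions $F_1$ (within parts) and $F_2$ (between parts), having variances $\sigma_1^2$ and $\sigma_2^2$. Let $\overline{\mathbf{X}}_{n,m}$ be the corresponding centered matrix, and let $\Delta^2=(\sigma_1^2+(m-1)\sigma_2^2)/m$. (i) If $\lim_{n\to\infty}\max\{\nu_1(n),\dots,\nu_m(n)\}>0$ and $\lim_{n\to\infty}\nu_i(n)/\nu_j(n)=1$ for all $i,j$, then the empirical spectral distribution $\Phi_{n^{-1/2}\overline{\mathbf{X}}_{n,m}}(x)$ converges weakly in probability, as $n\to\infty$, to the distribution $\Psi(x)$ with density $$\psi(x)=\frac{1}{2\pi\Delta^2}\sqrt{4\Delta^2-x^2}\;\mathbf{1}_{|x|\le 2\Delta}.$$ (ii) If $\lim_{n\to\infty}\max\{\nu_1(n),\dots,\nu_m(n)\}=0$, then $\Phi_{n^{-1/2}\overline{\mathbf{X}}_{n,m}}(x)$ converges weakly in probability, as $n\to\infty$, to the distribution $\Phi(x)$ with density $$\phi(x)=\frac{1}{2\pi\sigma_2^2}\sqrt{4\sigma_2^2-x^2}\;\mathbf{1}_{|x|\le 2\sigma_2}.$$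
   Context: For each $n$, let $[n]=\{1,\dots,n\}$ be partitioned into parts $V_1,\dots,V_m$, $m=m(n)\ge2$, with $|V_i|=n\nu_i=n\nu_i(n)$. A random multipartite matrix $\mathbf{X}_{n,m}=(x_{ij})_{1\le i,j\le n}$ is a random matrix whose entries $x_{ij}$ are independent random variables up to the symmetry $x_{ij}=x_{ji}$, such that $x_{ij}$ has distribution $F_1$ if $i$ and $j$ lie in the same part, and distribution $F_2$ if $i$ and $j$ lie in different parts, and such that $|x_{ij}|\le K$ for some constant $K$. Let $\mu_i=\int x\,dF_i$ be the mean and $\sigma_i^2$ the variance of $F_i$ ($i=1,2$). Let $\mathbf{J}_n$ be the $n\times n$ all-ones matrix and $\mathbf{I}_{n,m}$ the $n\times n$ matrix whose $(p,q)$ entry is $1$ if $p,q$ lie in the same part and $0$ otherwise. The centered matrix is $\overline{\mathbf{X}}_{n,m}=\mathbf{X}_{n,m}-\mu_1\mathbf{I}_{n,m}-\mu_2(\mathbf{J}_n-\mathbf{I}_{n,m})$, in which each entry has mean $0$. For a real symmetric $n\times n$ matrix $\mathbf{M}$ with eigenvalues $\lambda_1,\dots,\lambda_n$, the empirical spectral distribution is $\Phi_{\mathbf{M}}(x)=\frac1n\#\{i:\lambda_i\le x\}$. *)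

(* Defs.v *)
From mathcomp Require Import all_boot all_order all_algebra.
From mathcomp Require Import polyrcf.
From mathcomp Require Import all_classical all_reals all_analysis.

Set Implicit Arguments.
Unset Strict Implicit.
Unset Printing Implicit Defensive.

Import Order.TTheory GRing.Theory Num.Theory.
Import numFieldNormedType.Exports.

Local Open Scope classical_set_scope.
Local Open Scope ring_scope.

(* Mutual independence of the subfamily of [X] indexed by [D]. *)
Definition mutually_independent (R : realType) (d : measure_display)
    (T : measurableType d) (P : probability T R) (I : finType) (D : {set I})
    (X : I -> {RV P >-> R}) : Prop :=
  forall (J : {set I}) (B : I -> set R), J \subset D ->
    (forall i, measurable (B i)) ->
    P [set w | forall i, i \in J -> B i (X i w)]
    = (\prod_(i in J) P (X i @^-1` B i))%E.

(* A partition V_1, ..., V_m of the index set is encoded by the function [V]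
   sending each index to the label of its part. *)
Definition part_fraction (R : realType) (n m : nat) (V : 'I_n -> 'I_m)
    (i : 'I_m) : R :=
  #|[set p | V p == i]%SET|%:R / n%:R.

Definition max_part_fraction (R : realType) (n m : nat) (V : 'I_n -> 'I_m) : R :=
  \big[Num.max/0]_(i < m) part_fraction R V i.

Record random_multipartite (R : realType) (d : measure_display)
    (T : measurableType d) (P : probability T R) (n m : nat)
    (V : 'I_n -> 'I_m) (F1 F2 : probability (measurableTypeR R) R) (K : R)
    (x : 'I_n -> 'I_n -> {RV P >-> R}) : Prop := RandomMultipartite {
  entries_symmetric : forall i j w, x i j w = x j i w;
  entries_independent :
    mutually_independent [set ij : 'I_n * 'I_n | (ij.1 <= ij.2)%N]%SET
      (fun ij => x ij.1 ij.2);
  entries_within_parts : forall i j, V i = V j ->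
    forall A, measurable A -> distribution P (x i j) A = F1 A;
  entries_between_parts : forall i j, V i <> V j ->
    forall A, measurable A -> distribution P (x i j) A = F2 A;
  entries_bounded : forall i j, {ae P, forall w, `|x i j w| <= K}
}.

Definition law_mean (R : realType) (F : probability (measurableTypeR R) R) : R :=
  fine ('E_F[idfun])%E.

Definition law_variance (R : realType)
    (F : probability (measurableTypeR R) R) : R :=
  fine ('V_F[idfun])%E.

Definition same_part_mx (R : realType) (n m : nat) (V : 'I_n -> 'I_m) : 'M[R]_n :=
  \matrix_(p, q) (V p == V q)%:R.

Definition sample_mx (R : realType) (T : Type) (n : nat)
    (x : 'I_n -> 'I_n -> T -> R) (w : T) : 'M[R]_n :=
  \matrix_(i, j) x i j w.

Definition centered_mx (R : realType) (n m : nat) (V : 'I_n -> 'I_m)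
    (mu1 mu2 : R) (X : 'M[R]_n) : 'M[R]_n :=
  X - mu1 *: same_part_mx R V - mu2 *: (const_mx 1 - same_part_mx R V).

(* The real eigenvalues, each repeated according to its multiplicity as a root
   of the characteristic polynomial; for a symmetric matrix these are all the
   eigenvalues. *)
Definition eigenvalues (R : realType) (n : nat) (M : 'M[R]_n) : seq R :=
  flatten [seq nseq (mup a (char_poly M)) a | a <- rootsR (char_poly M)].

Definition esd (R : realType) (n : nat) (M : 'M[R]_n) (t : R) : R :=
  (count (fun a => a <= t)%R (eigenvalues M))%:R / n%:R.

(* Semicircle density of variance [v], meaningful for 0 < v. *)
Definition semicircle_pdf (R : realType) (v : R) (t : R) : R :=
  if `|t| <= 2 * Num.sqrt v
  then (2 * pi * v)^-1 * Num.sqrt (4 * v - t ^+ 2) else 0.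

Definition semicircle_cdf (R : realType) (v : R) (t : R) : R :=
  Rintegral lebesgue_measure `]-oo, t] (semicircle_pdf v).

(* The n-th random distribution function may live on its own probability space;
   weak convergence is pointwise convergence at the continuity points of the
   limit. *)
Definition cvg_weakly_in_probability (R : realType) (d : nat -> measure_display)
    (T : forall n, measurableType (d n)) (P : forall n, probability (T n) R)
    (Phi : forall n, T n -> R -> R) (Psi : R -> R) : Prop :=
  forall t : R, {for t, continuous Psi} -> forall eps : R, 0 < eps ->
    P n [set w | eps < `|Phi n w t - Psi t|] @[n --> \oo] --> 0%E.

Definition Delta2 (R : realType) (v1 v2 : R) (m : nat) : R :=
  (v1 + (m%:R - 1) * v2) / m%:R.

(* Main.v *)
(* Let G(i eta) = (M - i eta)^-1, M the normalized matrix. By the Schur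
   complement formula G_ii is -1 / (i eta - M_ii + r G' r^T), where G' is the
   resolvent of the minor with row and column i removed and r is the rest of
   row i, independent of G'. The quadratic form concentrates at the weighted sum
   of the G'_jj, the weights summing to about s, the limiting row variance. If
   eta is large, the map g |-> -1 / (i eta + s g) is a contraction; as the diagonal
   of the minors is controlled in the same way, finitely many iterations
   already force tr G(i eta) / n to the Stieltjes transform of the semicircle
   law of variance s, in mean square. No convergence near the real axis is needed:
   difference quotients in v = eta^2 give the convergence of the spectral means of
   x^j / (x^2 + v)^k, j <= k, hence of all polynomials in x / (x^2 + v) and of
   v / (x^2 + v). For large v these sandwich the indicator of a half line
   up to a multiple of x^2 / (x^2 + v), whose semicircle mean is at most s / v.

   In both cases of the theorem the row variance is v2 + nu_i (v1 - v2), nu_i being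
   the size fraction of the part containing the row. It tends to v2 if max nu
   tends to 0. In the balanced case m (max nu) tends to 1 with max nu
   bounded away from 0, so that the integer m is eventually constant and
   nu_i is close to 1/m. *)

Require Import Defs.
From mathcomp Require Import all_boot all_order all_algebra.
From mathcomp Require Import spectral polyrcf complex ring lra.
From mathcomp Require Import all_classical all_reals all_analysis measurable_realfun.

Set Implicit Arguments.
Unset Strict Implicit.
Unset Printing Implicit Defensive.

Import Order.TTheory GRing.Theory Num.Theory.
Import numFieldNormedType.Exports.

Local Open Scope classical_set_scope.
Local Open Scope ring_scope.

(** * The resolvent on the imaginary axis *)

(** The resolvent of a minor is never compared with that of the full matrix. Instead the mean square
    error of a diagonal entry is bounded for all sets of removed indices at once, and the bound for
    [S] is derived from the bound for [S] with one more index. Such a step halves the error and adds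
    a small remainder, because the centered entries are at most [2 |K| / sqrt n] and [eta] is large
    compared with [K]. The number [N] of steps is fixed before [n], so a row loses at most [N]
    entries, which alters its variance by O(1/n). Measurability is a second concern, since an
    eigenvalue count is not continuous in the matrix. It is carried along with convergence: spectral
    means are measurable for the resolvent kernels, then for polynomials in [x / (x^2 + v)], and
    finally for half lines as pointwise limits of these. The semicircle law enters only through its
    integrals against the resolvent kernels. The even kernel is integrated by an explicit primitive,
    and letting [eta] grow in the result gives the total mass. *)

Section Resolvent.
Variables (R : realType) (n : nat) (eta : R).
Hypothesis eta_gt0 : 0 < eta.

(* [res_re M + 'i * res_im M] is the resolvent [(M - 'i * eta)^-1]: working with its
   real and imaginary parts avoids complex matrices. *)
Definition quad_res (M : 'M[R]_n) : 'M[R]_n := invmx (M *m M + (eta ^+ 2)%:M).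
Definition res_re (M : 'M[R]_n) : 'M[R]_n := M *m quad_res M.
Definition res_im (M : 'M[R]_n) : 'M[R]_n := eta *: quad_res M.

Lemma sqnormE m (u : 'rV[R]_m) : (u *m u^T) 0 0 = \sum_j u 0 j ^+ 2.
Proof. by rewrite mxE; apply: eq_bigr => j _; rewrite mxE expr2. Qed.

Lemma sqnorm_ge0 m (u : 'rV[R]_m) : 0 <= (u *m u^T) 0 0.
Proof. by rewrite sqnormE sumr_ge0 // => j _; rewrite sqr_ge0. Qed.

(** For symmetric [M], [u (M^2 + eta^2) u^T = |u M|^2 + eta^2 |u|^2], so the kernel is trivial. *)
Lemma quad_res_unit (M : 'M[R]_n) : M^T = M -> M *m M + (eta ^+ 2)%:M \in unitmx.
Proof.
move=> sM; suff inj (u : 'rV[R]_n) : u *m (M *m M + (eta ^+ 2)%:M) = 0 -> u = 0.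
  rewrite -row_free_unit -kermx_eq0; apply/eqP/row_matrixP => i.
  by rewrite row0; apply: inj; rewrite -row_mul mulmx_ker row0.
move=> /(congr1 (fun w => (w *m u^T) 0 0)).
rewrite mul0mx [RHS]mxE mulmxDr mulmxDl mul_mx_scalar -scalemxAl.
have -> : u *m (M *m M) *m u^T = (u *m M) *m (u *m M)^T.
  by rewrite trmx_mul sM !mulmxA.
rewrite mxE [X in _ + X]mxE => h.
have h1 := sqnorm_ge0 (u *m M); have h2 := sqnorm_ge0 u.
have e2 : 0 < eta ^+ 2 by rewrite exprn_gt0.
have : (u *m u^T) 0 0 = 0.
  by apply/eqP; rewrite eq_le h2 andbT -(pmulr_rle0 _ e2); lra.
rewrite sqnormE => /psumr_eq0P h3; apply/rowP => j; rewrite [RHS]mxE.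
apply/eqP; rewrite -sqrf_eq0; apply/eqP.
by apply: h3 => // k _; rewrite sqr_ge0.
Qed.

Variable M : 'M[R]_n.
Hypothesis sM : M^T = M.
Local Notation X := (res_re M).
Local Notation Y := (res_im M).
Local Notation A := (quad_res M).

Lemma mul_quad_res : (M *m M + (eta ^+ 2)%:M) *m A = 1%:M.
Proof. by rewrite mulmxV // quad_res_unit. Qed.

Lemma quad_res_mul : A *m (M *m M + (eta ^+ 2)%:M) = 1%:M.
Proof. by rewrite mulVmx // quad_res_unit. Qed.

Lemma quad_res_comm : M *m A = A *m M.
Proof.
have h : (M *m M + (eta ^+ 2)%:M) *m M = M *m (M *m M + (eta ^+ 2)%:M).
  by rewrite mulmxDl mulmxDr mulmxA mul_scalar_mx mul_mx_scalar.
transitivity (A *m ((M *m M + (eta ^+ 2)%:M) *m M) *m A).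
  by rewrite (mulmxA A) quad_res_mul mul1mx.
by rewrite h -!mulmxA mul_quad_res mulmx1.
Qed.

Lemma quad_res_sym : A^T = A.
Proof. by rewrite /quad_res trmx_inv linearD /= trmx_mul tr_scalar_mx sM. Qed.

Lemma res_re_sym : X^T = X.
Proof. by rewrite /res_re trmx_mul quad_res_sym sM quad_res_comm. Qed.

Lemma res_im_sym : Y^T = Y.
Proof. by rewrite /res_im linearZ /= quad_res_sym. Qed.

Lemma mul_res_re : M *m X + eta *: Y = 1%:M.
Proof.
rewrite /res_re /res_im mulmxA scalerA -expr2 -mul_scalar_mx -mulmxDl.
by rewrite mul_quad_res.
Qed.

Lemma mul_res_im : M *m Y = eta *: X.
Proof. by rewrite /res_im -scalemxAr. Qed.

Lemma res_re_mul : X *m M + eta *: Y = 1%:M.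
Proof.
have /(congr1 trmx) := mul_res_re.
by rewrite linearD linearZ /= trmx_mul res_re_sym res_im_sym sM trmx1.
Qed.

Lemma res_im_mul : Y *m M = eta *: X.
Proof.
have /(congr1 trmx) := mul_res_im.
by rewrite trmx_mul [RHS]linearZ /= res_re_sym res_im_sym sM.
Qed.

(** The Ward identity [G G^* = Im G / eta]. Read on the diagonal, it bounds the squared norm of
    every row of the resolvent by [eta^-2], uniformly in [n]; the concentration of quadratic forms
    relies on this bound. *)
Lemma ward : eta *: (X *m X + Y *m Y) = Y.
Proof.
congr (_ *: _); transitivity (A *m (M *m M + (eta ^+ 2)%:M) *m A); last first.
  by rewrite quad_res_mul mul1mx.
rewrite mulmxDr mulmxDl {1}/res_re quad_res_comm /res_re /res_im.
by rewrite mul_mx_scalar -scalemxAr -!scalemxAl scalerA -expr2 !mulmxA.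
Qed.

Lemma ward_diag i : eta * \sum_j (X i j ^+ 2 + Y i j ^+ 2) = Y i i.
Proof.
rewrite -[in RHS]ward mxE; congr (_ * _); rewrite 3!mxE -big_split /=.
apply: eq_bigr => j _; rewrite !expr2; congr (_ * _ + _ * _).
  by rewrite -[in LHS]res_re_sym mxE.
by rewrite -[in LHS]res_im_sym mxE.
Qed.

Lemma sum_res_ge0 i : 0 <= \sum_j (X i j ^+ 2 + Y i j ^+ 2).
Proof. by apply: sumr_ge0 => j _; rewrite addr_ge0 ?sqr_ge0. Qed.

Lemma res_im_ge0 i : 0 <= Y i i.
Proof. by rewrite -ward_diag mulr_ge0 ?sum_res_ge0 // ltW. Qed.

Lemma res_im_le i : Y i i <= eta^-1.
Proof.
have h : eta * Y i i ^+ 2 <= Y i i.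
  rewrite -[leRHS]ward_diag ler_wpM2l ?(ltW eta_gt0) // (bigD1 i) //=.
  have := sqr_ge0 (X i i).
  have : 0 <= \sum_(j | j != i) (X i j ^+ 2 + Y i j ^+ 2).
    by apply: sumr_ge0 => j _; rewrite addr_ge0 ?sqr_ge0.
  lra.
have := res_im_ge0 i; rewrite le_eqVlt => /orP[/eqP<-|Y0].
  by rewrite invr_ge0 ltW.
by rewrite -[_^-1]mul1r ler_pdivlMr // mulrC -(ler_pM2r Y0) mul1r -mulrA -expr2.
Qed.

Lemma sum_res_le i : \sum_j (X i j ^+ 2 + Y i j ^+ 2) <= eta ^- 2.
Proof.
rewrite -(ler_pM2l eta_gt0) ward_diag (le_trans (res_im_le i)) //.
by rewrite expr2 invfM mulrA divff ?mul1r // gt_eqF.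
Qed.
End Resolvent.

Lemma sum_res_re_le (R : realType) n eta (M : 'M[R]_n) i : 0 < eta -> M^T = M ->
  \sum_j res_re eta M i j ^+ 2 <= eta ^- 2.
Proof.
move=> e0 sM; apply: le_trans (sum_res_le e0 sM i).
by apply: ler_sum => j _; rewrite lerDl sqr_ge0.
Qed.

Lemma sum_res_im_le (R : realType) n eta (M : 'M[R]_n) i : 0 < eta -> M^T = M ->
  \sum_j res_im eta M i j ^+ 2 <= eta ^- 2.
Proof.
move=> e0 sM; apply: le_trans (sum_res_le e0 sM i).
by apply: ler_sum => j _; rewrite lerDr sqr_ge0.
Qed.

(** * The Schur complement formula on the diagonal of the resolvent *)

Section Schur.
Variables (R : realType) (n : nat) (eta : R).
Hypothesis eta_gt0 : 0 < eta.

(* Zeroing the rows and columns in [S], instead of deleting them, keeps the size [n]. *)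
Definition zero_rc (M : 'M[R]_n) (S : {set 'I_n}) : 'M[R]_n :=
  \matrix_(j, k) if (j \in S) || (k \in S) then 0 else M j k.

Lemma zero_rc_sym M S : M^T = M -> (zero_rc M S)^T = zero_rc M S.
Proof.
move=> sM; apply/matrixP => j k; rewrite !mxE orbC.
by case: ifP => // _; rewrite -[in LHS]sM mxE.
Qed.

Lemma zero_rc1 M S i : zero_rc (zero_rc M S) [set i]%SET = zero_rc M (i |: S).
Proof.
apply/matrixP => j k; rewrite !mxE !inE.
by do 4!case: (_ \in _) || case: eqP.
Qed.

Variables (M : 'M[R]_n) (i : 'I_n).
Hypothesis sM : M^T = M.
Let M' := zero_rc M [set i]%SET.
Definition offdiag_row : 'rV[R]_n := \row_j if j == i then 0 else M i j.
Local Notation r := offdiag_row.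
Let u := r *m res_re eta M'.
Let w := r *m res_im eta M'.
Let qX := (r *m res_re eta M' *m r^T) 0 0.
Let qY := (r *m res_im eta M' *m r^T) 0 0.

Let sM' : M'^T = M'. Proof. exact: zero_rc_sym. Qed.

Let M'_i (v : 'rV[R]_n) : (v *m M') 0 i = 0.
Proof. by rewrite mxE big1 // => k _; rewrite mxE !inE eqxx orbT mulr0. Qed.

Let uM' : u *m M' = r + (- eta) *: w.
Proof.
have e : res_re eta M' *m M' = 1%:M - eta *: res_im eta M'.
  by rewrite -(res_re_mul eta_gt0 sM') addrK.
by rewrite /u /w -mulmxA e mulmxBr mulmx1 scaleNr scalemxAr.
Qed.

Let wM' : w *m M' = eta *: u.
Proof. by rewrite /u /w -mulmxA (res_im_mul eta_gt0 sM') -scalemxAr. Qed.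

(** Column [i] of [M'] vanishes, hence so does entry [i] of [w M' = eta u]: the resolvent of the
    minor does not link [i] to the indices on which [r] is supported. *)
Let u_i : u 0 i = 0.
Proof.
have h : eta * u 0 i = 0 by have := M'_i w; rewrite wM' mxE.
by move/eqP: h; rewrite mulf_eq0 gt_eqF //= => /eqP.
Qed.

Let w_i : w 0 i = 0.
Proof.
have := M'_i u; rewrite uM' !mxE eqxx add0r => /eqP.
by rewrite mulf_eq0 oppr_eq0 gt_eqF //= => /eqP.
Qed.

Let dot (a : 'rV[R]_n) (b : 'cV[R]_n) := (a *m b) 0 0.

(** [M] and [M'] differ only in row and column [i]. Against a vector vanishing at [i] the row has no
    effect, and the column contributes [g_i] times the pairing of [v] with [r]. *)
Let dotE (v : 'rV[R]_n) (g : 'cV[R]_n) : v 0 i = 0 ->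
  dot (v *m M') g = dot v (M *m g) - g i 0 * dot v r^T.
Proof.
move=> vi; rewrite /dot -mulmxA [LHS]mxE [X in X - _]mxE [X in _ * X]mxE.
rewrite mulr_sumr -sumrB; apply: eq_bigr => j _.
have [->|ji] := eqVneq j i; first by rewrite vi !mul0r mulr0 subr0.
rewrite mulrCA -mulrBr; congr (_ * _).
rewrite [LHS]mxE [X in X - _]mxE mxE [r _ _]mxE (negbTE ji).
rewrite (bigD1 i) //= [in RHS](bigD1 i) //= !mxE !inE eqxx orbT mul0r add0r.
have -> : M i j = M j i by rewrite -[in LHS]sM mxE.
rewrite [g i 0 * _]mulrC addrC addrK; apply: eq_bigr => k ki.
by rewrite !mxE !inE (negbTE ji) (negbTE ki).
Qed.

Let row_iE (g : 'cV[R]_n) : (M *m g) i 0 = M i i * g i 0 + dot r g.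
Proof.
rewrite /dot !mxE (bigD1 i) //= [in RHS](bigD1 i) //= [r _ _]mxE eqxx mul0r add0r.
by congr (_ + _); apply: eq_bigr => k ki; rewrite mxE (negbTE ki).
Qed.

Let dotD v w' g : dot (v + w') g = dot v g + dot w' g.
Proof. by rewrite /dot mulmxDl mxE. Qed.
Let dotZ c v g : dot (c *: v) g = c * dot v g.
Proof. by rewrite /dot -scalemxAl mxE. Qed.
Let dotDr v g h : dot v (g + h) = dot v g + dot v h.
Proof. by rewrite /dot mulmxDr mxE. Qed.
Let dotZr c v g : dot v (c *: g) = c * dot v g.
Proof. by rewrite /dot -scalemxAr mxE. Qed.

(** These are the real and imaginary parts of [G_ii (M_ii - i eta - r G' r^T) = 1], stated without
    division. Column [i] of [(M - i eta) G = 1] is read at row [i] and paired with [u = r X'] and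
    [w = r Y']; eliminating the pairings with [g] and [h] is linear. *)
Lemma schur_complement :
  res_re eta M i i * (M i i - qX) + res_im eta M i i * (eta + qY) = 1 /\
  res_im eta M i i * (M i i - qX) - res_re eta M i i * (eta + qY) = 0.
Proof.
pose g := col i (res_re eta M); pose h := col i (res_im eta M).
have e1 : M *m g = delta_mx i 0 + (- eta) *: h.
  have e : M *m res_re eta M = 1%:M - eta *: res_im eta M.
    by rewrite -(mul_res_re eta_gt0 sM) addrK.
  by rewrite /g /h !colE mulmxA e mulmxBl mul1mx scaleNr -scalemxAl.
have e2 : M *m h = eta *: g.
  by rewrite /g /h !colE mulmxA mul_res_im -scalemxAl.
have d0 (v : 'rV[R]_n) : v 0 i = 0 -> dot v (delta_mx i 0) = 0.
  by move=> vi; rewrite /dot -colE mxE.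
have := dotE g u_i; have := dotE g w_i; have := dotE h u_i; have := dotE h w_i.
rewrite uM' wM' e1 e2 !dotD !dotDr !d0 // !dotZ !dotZr.
have gi : g i 0 = res_re eta M i i by rewrite /g mxE.
have hi : h i 0 = res_im eta M i i by rewrite /h mxE.
have mxB (a b : 'cV[R]_n) : (a + b) i 0 = a i 0 + b i 0 by rewrite mxE.
have mxZ c (a : 'cV[R]_n) : (c *: a) i 0 = c * a i 0 by rewrite mxE.
have mx1 : (delta_mx i 0 : 'cV[R]_n) i 0 = 1 by rewrite mxE !eqxx.
have := row_iE g; have := row_iE h.
rewrite e1 e2 !mxB !mxZ mx1 gi hi.
rewrite -[dot u r^T]/qX -[dot w r^T]/qY => f1 f2 f3 f4 f5 f6.
split; lra.
Qed.

End Schur.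

(* With G = X + iY and m = ib, this is |G - m|^2 = |G|^2 |m|^2 |1/m - 1/G|^2,
   where 1/G = a - i(eta + q) and 1/m = -i(eta + s b). *)
Lemma schur_stability (R : realType) (eta s b X Y a q : R) : 0 < eta -> 0 <= s -> 0 < b ->
  eta * b + s * b ^+ 2 = 1 -> X * a + Y * (eta + q) = 1 ->
  Y * a - X * (eta + q) = 0 -> X ^+ 2 + Y ^+ 2 <= eta ^- 2 ->
  X ^+ 2 + (Y - b) ^+ 2 <= eta ^- 4 * (a ^+ 2 + (q - s * b) ^+ 2).
Proof.
move=> e0 s0 b0 hb h1 h2 hXY.
have eX : X = b * (Y * a - X * (q - s * b)).
  transitivity (X * (eta * b + s * b ^+ 2) + b * (Y * a - X * (eta + q))); last by ring.
  by rewrite hb h2; ring.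
have eY : Y - b = - b * (X * a + Y * (q - s * b)).
  transitivity (Y * (eta * b + s * b ^+ 2) - b * (X * a + Y * (eta + q))); last by ring.
  by rewrite hb h1; ring.
have -> : X ^+ 2 + (Y - b) ^+ 2
    = (X ^+ 2 + Y ^+ 2) * b ^+ 2 * (a ^+ 2 + (q - s * b) ^+ 2).
  by rewrite eY {1}eX; ring.
rewrite ler_wpM2r ?addr_ge0 ?sqr_ge0 //.
have eb : b <= eta^-1.
  rewrite -[_^-1]mul1r ler_pdivlMr // mulrC -hb lerDl mulr_ge0 //.
  by rewrite sqr_ge0.
have b2 : b ^+ 2 <= eta ^- 2.
  by rewrite -exprVn lerXn2r // nnegrE ?invr_ge0 ltW.
have -> : eta ^- 4 = eta ^- 2 * eta ^- 2 by rewrite -invfM -exprD.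
by rewrite ler_pM ?sqr_ge0 // addr_ge0 ?sqr_ge0.
Qed.

(** * Spectral decomposition and resolvent traces *)

Section SpectralTrace.
Variable R : realType.

(** Serves to identify [eigenvalues], which is read off the characteristic polynomial, with the
    diagonal of a diagonalization. Root multiplicity is additive on products, so it counts
    occurrences in [s]. *)
Lemma perm_eq_roots_mup (s : seq R) (p : {poly R}) :
  p = \prod_(a <- s) ('X - a%:P) ->
  perm_eq (flatten [seq nseq (mup a p) a | a <- rootsR p]) s.
Proof.
move=> pE; have p0 : p != 0.
  by rewrite pE monic_neq0 // monic_prod // => a _; exact: monicXsubC.
have mE x : mup x p = count_mem x s.
  rewrite {p0}pE; elim: s => [|a s IH].
    by rewrite big_nil mupNroot // root1.
  rewrite big_cons mupM ?IH ?polyXsubC_eq0 //; last first.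
    by rewrite monic_neq0 // monic_prod // => c _; exact: monicXsubC.
  by rewrite -[X in mup _ X]expr1 mup_XsubCX /=; case: (a == x).
apply/allP => x _ /=; apply/eqP; rewrite -[RHS]mE count_flatten -map_comp.
have cE (mu : R -> nat) r : sumn [seq (count_mem x \o (fun a => nseq (mu a) a)) a | a <- r]
    = (count_mem x r * mu x)%N.
  elim: r => //= a r ->; rewrite count_nseq mulnDl /=.
  by case: eqP => [->|].
rewrite cE count_uniq_mem; last exact: uniq_roots.
have [xr|xr] := boolP (x \in rootsR p); first by rewrite mul1n.
rewrite mul0n mupNroot //; apply: contra xr => px.
by rewrite -(roots_on_rootsR p0 x) px.
Qed.

Lemma map_mx_inverse (A B : comNzRingType) (f : {rmorphism A -> B}) n
    (X N : 'M[A]_n) (Y : 'M[B]_n) :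
  X *m N = 1%:M -> map_mx f N *m Y = 1%:M -> map_mx f X = Y.
Proof.
move=> XN /(congr1 (mulmx (map_mx f X))).
by rewrite mulmxA -map_mxM XN map_mx1 mul1mx mulmx1.
Qed.

(** [M] is diagonalized as a Hermitian matrix over [R[i]]; the diagonal is real, and conjugation
    carries [quad_res eta M] to the diagonal matrix of the [(l_i^2 + eta^2)^-1]. The enumeration [l]
    does not depend on [eta]. *)
Lemma eigenvalues_symmetric n (M : 'M[R]_n) : M^T = M ->
  exists l : 'I_n -> R, perm_eq (eigenvalues M) [seq l i | i <- enum 'I_n] /\
   forall eta, 0 < eta ->
     \tr (res_re eta M) = \sum_i l i / (l i ^+ 2 + eta ^+ 2) /\
     \tr (res_im eta M) = \sum_i eta / (l i ^+ 2 + eta ^+ 2).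
Proof.
move=> sM; pose C := R[i]; pose f : {rmorphism R -> C} := real_complex R.
pose MC := map_mx f M.
have MCh : MC \is hermsymmx.
  apply: realsym_hermsym.
    by apply/is_hermitianmxP; rewrite expr0 scale1r map_mx_id // map_trmx sM.
  by apply/mxOverP => i j; rewrite mxE; apply/complex_realP; exists (M i j).
have /orthomx_spectralP := hermitian_normalmx MCh.
have := hermitian_spectral_diag_real MCh.
have := spectral_unit MC.
move: (spectralmx MC) (spectral_diag MC) => P D Pu /mxOverP Dreal MCE.
pose l i := complex.Re (D 0 i).
have DE : D = map_mx f (\row_i l i).
  by apply/rowP => i; rewrite !mxE; apply/esym; exact: RRe_real.
pose dg (w : 'I_n -> R) := map_mx f (diag_mx (\row_i w i)).
have dgM w w' : dg w *m dg w' = dg (fun i => w i * w' i).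
  rewrite /dg -map_mxM mulmx_diag; congr (map_mx f (diag_mx _)).
  by apply/rowP => i; rewrite !mxE.
have dgD w w' : dg w + dg w' = dg (fun i => w i + w' i).
  rewrite /dg -map_mxD -linearD; congr (map_mx f (diag_mx _)).
  by apply/rowP => i; rewrite !mxE.
have dgC c : (f c)%:M = dg (fun=> c).
  rewrite /dg -map_scalar_mx -diag_const_mx; congr (map_mx f (diag_mx _)).
  by apply/rowP => i; rewrite !mxE.
pose cj A := invmx P *m A *m P.
have cjM A B : cj A *m cj B = cj (A *m B).
  by rewrite /cj !mulmxA mulmxK.
have cjD A B : cj A + cj B = cj (A + B).
  by rewrite /cj mulmxDr mulmxDl.
have cjC c : cj (c%:M) = c%:M.
  by rewrite /cj mul_mx_scalar -scalemxAl mulVmx // scalemx1.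
have tr_cj w : \tr (cj (dg w)) = f (\sum_i w i).
  rewrite /cj mxtrace_mulC mulmxA mulmxV // mul1mx /dg trace_map_mx mxtrace_diag.
  by congr (f _); apply: eq_bigr => i _; rewrite mxE.
have MCd : MC = cj (dg l).
  by rewrite /cj /dg map_diag_mx -DE; exact: MCE.
exists l; split.
  apply: perm_eq_roots_mup; rewrite big_map big_enum /=.
  apply: (@map_inj_poly _ _ f) => //; first exact: complexI.
  transitivity (char_poly MC); first exact: map_char_poly.
  rewrite rmorph_prod /=.
  transitivity (char_poly (dg l)); last first.
    rewrite char_poly_trig; last by rewrite /dg map_diag_mx diag_mx_is_trig.
    apply: eq_bigr => i _.
    by rewrite rmorphB /= map_polyX map_polyC /= !mxE eqxx.
  rewrite MCd /char_poly.
  have -> : char_poly_mx (cj (dg l))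
    = map_mx polyC (invmx P) *m char_poly_mx (dg l) *m map_mx polyC P.
    rewrite /char_poly_mx mulmxBr mulmxBl !map_mxM /=; congr (_ - _).
    by rewrite mul_mx_scalar -scalemxAl -map_mxM mulVmx // map_mx1 scalemx1.
  rewrite !det_mulmx mulrAC -det_mulmx -map_mxM mulVmx // map_mx1 det1 mul1r //.
move=> eta e0.
have pos i : l i ^+ 2 + eta ^+ 2 != 0.
  by rewrite gt_eqF // ltr_wpDl ?sqr_ge0 // exprn_gt0.
pose q i := (l i ^+ 2 + eta ^+ 2)^-1.
have qE : map_mx f (quad_res eta M) = cj (dg q).
  have unitC := quad_res_unit e0 sM.
  have : map_mx f (M *m M + (eta ^+ 2)%:M) *m cj (dg q) = 1%:M.
    rewrite map_mxD map_mxM map_scalar_mx -/MC MCd cjM -[(f _)%:M]cjC cjD dgC dgM dgD cjM dgM.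
    rewrite -[RHS]cjC -(rmorph1 f) dgC; congr (cj (map_mx f (diag_mx _))).
    by apply/rowP => i; rewrite !mxE -expr2 mulfV.
  exact: map_mx_inverse (quad_res_mul e0 sM).
split; apply: (@complexI R); rewrite -/(f _) -trace_map_mx -/(f _).
  by rewrite map_mxM qE -/MC MCd cjM dgM tr_cj.
rewrite map_mxZ qE -mul_scalar_mx -cjC dgC cjM dgM tr_cj //.
Qed.
End SpectralTrace.

(** * Expectation and independence *)

Section BoundedMeasurable.
Context d (T : measurableType d) (R : realType).
Implicit Types f g : T -> R.

(** Bounded measurable functions form an algebra and are integrable for any probability, so all
    expectations below exist and are linear. *)
Definition bmf f := measurable_fun setT f /\ exists B : R, forall w, `|f w| <= B.

Lemma bmf_cst (c : R) : bmf (fun=> c).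
Proof. by split; [exact: measurable_cst|exists `|c|]. Qed.

Lemma bmfD f g : bmf f -> bmf g -> bmf (fun w => f w + g w).
Proof.
move=> [mf [A fA]] [mg [B gB]]; split; first exact: measurable_funD.
by exists (A + B) => w; rewrite (le_trans (ler_normD _ _)) // lerD.
Qed.

Lemma bmfM f g : bmf f -> bmf g -> bmf (fun w => f w * g w).
Proof.
move=> [mf [A fA]] [mg [B gB]]; split; first exact: measurable_funM.
by exists (A * B) => w; rewrite normrM ler_pM.
Qed.

Lemma bmfZ c f : bmf f -> bmf (fun w => c * f w).
Proof. exact: bmfM (bmf_cst c). Qed.

Lemma bmfN f : bmf f -> bmf (fun w => - f w).
Proof. by move/(bmfZ (-1)); under eq_fun do rewrite mulN1r. Qed.

Lemma bmfB f g : bmf f -> bmf g -> bmf (fun w => f w - g w).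
Proof. by move=> bf /bmfN; exact: bmfD. Qed.

Lemma bmfX f k : bmf f -> bmf (fun w => f w ^+ k).
Proof.
move=> bf; elim: k => [|k IH]; first exact: (bmf_cst 1).
by under eq_fun do rewrite exprS; exact: bmfM.
Qed.

Lemma bmf_sum (I : Type) (s : seq I) (p : pred I) (f : I -> T -> R) :
  (forall i, p i -> bmf (f i)) -> bmf (fun w => \sum_(i <- s | p i) f i w).
Proof.
move=> bf; elim: s => [|i s IH].
  by under eq_fun do rewrite big_nil; exact: bmf_cst.
under eq_fun do rewrite big_cons.
by case pi: (p i) => //; exact: bmfD (bf _ pi) IH.
Qed.

Lemma measurable_superlevel f c : measurable_fun setT f -> measurable [set w | c < f w].
Proof.
move=> mf; rewrite (_ : [set w | c < f w] = setT `&` f @^-1` [set` `]c, +oo[]).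
  exact: mf measurableT _ (measurable_itv _).
by apply/seteqP; split => w /=; rewrite in_itv /= andbT // => -[].
Qed.

Variable P : probability T R.
Definition Ex f : R := Rintegral P setT f.

Lemma bmf_integrable f : bmf f -> P.-integrable setT (EFin \o f).
Proof.
move=> [mf [B fB]]; apply: measurable_bounded_integrable => //.
  by rewrite ltey_eq fin_num_measure.
exists B; split; first exact: num_real.
by move=> x Bx w _ /=; rewrite (le_trans (fB w)) // ltW.
Qed.

Lemma ExD f g : bmf f -> bmf g -> Ex (fun w => f w + g w) = Ex f + Ex g.
Proof. by move=> bf bg; rewrite /Ex RintegralD //; exact: bmf_integrable. Qed.

Lemma ExB f g : bmf f -> bmf g -> Ex (fun w => f w - g w) = Ex f - Ex g.
Proof. by move=> bf bg; rewrite /Ex RintegralB //; exact: bmf_integrable. Qed.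

Lemma ExZ c f : bmf f -> Ex (fun w => c * f w) = c * Ex f.
Proof. by move=> bf; rewrite /Ex RintegralZl //; exact: bmf_integrable. Qed.

Lemma Ex_cst c : Ex (fun=> c) = c.
Proof. by rewrite /Ex Rintegral_cst // [X in fine X]probability_setT mulr1. Qed.

Lemma Ex_ge0 f : (forall w, 0 <= f w) -> 0 <= Ex f.
Proof. by move=> f0; exact: Rintegral_ge0. Qed.

Lemma Ex_le f g : bmf f -> bmf g -> (forall w, f w <= g w) -> Ex f <= Ex g.
Proof. by move=> bf bg fg; apply: le_Rintegral => //; exact: bmf_integrable. Qed.

Lemma Ex_sum (I : Type) (s : seq I) (p : pred I) (f : I -> T -> R) :
  (forall i, p i -> bmf (f i)) ->
  Ex (fun w => \sum_(i <- s | p i) f i w) = \sum_(i <- s | p i) Ex (f i).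
Proof.
move=> bf; elim: s => [|i s IH].
  by under eq_fun do rewrite big_nil; rewrite Ex_cst big_nil.
under eq_fun do rewrite big_cons.
rewrite big_cons; case pi: (p i) => //.
by rewrite ExD ?IH //; [exact: bf|exact: bmf_sum].
Qed.

Lemma ExE f : bmf f -> (Ex f)%:E = (\int[P]_w (f w)%:E)%E.
Proof. by move=> bf; rewrite /Ex fineK // integrable_fin_num // bmf_integrable. Qed.

Lemma Ex_sqr_sum (I : eqType) (s : seq I) (u : I -> T -> R) : uniq s ->
  (forall i, bmf (u i)) ->
  (forall i j, i != j -> Ex (fun w => u i w * u j w) = 0) ->
  Ex (fun w => (\sum_(i <- s) u i w) ^+ 2) = \sum_(i <- s) Ex (fun w => u i w ^+ 2).
Proof.
move=> us bu orth; elim: s us => [|i s IH] /=.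
  by move=> _; under eq_fun do rewrite big_nil expr0n /=; rewrite Ex_cst big_nil.
move=> /andP[si us].
have bs : bmf (fun w => \sum_(j <- s) u j w) by apply: bmf_sum => j _.
transitivity (Ex (fun w => (u i w ^+ 2 + (\sum_(j <- s) u j w) ^+ 2)
     + 2 * (\sum_(j <- s) u i w * u j w))).
  by apply: eq_Rintegral => w _; rewrite big_cons -mulr_sumr; ring.
rewrite ExD; last 2 first.
  by apply: bmfD; exact: bmfX.
  by apply/bmfZ/bmf_sum => j _; exact: bmfM.
rewrite ExD ?IH //; [|exact: bmfX|exact: bmfX].
rewrite ExZ; last by apply/bmf_sum => j _; exact: bmfM.
rewrite Ex_sum; last by move=> j _; exact: bmfM.
rewrite [X in 2 * X]big1_seq ?mulr0 ?addr0 ?big_cons // => j /andP[_ js].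
by apply: orth; apply: contra si => /eqP->.
Qed.

Definition indep_fun f g := forall A B : set R, measurable A -> measurable B ->
  P (f @^-1` A `&` g @^-1` B) = (P (f @^-1` A) * P (g @^-1` B))%E.

(** The law of [(f, g)] agrees with the product of the two laws on rectangles, hence everywhere;
    Fubini then splits the integral of the product. *)
Lemma Ex_indep f g : bmf f -> bmf g -> indep_fun f g ->
  Ex (fun w => f w * g w) = Ex f * Ex g.
Proof.
move=> bf bg ind.
have [mf _] := bf; have [mg _] := bg.
pose F : {mfun T >-> R} := mfun_Sub (mem_set mf).
pose G : {mfun T >-> R} := mfun_Sub (mem_set mg).
pose h (w : T) : R * R := (f w, g w).
have mh : measurable_fun setT h by exact/measurable_fun_pairP.
pose H : {mfun T >-> (R * R)%type} := mfun_Sub (mem_set mh).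
pose phi (xy : R * R) : \bar R := (xy.1 * xy.2)%:E.
have mphi : measurable_fun setT phi.
  by apply/measurable_EFinP/measurable_funM; [exact: measurable_fst|exact: measurable_snd].
have iphi : P.-integrable setT (phi \o H) := bmf_integrable (bmfM bf bg).
have prodE A : measurable A ->
    (distribution P F \x distribution P G)%E A = distribution P H A.
  move=> mA; apply: product_measure_unique; last exact: mA.
  by move=> B C mB mC; exact: (ind B C mB mC).
have iphi' : (distribution P F \x distribution P G)%E.-integrable setT phi.
  apply/integrableP; split=> //.
  rewrite (eq_measure_integral (distribution P H)); last by move=> A mA _; exact: prodE.
  have /integrableP[_] := @integrable_pushforward _ _ _ _ _ _ mh P setT phi mphi iphi measurableT.
  by [].
apply: EFin_inj; rewrite ExE; last exact: bmfM.
transitivity (\int[distribution P H]_z phi z)%E.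
  by rewrite integral_distribution.
rewrite -(eq_measure_integral _ (fun A mA _ => prodE A mA)).
rewrite -integral12_prod_meas1 //.
have iid (X : {mfun T >-> R}) : bmf X -> (distribution P X).-integrable setT EFin.
  move=> bX; apply: integrable_pushforward => //.
  exact: bmf_integrable bX.
transitivity (\int[distribution P F]_x (x%:E * (Ex g)%:E))%E.
  apply: eq_integral => x _.
  transitivity (\int[distribution P G]_y (x%:E * y%:E))%E; first by [].
  rewrite integralZl //; last exact: iid.
  rewrite (ExE bg); congr (_ * _)%E.
  by apply: integral_distribution => //; exact: bmf_integrable.
rewrite integralZr //; last exact: iid.
rewrite EFinM (ExE bf); congr (_ * _)%E.
by apply: integral_distribution => //; exact: bmf_integrable.
Qed.
End BoundedMeasurable.

(** * Independence of functions of disjoint groups of variables *)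

Section Independence.
Context d (T : measurableType d) (R : realType) (P : probability T R).
Variables (I : finType) (D : {set I}) (X : I -> {RV P >-> R}).
Hypothesis ind : mutually_independent D X.

(** A pi-system that generates the sigma-algebra of the variables indexed by [J]. *)
Definition cylinders (J : {set I}) : set (set T) :=
  [set A | exists2 B : I -> set R, (forall i, measurable (B i)) &
     A = [set w | forall i, i \in J -> B i (X i w)]].

(** Measurability with respect to the variables in [J] is [bmf] on the same set [T] with a smaller
    sigma-algebra. The closure properties of [bmf], and the measurability of resolvent entries, thus
    apply to it unchanged. *)
Definition sigma_bmf (J : {set I}) (f : T -> R) :=
  @bmf _ (g_sigma_algebraType (cylinders J)) R f.

Lemma cylinders_measurable J A : cylinders J A -> measurable A.
Proof.
move=> [B mB ->].
have -> : [set w | forall i, i \in J -> B i (X i w)]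
    = \bigcap_(i in [set` J]) (X i @^-1` B i).
  by apply/seteqP; split => w /= h i; exact: h.
apply: fin_bigcap_measurable => // i _.
by rewrite -[X in measurable X]setTI; exact: measurable_funP.
Qed.

Lemma cylinders_setI_closed J : setI_closed (cylinders J).
Proof.
move=> _ _ [B mB ->] [C mC ->]; exists (fun i => B i `&` C i).
  by move=> i; exact: measurableI.
apply/seteqP; split => w /=; first by move=> [h1 h2] i iJ; split; [exact: h1|exact: h2].
by move=> h; split => i /h [].
Qed.

Lemma sigma_cylinders_measurable J A : <<s cylinders J >> A -> measurable A.
Proof.
apply: (@smallest_sub _ (sigma_algebra setT) (cylinders J) measurable).
  exact: sigma_algebra_measurable.
exact: cylinders_measurable.
Qed.

Lemma cylinders_sub (J1 J2 : {set I}) : J1 \subset J2 -> cylinders J1 `<=` cylinders J2.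
Proof.
move=> /fintype.subsetP s12 _ [B mB ->].
exists (fun i => if i \in J1 then B i else setT).
  by move=> i; case: ifP.
apply/seteqP; split => w /= h i; first by move=> _; case: ifP => // /h.
by move=> iJ; have := h _ (s12 _ iJ); rewrite iJ.
Qed.

Lemma sigma_bmf_sub (J1 J2 : {set I}) f : J1 \subset J2 -> sigma_bmf J1 f -> sigma_bmf J2 f.
Proof.
move=> s12 [mf bf]; split=> // _ A mA.
have := mf measurableT A mA.
exact: (@sub_sigma_algebra2 _ setT _ _ (cylinders_sub s12)).
Qed.

Lemma sigma_bmf_bmf J f : sigma_bmf J f -> bmf f.
Proof.
by move=> [mf bf]; split=> // _ A mA; apply: (@sigma_cylinders_measurable J); exact: mf.
Qed.

Lemma sigma_bmf_comp (J : {set I}) i (phi : R -> R) : i \in J -> bmf phi ->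
  sigma_bmf J (fun w => phi (X i w)).
Proof.
move=> iJ [mphi [B phiB]]; split; last by exists B.
move=> _ A mA; rewrite setTI; apply: sub_sigma_algebra.
exists (fun j => if j == i then phi @^-1` A else setT).
  by move=> j; case: ifP => // _; rewrite -[X in measurable X]setTI; exact: mphi.
apply/seteqP; split => w /= h.
  by move=> j _; case: eqP => // ->.
by have := h _ iJ; rewrite eqxx.
Qed.

Lemma sigma_bmfM J f g : sigma_bmf J f -> sigma_bmf J g ->
  sigma_bmf J (fun w => f w * g w).
Proof. exact: bmfM. Qed.

Lemma sigma_bmfBr J f c : sigma_bmf J f -> sigma_bmf J (fun w => f w - c).
Proof. by move=> bf; exact: bmfB bf (bmf_cst _ _). Qed.

Lemma sigma_bmfX J f k : sigma_bmf J f -> sigma_bmf J (fun w => f w ^+ k).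
Proof. exact: bmfX. Qed.

(** The events independent of a fixed [B] form a Dynkin system: differences are handled by
    finiteness of [P], increasing unions by continuity from below. *)
Lemma lambda_indep B : measurable B ->
  lambda_system setT [set A | measurable A /\ P (A `&` B) = (P A * P B)%E].
Proof.
move=> mB; split => //.
- by split => //; rewrite setTI probability_setT mul1e.
- move=> A C CA [mA hA] [mC hC]; split; first exact: measurableD.
  have -> : (A `\` C) `&` B = (A `&` B) `\` (C `&` B).
    apply/seteqP; split => w /=; first by move=> [[a c] b]; split => // -[].
    by move=> [[a b] c]; split => //; split => // cc; apply: c.
  have AB := measurableI _ _ mA mB; have CB := measurableI _ _ mC mB.
  rewrite !measureD //; try by rewrite ltey_eq fin_num_measure.
  have -> : A `&` C = C by apply/seteqP; split=> w; [case|split=> //; exact: CA].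
  have -> : A `&` B `&` (C `&` B) = C `&` B.
    by rewrite setIACA setIid; congr (_ `&` _); apply/seteqP; split=> w; [case|split=> //; exact: CA].
  transitivity (P A * P B - P C * P B)%E; first by congr (_ - _)%E; [exact: hA|exact: hC].
  by rewrite muleBl //; [exact: fin_num_measure|rewrite fin_num_adde_defr // fin_num_measure].
- move=> F ndF hF; have mF i : measurable (F i) by have [] := hF i.
  have mU : measurable (\bigcup_i F i) by exact: bigcup_measurable.
  split => //; rewrite setI_bigcupl.
  have c1 : (P \o (fun i => F i `&` B)) @ \oo --> P (\bigcup_i (F i `&` B)).
    apply: nondecreasing_cvg_mu => //.
    - by move=> i; exact: measurableI.
    - by apply: bigcup_measurable => i _; exact: measurableI.
    - move=> i j ij; have /subsetPset Fij := ndF _ _ ij.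
      by apply/subsetPset => w [Fw Bw]; split=> //; exact: Fij.
  have c2 : (P \o F) @ \oo --> P (\bigcup_i F i) by exact: nondecreasing_cvg_mu.
  have c3 : (fun i => P (F i) * P B)%E @ \oo --> (P (\bigcup_i F i) * P B)%E.
    by apply: cvgeZr => //; exact: fin_num_measure.
  have e : P \o (fun i => F i `&` B) = (fun i => P (F i) * P B)%E.
    by apply/funext => i /=; have [] := hF i.
  by rewrite e in c1; exact: (cvg_unique _ c1 c3).
Qed.

Variables (J1 J2 : {set I}).
Hypotheses (s1 : J1 \subset D) (s2 : J2 \subset D) (dis : forall i, i \in J1 -> i \notin J2).

Lemma cylinders_indep A B : cylinders J1 A -> cylinders J2 B ->
  P (A `&` B) = (P A * P B)%E.
Proof.
move=> [B1 mB1 ->] [B2 mB2 ->].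
pose C i := if i \in J1 then B1 i else B2 i.
have -> : [set w | forall i, i \in J1 -> B1 i (X i w)]
   `&` [set w | forall i, i \in J2 -> B2 i (X i w)]
   = [set w | forall i, i \in J1 :|: J2 -> C i (X i w)].
  apply/seteqP; split => w /=; rewrite /C.
    by move=> [h1 h2] i; rewrite inE; case: ifP => [/h1//|_ /= /h2].
  move=> h; split => i iJ; have := h i; rewrite inE iJ ?orbT => /(_ isT) //.
  by case: ifP => // /dis; rewrite iJ.
have mC i : measurable (C i) by rewrite /C; case: ifP.
have sU : J1 :|: J2 \subset D by rewrite finset.subUset s1 s2.
rewrite (ind s1 mB1) (ind s2 mB2) (ind sU mC).
rewrite (bigID (mem J1)) /=; congr (_ * _)%E.
  by apply: eq_big => i; rewrite !inE; case: (boolP (i \in J1)) => //= iJ; rewrite ?andbF /C ?iJ.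
apply: eq_big => i; rewrite !inE.
  by case: (boolP (i \in J1)) => //= [/dis/negbTE->//|_]; rewrite andbT.
by case: (boolP (i \in J1)) => //= iJ _; rewrite /C (negbTE iJ).
Qed.

(** Dynkin's lemma is used twice: for [A] with [B] an arbitrary event of the second sigma-algebra,
    then for [B] with [A] a cylinder. *)
Lemma sigma_indep A B : <<s cylinders J1 >> A -> <<s cylinders J2 >> B ->
  P (A `&` B) = (P A * P B)%E.
Proof.
move=> hA hB; have mB := sigma_cylinders_measurable hB.
suff [] : [set A | measurable A /\ P (A `&` B) = (P A * P B)%E] A by [].
apply: (@lambda_system_subset _ (cylinders J1)) (hA) => //.
- exact: cylinders_setI_closed.
- exact: lambda_indep.
move=> {hA}A hA; have mA := cylinders_measurable hA; split => //.
rewrite setIC muleC.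
suff [] : [set B | measurable B /\ P (B `&` A) = (P B * P A)%E] B by [].
apply: (@lambda_system_subset _ (cylinders J2)) (hB) => //.
- exact: cylinders_setI_closed.
- exact: lambda_indep.
move=> {hB mB}B hB; split; first exact: cylinders_measurable hB.
by rewrite setIC muleC; exact: cylinders_indep.
Qed.

Lemma Ex_sigma_indep f g : sigma_bmf J1 f -> sigma_bmf J2 g ->
  Ex P (fun w => f w * g w) = Ex P f * Ex P g.
Proof.
move=> bf bg; apply: Ex_indep; [exact: sigma_bmf_bmf bf|exact: sigma_bmf_bmf bg|].
move=> A B mA mB; apply: sigma_indep.
  by have := bf.1 measurableT _ mA; rewrite setTI.
by have := bg.1 measurableT _ mB; rewrite setTI.
Qed.
End Independence.

(** * Measurability of the resolvent entries *)

Section MeasurableMatrix.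
Context d (T : measurableType d) (R : realType).

Definition measurable_mx m n (M : T -> 'M[R]_(m, n)) :=
  forall i j, measurable_fun setT (fun w => M w i j).

Lemma measurable_mxM m n p (M : T -> 'M[R]_(m, n)) (N : T -> 'M[R]_(n, p)) :
  measurable_mx M -> measurable_mx N -> measurable_mx (fun w => M w *m N w).
Proof.
move=> mM mN i j; under eq_fun do rewrite mxE.
by apply: measurable_sum => k; exact: measurable_funM.
Qed.

Lemma measurable_det n (M : T -> 'M[R]_n) :
  measurable_mx M -> measurable_fun setT (fun w => \det (M w)).
Proof.
move=> mM; apply: measurable_sum => s; apply: measurable_funM => //.
by apply: measurable_prod => i _; exact: mM.
Qed.

(** [1 / f = f exp (- ln (f^2))], where the square makes the logarithm meaningful whatever the sign
    of [f]. *)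
Lemma measurable_fun_inv (f : T -> R) : (forall w, f w != 0) ->
  measurable_fun setT f -> measurable_fun setT (fun w => (f w)^-1).
Proof.
move=> f0 mf.
have e w : (f w)^-1 = f w * expR (- ln (f w ^+ 2)).
  have p : 0 < f w ^+ 2 by rewrite exprn_even_gt0 //= f0.
  by rewrite expRN lnK ?posrE // expr2 invfM mulrA divff // mul1r.
under eq_fun do rewrite e.
apply: measurable_funM => //; apply: measurableT_comp; first exact: measurable_expR.
apply: measurable_funN; apply: measurableT_comp; first exact: measurable_ln.
exact: measurable_funX.
Qed.

(** Cramer's rule: cofactors and determinant are polynomials in the entries. *)
Lemma measurable_invmx n (M : T -> 'M[R]_n) : (forall w, M w \in unitmx) ->
  measurable_mx M -> measurable_mx (fun w => invmx (M w)).
Proof.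
move=> uM mM i j; under eq_fun do rewrite /invmx uM mxE.
apply: measurable_funM.
  apply: measurable_fun_inv; last exact: measurable_det.
  by move=> w; have := uM w; rewrite unitmxE unitfE.
under eq_fun do rewrite mxE /cofactor.
apply: measurable_funM => //; apply: measurable_det => k l.
by under eq_fun do rewrite !mxE; exact: mM.
Qed.

Variables (n : nat) (eta : R) (M : T -> 'M[R]_n).
Hypotheses (eta_gt0 : 0 < eta) (sM : forall w, (M w)^T = M w) (mM : measurable_mx M).

Lemma measurable_quad_res : measurable_mx (fun w => quad_res eta (M w)).
Proof.
apply: measurable_invmx => [w|i j]; first exact: quad_res_unit.
under eq_fun do rewrite mxE; apply: measurable_funD; first exact: measurable_mxM.
exact: measurable_cst.
Qed.

Lemma entry_le (f : 'I_n -> R) j : \sum_j f j ^+ 2 <= eta ^- 2 -> `|f j| <= eta^-1.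
Proof.
move=> h; rewrite -(@ler_pXn2r _ 2) ?nnegrE ?invr_ge0 ?(ltW eta_gt0) //.
rewrite exprVn real_normK ?num_real //; apply: le_trans h.
by rewrite (bigD1 j) //= lerDl sumr_ge0 // => k _; rewrite sqr_ge0.
Qed.

Lemma bmf_res_re i j : bmf (fun w => res_re eta (M w) i j).
Proof.
split; first by apply: measurable_mxM => //; exact: measurable_quad_res.
exists eta^-1 => w; apply: (entry_le (f := fun j => res_re eta (M w) i j)).
exact: sum_res_re_le.
Qed.

Lemma bmf_res_im i j : bmf (fun w => res_im eta (M w) i j).
Proof.
split.
  under eq_fun do rewrite mxE; apply: measurable_funM => //; exact: measurable_quad_res.
exists eta^-1 => w; apply: (entry_le (f := fun j => res_im eta (M w) i j)).
exact: sum_res_im_le.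
Qed.
End MeasurableMatrix.

(** * Concentration of quadratic forms *)

(** The unordered pair of [i] and [j], represented in the upper triangle, where the entries are
    independent. *)
Definition edge n (i j : 'I_n) : 'I_n * 'I_n := if (i <= j)%N then (i, j) else (j, i).

Lemma edge_le n (i j : 'I_n) : ((edge i j).1 <= (edge i j).2)%N.
Proof. by rewrite /edge; case: (leqP i j) => /= [|/ltnW]. Qed.

Lemma edge_inj n (i : 'I_n) : injective (edge i).
Proof.
move=> j k; rewrite /edge; case: leqP => ij; case: leqP => ik => -[] //.
  by move=> e1 e2; rewrite e2 e1.
by move=> e1 e2; rewrite e1 e2.
Qed.

Lemma sum_symmetric (R : comNzRingType) n (a : 'I_n -> 'I_n -> R) :
  (forall j l, a j l = a l j) ->
  \sum_(j < n) \sum_(l < n) a j l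
  = \sum_(j < n) a j j + 2 * \sum_(j < n) \sum_(l < n | (l < j)%N) a j l.
Proof.
move=> sa.
have h j : \sum_(l < n) a j l
    = a j j + (\sum_(l < n | (l < j)%N) a j l + \sum_(l < n | (j < l)%N) a j l).
  rewrite (bigD1 j) //=; congr (_ + _); rewrite (bigID (fun l : 'I_n => (l < j)%N)) /=.
  congr (_ + _); apply: eq_bigl => l; rewrite -val_eqE /=; case: ltngtP => //.
rewrite (eq_bigr _ (fun j _ => h j)) !big_split /= mulrDl mul1r; congr (_ + (_ + _)).
rewrite (exchange_big_dep xpredT) //=; apply: eq_bigr => j _.
by apply: eq_bigr => l _; exact: sa.
Qed.

Section QuadraticForm.
Context d (T : measurableType d) (R : realType) (P : probability T R) (n : nat).
Variable x : 'I_n * 'I_n -> {RV P >-> R}.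
Hypothesis ind : mutually_independent [set e : 'I_n * 'I_n | (e.1 <= e.2)%N]%SET x.
Variables (phi : 'I_n -> 'I_n -> R -> R) (beta : R).
Let y i j w := phi i j (x (edge i j) w).
Hypothesis bphi : forall i j, bmf (phi i j).
Hypothesis y_le : forall i j w, `|y i j w| <= beta.
Hypothesis Ey : forall i j, Ex P (y i j) = 0.

(** The entries that survive when the rows and columns in [U] are removed; the resolvent of that
    minor is a function of them. *)
Definition outer_edges (U : {set 'I_n}) : {set 'I_n * 'I_n} :=
  [set e : 'I_n * 'I_n | [&& (e.1 <= e.2)%N, e.1 \notin U & e.2 \notin U]]%SET.

Variables (U : {set 'I_n}) (i : 'I_n) (A : 'I_n -> 'I_n -> T -> R) (c : R).
Hypothesis iU : i \in U.
Hypothesis sA : forall j l, sigma_bmf x (outer_edges U) (A j l).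
Hypothesis symA : forall j l w, A j l w = A l j w.
Hypothesis A_le : forall j w, \sum_l A j l w ^+ 2 <= c.

Let r j w := if j \in U then 0 else y i j w.
Let s j := Ex P (fun w => r j w ^+ 2).
(** A filtration: the whole minor is known from the start, and the entries of row [i] are revealed
    one by one. At time [j] the entry [r j] is still independent of what is known. *)
Let J (j : 'I_n) : {set 'I_n * 'I_n} :=
  outer_edges U :|: [set edge i k | k : 'I_n & (k < j)%N].

Let D0 := [set e : 'I_n * 'I_n | (e.1 <= e.2)%N]%SET.

Let J_sub j : J j \subset D0.
Proof.
apply/fintype.subsetP => e; rewrite !inE => /orP[/and3P[]//|/imsetP[k _ ->]].
exact: edge_le.
Qed.

Let e_sub j : [set edge i j]%SET \subset D0.
Proof. by rewrite finset.sub1set inE edge_le. Qed.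

Let e_dis j e : e \in [set edge i j]%SET -> e \notin J j.
Proof.
rewrite inE => /eqP->; rewrite !inE negb_or; apply/andP; split.
  by rewrite edge_le /= /edge; case: ifP; rewrite /= iU //= andbF.
by apply/imsetP => -[k]; rewrite inE => kj /edge_inj jk; rewrite jk ltnn in kj.
Qed.

Let sub_outer j : outer_edges U \subset J j.
Proof. exact: finset.subsetUl. Qed.


Let sr (K : {set 'I_n * 'I_n}) j : edge i j \in K -> sigma_bmf x K (r j).
Proof.
move=> eK; rewrite /r; case: (j \in U); first exact: bmf_cst.
exact: sigma_bmf_comp.
Qed.

Let br j : bmf (r j).
Proof. by apply: (sigma_bmf_bmf (sr (j := j) (K := [set edge i j]%SET) _)); rewrite inE. Qed.

Let bA j l : bmf (A j l). Proof. exact: sigma_bmf_bmf (sA j l). Qed.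

Let Er j : Ex P (r j) = 0.
Proof. by rewrite /r; case: (j \in U); [exact: Ex_cst|exact: Ey]. Qed.

Let beta_ge0 : 0 <= beta.
Proof. exact: le_trans (normr_ge0 _) (y_le i i point). Qed.

Let r_le j w : r j w ^+ 2 <= beta ^+ 2.
Proof.
rewrite /r; case: ifP => _; first by rewrite expr0n sqr_ge0.
by rewrite -[leLHS]real_normK ?num_real // lerXn2r // nnegrE.
Qed.

Let srJ (j l : 'I_n) : (l < j)%N -> sigma_bmf x (J j) (r l).
Proof.
by move=> lj; apply: sr; rewrite inE; apply/orP; right; apply/imsetP; exists l; rewrite ?inE.
Qed.

Let sAJ j k l : sigma_bmf x (J j) (A k l).
Proof. exact: sigma_bmf_sub (sub_outer j) (sA k l). Qed.

Let JS (j l : 'I_n) : (l < j)%N -> J l \subset J j.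
Proof.
move=> lj; apply: finset.setUS; apply/fintype.subsetP => e /imsetP[k].
rewrite inE => kl ->; apply/imsetP; exists k => //; rewrite inE.
exact: ltn_trans lj.
Qed.

Let W (j : 'I_n) w := \sum_(l < n | (l < j)%N) A j l w * r l w.

Let sW j : sigma_bmf x (J j) (W j).
Proof. by apply: bmf_sum => l lj; apply: bmfM; [exact: sAJ|exact: srJ]. Qed.

Let s_ge0 j : 0 <= s j <= beta ^+ 2.
Proof.
rewrite Ex_ge0 /=; last by move=> w; exact: sqr_ge0.
rewrite -(Ex_cst P (beta ^+ 2)); apply: Ex_le => //; first exact: bmfX.
exact: bmf_cst.
Qed.

Let ltn_wlog (Q : 'I_n -> 'I_n -> Prop) : (forall j l, Q j l -> Q l j) ->
  (forall j l : 'I_n, (l < j)%N -> Q j l) -> forall j l, j != l -> Q j l.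
Proof.
move=> Qs Ql j l; rewrite -val_eqE /=; case: ltngtP => // [jl|lj] _.
  exact/Qs/Ql.
exact: Ql.
Qed.

(** For [k < l] the cross term is the centered [r l] times a function of [J l], so its mean is 0.
    The squares are then summed with the row bound [A_le]. *)
Let EW j : Ex P (fun w => W j w ^+ 2) <= beta ^+ 2 * c.
Proof.
have orth : forall l k, l != k ->
    Ex P (fun w => A j l w * r l w * (A j k w * r k w)) = 0.
  apply: (@ltn_wlog (fun l k => Ex P (fun w => A j l w * r l w * (A j k w * r k w)) = 0)).
    by move=> l k <-; apply: eq_Rintegral => w _; rewrite mulrC.
  move=> l k kl.
  transitivity (Ex P (fun w => r l w * (A j l w * (A j k w * r k w)))).
    by apply: eq_Rintegral => w _; ring.
  rewrite (Ex_sigma_indep ind (J1 := [set edge i l]%SET) (J2 := J l)) //.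
  - by rewrite Er mul0r.
  - exact: e_dis.
  - by apply: sr; rewrite inE.
  - by apply: sigma_bmfM => //; apply: sigma_bmfM => //; exact: srJ.
rewrite /W; under eq_fun do rewrite -big_filter.
rewrite (Ex_sqr_sum (u := fun l w => A j l w * r l w) _ _ orth); last 2 first.
- exact/filter_uniq/index_enum_uniq.
- by move=> l; exact: bmfM.
rewrite big_filter -Ex_sum; last by move=> l _; apply/bmfX/bmfM.
rewrite -(Ex_cst P (_ * c)); apply: Ex_le.
- by apply: bmf_sum => l _; apply/bmfX/bmfM.
- exact: bmf_cst.
move=> w; apply: (@le_trans _ _ (\sum_l beta ^+ 2 * A j l w ^+ 2)); last first.
  by rewrite -mulr_sumr ler_wpM2l ?sqr_ge0.
rewrite [leRHS](bigID (fun l : 'I_n => (l < j)%N)) /= -[leLHS]addr0.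
rewrite lerD ?sumr_ge0 // => [|l _]; last by rewrite mulr_ge0 ?sqr_ge0.
apply: ler_sum => l _; rewrite exprMn mulrC ler_wpM2r ?sqr_ge0 //.
Qed.

(** The deviation is [\sum v_j + 2 \sum u_j], with [v_j] the diagonal fluctuation and
    [u_j = r_j W_j] the part below the diagonal. Both are martingale difference sequences for [J],
    so second moments add, each term contributing at most [beta^4 c]. The 10 is 2 + 8, from
    [(a + 2 b)^2 <= 2 a^2 + 8 b^2]. *)
Lemma quadratic_form_variance :
  Ex P (fun w => (\sum_j \sum_l r j w * A j l w * r l w - \sum_j s j * A j j w) ^+ 2)
  <= 10 * (n%:R * (beta ^+ 4 * c)).
Proof.
pose u j w := r j w * W j w.
pose v j w := (r j w ^+ 2 - s j) * A j j w.
have bW j : bmf (W j) by exact: sigma_bmf_bmf (sW j).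
have bu j : bmf (u j) by exact: bmfM.
have bv j : bmf (v j) by apply: bmfM => //; apply: bmfB; [exact: bmfX|exact: bmf_cst].
have Eu : Ex P (fun w => (\sum_j u j w) ^+ 2) <= n%:R * (beta ^+ 4 * c).
  have orth : forall l k, l != k -> Ex P (fun w => u l w * u k w) = 0.
    apply: (@ltn_wlog (fun l k => Ex P (fun w => u l w * u k w) = 0)).
      by move=> l k <-; apply: eq_Rintegral => w _; rewrite mulrC.
    move=> l k kl.
    transitivity (Ex P (fun w => r l w * (W l w * (r k w * W k w)))).
      by apply: eq_Rintegral => w _; rewrite /u; ring.
    rewrite (Ex_sigma_indep ind (J1 := [set edge i l]%SET) (J2 := J l)) //.
    - by rewrite Er mul0r.
    - exact: e_dis.
    - by apply: sr; rewrite inE.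
    - apply: sigma_bmfM; first exact: sW.
      apply: sigma_bmfM; first exact: srJ.
      exact: sigma_bmf_sub (JS kl) (sW k).
  rewrite (Ex_sqr_sum _ bu orth) ?index_enum_uniq //.
  rewrite -[n in n%:R]card_ord mulr_natl -sumr_const; apply: ler_sum => j _.
  apply: (@le_trans _ _ (Ex P (fun w => beta ^+ 2 * W j w ^+ 2))).
    apply: Ex_le; [exact: bmfX|by apply/bmfZ/bmfX|].
    by move=> w; rewrite exprMn ler_wpM2r ?sqr_ge0.
  rewrite ExZ; last exact: bmfX.
  have -> : beta ^+ 4 * c = beta ^+ 2 * (beta ^+ 2 * c) by ring.
  by rewrite ler_wpM2l ?sqr_ge0.
have Ev : Ex P (fun w => (\sum_j v j w) ^+ 2) <= n%:R * (beta ^+ 4 * c).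
  have orth : forall l k, l != k -> Ex P (fun w => v l w * v k w) = 0.
    apply: (@ltn_wlog (fun l k => Ex P (fun w => v l w * v k w) = 0)).
      by move=> l k <-; apply: eq_Rintegral => w _; rewrite mulrC.
    move=> l k kl.
    transitivity (Ex P (fun w => (r l w ^+ 2 - s l) * (A l l w * v k w))).
      by apply: eq_Rintegral => w _; rewrite /v; ring.
    rewrite (Ex_sigma_indep ind (J1 := [set edge i l]%SET) (J2 := J l)) //.
    - rewrite ExB ?Ex_cst ?subrr ?mul0r //; [exact: bmfX|exact: bmf_cst].
    - exact: e_dis.
    - by apply/sigma_bmfBr/sigma_bmfX/sr; rewrite inE.
    - apply: sigma_bmfM => //; apply: sigma_bmfM => //.
      exact/sigma_bmfBr/sigma_bmfX/srJ.
  rewrite (Ex_sqr_sum _ bv orth) ?index_enum_uniq //.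
  rewrite -[n in n%:R]card_ord mulr_natl -sumr_const; apply: ler_sum => j _.
  rewrite -(Ex_cst P (_ * c)); apply: Ex_le; [exact: bmfX|exact: bmf_cst|].
  move=> w; rewrite exprMn ler_pM ?sqr_ge0 //; last first.
    apply: le_trans (A_le j w); rewrite (bigD1 j) //= lerDl.
    by rewrite sumr_ge0 // => k _; rewrite sqr_ge0.
  have -> : beta ^+ 4 = (beta ^+ 2) ^+ 2 by ring.
  have := r_le j w; have := s_ge0 j; have := sqr_ge0 (r j w).
  move: (r j w ^+ 2) (s j) (beta ^+ 2) => a b e a0 /andP[b0 be] ae.
  have h : `|a - b| <= e by rewrite ler_norml; lra.
  by rewrite -[leLHS]real_normK ?num_real // lerXn2r // nnegrE (le_trans a0).
apply: (@le_trans _ _ (Ex P (fun w => 2 * (\sum_j v j w) ^+ 2 + 8 * (\sum_j u j w) ^+ 2))).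
  have e w : \sum_j \sum_l r j w * A j l w * r l w - \sum_j s j * A j j w
      = \sum_j v j w + 2 * \sum_j u j w.
    rewrite sum_symmetric; last by move=> j l; rewrite symA; ring.
    rewrite addrAC -sumrB; congr (_ + 2 * _); apply: eq_bigr => j _.
      by rewrite /v; ring.
    by rewrite /u /W mulr_sumr; apply: eq_bigr => l _; ring.
  under eq_fun do rewrite e.
  have bsv : bmf (fun w => \sum_j v j w) by exact: bmf_sum.
  have bsu : bmf (fun w => \sum_j u j w) by exact: bmf_sum.
  apply: Ex_le.
  - by apply/bmfX/bmfD => //; exact: bmfZ.
  - by apply: bmfD; apply/bmfZ/bmfX.
  - by move=> w; have := sqr_ge0 (\sum_j v j w - 2 * \sum_j u j w); lra.
rewrite ExD; last 2 first.
- by apply/bmfZ/bmfX/bmf_sum.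
- by apply/bmfZ/bmfX/bmf_sum.
rewrite !ExZ; [|by apply/bmfX/bmf_sum..].
lra.
Qed.
End QuadraticForm.

(** Cauchy-Schwarz, from the nonnegativity of [\sum s_i (S z_i - m)^2 = S (S q - m^2)]; when [S = 0]
    every weight is 0. *)
Lemma weighted_sum_sqr (R : realFieldType) (I : finType) (s z : I -> R) :
  (forall i, 0 <= s i) ->
  (\sum_i s i * z i) ^+ 2 <= (\sum_i s i) * \sum_i s i * z i ^+ 2.
Proof.
move=> s0; set S := \sum_i s i; set m := \sum_i s i * z i; set q := \sum_i _.
have S0 : 0 <= S by exact: sumr_ge0.
have : 0 <= \sum_i s i * (S * z i - m) ^+ 2.
  by apply: sumr_ge0 => i _; rewrite mulr_ge0 ?sqr_ge0.
have -> : \sum_i s i * (S * z i - m) ^+ 2 = S * (S * q - m ^+ 2).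
  transitivity (\sum_i (S ^+ 2 * (s i * z i ^+ 2) - (2 * S * m) * (s i * z i) + m ^+ 2 * s i)).
    by apply: eq_bigr => i _; ring.
  by rewrite big_split sumrB /= -!mulr_sumr -/S -/m -/q; ring.
have [SN|] := eqVneq S 0; last first.
  by move=> SN0; rewrite pmulr_rge0 ?lt_def ?SN0 // subr_ge0.
have sz i : s i = 0.
  by have /psumr_eq0P := SN; apply => // j _.
rewrite SN !mul0r /m big1 => [_|i _]; last by rewrite sz mul0r.
by rewrite expr2 mul0r.
Qed.

Lemma sum3_sqr (R : realDomainType) (x y z : R) :
  (x + y + z) ^+ 2 <= 3 * (x ^+ 2 + y ^+ 2 + z ^+ 2).
Proof.
have h1 := sqr_ge0 (x - y); have h2 := sqr_ge0 (y - z); have h3 := sqr_ge0 (x - z).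
lra.
Qed.

(** * Mean square convergence of the resolvent trace *)

Section Contraction.
Context d (T : measurableType d) (R : realType) (P : probability T R) (n : nat).
Variable x : 'I_n * 'I_n -> {RV P >-> R}.
Hypothesis ind : mutually_independent [set e : 'I_n * 'I_n | (e.1 <= e.2)%N]%SET x.
Variables (phi : 'I_n -> 'I_n -> R -> R) (beta : R).
Definition wigner_entry i j w := phi i j (x (edge i j) w).
Local Notation y := wigner_entry.
Hypothesis bphi : forall i j, bmf (phi i j).
Hypothesis phiC : forall i j, phi i j = phi j i.
Hypothesis y_le : forall i j w, `|y i j w| <= beta.
Hypothesis Ey : forall i j, Ex P (y i j) = 0.

Definition wigner_mx w : 'M[R]_n := \matrix_(i, j) y i j w.
Local Notation M := wigner_mx.

Lemma wigner_mx_sym w : (M w)^T = M w.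
Proof.
apply/matrixP => i j; rewrite !mxE /wigner_entry phiC; congr (phi _ _ (x _ _)).
by rewrite /edge; case: ltngtP => // /val_inj ->.
Qed.

Variables (eta s b delta B2 : R).
Hypotheses (eta_gt0 : 0 < eta) (s_ge0 : 0 <= s) (b_gt0 : 0 < b).
Hypothesis b_eq : eta * b + s * b ^+ 2 = 1.
Hypothesis B2E : n%:R * beta ^+ 2 = B2.
Hypothesis row_var : forall i, `|\sum_j Ex P (fun w => y i j w ^+ 2) - s| <= delta.

Let MS S w := zero_rc (M w) S.

Let sMS S w : (MS S w)^T = MS S w.
Proof. exact/zero_rc_sym/wigner_mx_sym. Qed.

Let mMS S : @measurable_mx _ (g_sigma_algebraType (cylinders x (outer_edges S))) R n n (MS S).
Proof.
move=> i j; rewrite /MS; under eq_fun do rewrite !mxE.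
have [iS|iS] := boolP (i \in S); first exact: measurable_cst.
have [jS|jS] := boolP (j \in S); first exact: measurable_cst.
apply: (@sigma_bmf_comp _ _ _ P _ x (outer_edges S) (edge i j) (phi i j) _ _).1 => //.
by rewrite inE edge_le /edge; case: ifP => _ /=; rewrite iS jS.
Qed.

Let sX S i j : sigma_bmf x (outer_edges S) (fun w => res_re eta (MS S w) i j).
Proof. exact: bmf_res_re. Qed.

Let sY S i j : sigma_bmf x (outer_edges S) (fun w => res_im eta (MS S w) i j).
Proof. exact: bmf_res_im. Qed.

Let bX S i j : bmf (fun w => res_re eta (MS S w) i j).
Proof. exact: sigma_bmf_bmf (sX S i j). Qed.

Let bY S i j : bmf (fun w => res_im eta (MS S w) i j).
Proof. exact: sigma_bmf_bmf (sY S i j). Qed.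

(** Mean square distance from [G_ii] to [i b], where [G] is the resolvent of the minor. By [b_eq],
    [i b] is the Stieltjes transform at [i eta] of the semicircle law of variance [s]. *)
Definition res_err (S : {set 'I_n}) i := Ex P (fun w =>
  res_re eta (zero_rc (M w) S) i i ^+ 2 + (res_im eta (zero_rc (M w) S) i i - b) ^+ 2).

Let bys i j : bmf (y i j).
Proof.
apply: (@sigma_bmf_bmf _ _ _ P _ x [set edge i j]%SET); apply: sigma_bmf_comp => //.
by rewrite inE.
Qed.

Let y2_le i j w : y i j w ^+ 2 <= beta ^+ 2.
Proof.
by rewrite -[leLHS]real_normK ?num_real // lerXn2r // nnegrE (le_trans (normr_ge0 _) (y_le i j w)).
Qed.

Let b_le : b <= eta^-1.
Proof.
by rewrite -[_^-1]mul1r ler_pdivlMr // mulrC -b_eq lerDl mulr_ge0 // sqr_ge0.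
Qed.

Let b2_le : b ^+ 2 <= eta ^- 2.
Proof. by rewrite -exprVn lerXn2r // nnegrE ?invr_ge0 ltW. Qed.


(** The starting point of the iteration: [|G_ii|^2] and [b^2] are at most [eta^-2], and the cross
    term [- 2 Y_ii b] is not positive. *)
Lemma res_err_le S i : res_err S i <= 2 * eta ^- 2.
Proof.
rewrite -(Ex_cst P (2 * _)); apply: Ex_le; last 1 first.
- move=> w; have h := sum_res_le eta_gt0 (sMS S w) i.
  have h1 : res_re eta (MS S w) i i ^+ 2 + res_im eta (MS S w) i i ^+ 2 <= eta ^- 2.
    apply: le_trans h; rewrite (bigD1 i) //= lerDl sumr_ge0 // => j _.
    by rewrite addr_ge0 ?sqr_ge0.
  have h2 := mulr_ge0 (res_im_ge0 eta_gt0 (sMS S w) i) (ltW b_gt0).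
  rewrite -/(MS S w); have := b2_le; lra.
- by apply: bmfD; apply: bmfX; [exact: bX|apply: bmfB; [exact: bY|exact: bmf_cst]].
- exact: bmf_cst.
Qed.

Section Step.
Variables (S : {set 'I_n}) (i : 'I_n) (e : R).
Hypothesis iS : i \notin S.
Let U := i |: S.
Hypothesis e_ge0 : 0 <= e.
Hypothesis err_U : forall j, j \notin U -> res_err U j <= e.

Let r j w := if j \in U then 0 else y i j w.
Let v j := Ex P (fun w => r j w ^+ 2).
Let q (Z : 'M[R]_n -> 'M[R]_n) w := \sum_j \sum_l r j w * Z (MS U w) j l * r l w.

Let iU : i \in U. Proof. by rewrite !inE eqxx. Qed.

Let quadE (Z : 'M[R]_n -> 'M[R]_n) w :
  (offdiag_row (MS S w) i *m Z (zero_rc (MS S w) [set i]%SET) *m (offdiag_row (MS S w) i)^T) 0 0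
  = q Z w.
Proof.
have rE j : offdiag_row (MS S w) i 0 j = r j w.
  by rewrite !mxE /r /U !inE (negbTE iS); case: (j == i).
rewrite /MS zero_rc1 mxE.
under eq_bigr do rewrite mxE mulr_suml.
rewrite exchange_big /=; apply: eq_bigr => j _; apply: eq_bigr => l _.
by rewrite [(_^T) _ _]mxE !rE.
Qed.

Let v_ge0 j : 0 <= v j. Proof. by apply: Ex_ge0 => w; exact: sqr_ge0. Qed.

Let br j : bmf (r j).
Proof. by rewrite /r; case: (j \in U); [exact: bmf_cst|exact: bys]. Qed.

Let v_le j : v j <= beta ^+ 2.
Proof.
rewrite /v -(Ex_cst P (beta ^+ 2)); apply: Ex_le; [exact: bmfX|exact: bmf_cst|].
by move=> w; rewrite /r; case: (j \in U); rewrite ?expr0n ?sqr_ge0.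
Qed.

Let sum_v_le : \sum_j v j <= B2.
Proof.
rewrite -B2E -[n in n%:R]card_ord mulr_natl -sumr_const.
by apply: ler_sum => j _.
Qed.

Let row_var_U : `|\sum_j v j - s| <= delta + #|U|%:R * beta ^+ 2.
Proof.
have h : \sum_j Ex P (fun w => y i j w ^+ 2)
    = \sum_j v j + \sum_(j in U) Ex P (fun w => y i j w ^+ 2).
  rewrite [LHS](bigID (mem U)) /= addrC [in RHS](bigID (mem U)) /=.
  rewrite [X in _ = (X + _) + _]big1 ?add0r.
    congr (_ + _); apply: eq_bigr => j jU.
    by apply: eq_Rintegral => w _; rewrite /r (negbTE jU).
  move=> j jU; rewrite /v -(Ex_cst P 0).
  by apply: eq_Rintegral => w _; rewrite /r jU expr0n.
have := row_var i; rewrite h.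
have h0 : 0 <= \sum_(j in U) Ex P (fun w => y i j w ^+ 2).
  by apply: sumr_ge0 => j _; apply: Ex_ge0 => w; exact: sqr_ge0.
have h1 : \sum_(j in U) Ex P (fun w => y i j w ^+ 2) <= #|U|%:R * beta ^+ 2.
  rewrite mulr_natl -sumr_const; apply: ler_sum => j _.
  by rewrite -(Ex_cst P (beta ^+ 2)); apply: Ex_le => //; [exact: bmfX|exact: bmf_cst].
rewrite !ler_norml; lra.
Qed.

Let B2_ge0 : 0 <= B2.
Proof. by rewrite -B2E mulr_ge0 ?sqr_ge0. Qed.

Let symZ (Z : R -> 'M[R]_n -> 'M[R]_n) (h : forall w, (Z eta (MS U w))^T = Z eta (MS U w)) j l w :
  Z eta (MS U w) j l = Z eta (MS U w) l j.
Proof. by rewrite -[in LHS]h mxE. Qed.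

Let qX_conc : Ex P (fun w => (q (res_re eta) w - \sum_j v j * res_re eta (MS U w) j j) ^+ 2)
  <= 10 * (B2 * beta ^+ 2 * eta ^- 2).
Proof.
have -> : 10 * (B2 * beta ^+ 2 * eta ^- 2) = 10 * (n%:R * (beta ^+ 4 * eta ^- 2)).
  by rewrite -B2E; ring.
apply: (quadratic_form_variance ind bphi y_le Ey iU
  (A := fun j l w => res_re eta (MS U w) j l)).
- by move=> j l; exact: sX.
- by move=> j l w; apply: symZ => ?; exact: res_re_sym.
- by move=> j w; exact: sum_res_re_le.
Qed.

Let qY_conc : Ex P (fun w => (q (res_im eta) w - \sum_j v j * res_im eta (MS U w) j j) ^+ 2)
  <= 10 * (B2 * beta ^+ 2 * eta ^- 2).
Proof.
have -> : 10 * (B2 * beta ^+ 2 * eta ^- 2) = 10 * (n%:R * (beta ^+ 4 * eta ^- 2)).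
  by rewrite -B2E; ring.
apply: (quadratic_form_variance ind bphi y_le Ey iU
  (A := fun j l w => res_im eta (MS U w) j l)).
- by move=> j l; exact: sY.
- by move=> j l w; apply: symZ => ?; exact: res_im_sym.
- by move=> j w; exact: sum_res_im_le.
Qed.

Let bq (Z : 'M[R]_n -> 'M[R]_n) : (forall j l, bmf (fun w => Z (MS U w) j l)) -> bmf (q Z).
Proof.
by move=> bZ; apply: bmf_sum => j _; apply: bmf_sum => l _; apply: bmfM => //; apply: bmfM.
Qed.

(** The terms of the bound have distinct origins. [beta^2] bounds the diagonal entry. The 20
    collects the concentration of the quadratic forms of the real and the imaginary part, 10 each.
    [B2^2 e] comes from weighted Cauchy-Schwarz with total weight at most [B2], applied to the
    errors of the smaller minor. The last term is the defect of the row variance times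
    [b^2 <= eta^-2]. The factor 3 is the price of squaring sums of three terms. *)
Lemma res_err_step : res_err S i <= 3 * eta ^- 4 *
  (beta ^+ 2 + 20 * (B2 * beta ^+ 2 * eta ^- 2) + B2 ^+ 2 * e
   + (delta + #|U|%:R * beta ^+ 2) ^+ 2 * eta ^- 2).
Proof.
pose mX w := \sum_j v j * res_re eta (MS U w) j j.
pose mY w := \sum_j v j * res_im eta (MS U w) j j.
pose err j w := res_re eta (MS U w) j j ^+ 2 + (res_im eta (MS U w) j j - b) ^+ 2.
pose t := (delta + #|U|%:R * beta ^+ 2) ^+ 2 * eta ^- 2.
pose F1 w := (q (res_re eta) w - mX w) ^+ 2.
pose F2 w := (q (res_im eta) w - mY w) ^+ 2.
pose F3 w := B2 * \sum_j v j * err j w.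
have bmX : bmf mX by apply: bmf_sum => j _; apply/bmfZ/bX.
have bmY : bmf mY by apply: bmf_sum => j _; apply/bmfZ/bY.
have berr j : bmf (err j).
  by apply: bmfD; apply: bmfX; [exact: bX|apply: bmfB; [exact: bY|exact: bmf_cst]].
have bF1 : bmf F1 by apply/bmfX/bmfB => //; exact: bq.
have bF2 : bmf F2 by apply/bmfX/bmfB => //; exact: bq.
have bF3 : bmf F3 by apply/bmfZ/bmf_sum => j _; exact: bmfZ.
have eta4 : 0 <= 3 * eta ^- 4 by rewrite mulr_ge0 // invr_ge0 exprn_ge0 ?ltW.
have bF : bmf (fun w => beta ^+ 2 + F1 w + F2 w + F3 w + t).
  by do ?[exact: bmf_cst | apply: bmfD => //].
apply: (@le_trans _ _ (Ex P (fun w => 3 * eta ^- 4 *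
    (beta ^+ 2 + F1 w + F2 w + F3 w + t)))).
  apply: Ex_le; first by apply: bmfD; apply: bmfX; [exact: bX|apply: bmfB; [exact: bY|exact: bmf_cst]].
    exact: bmfZ.
  move=> w; have [] := schur_complement eta_gt0 i (sMS S w); rewrite !quadE => h1 h2.
  have h3 : res_re eta (MS S w) i i ^+ 2 + res_im eta (MS S w) i i ^+ 2 <= eta ^- 2.
    apply: le_trans (sum_res_le eta_gt0 (sMS S w) i); rewrite (bigD1 i) //= lerDl sumr_ge0 // => j _.
    by rewrite addr_ge0 ?sqr_ge0.
  apply: le_trans (schur_stability eta_gt0 s_ge0 b_gt0 b_eq h1 h2 h3) _.
  rewrite [3 * _]mulrC -mulrA ler_wpM2l //.
    by rewrite invr_ge0 exprn_ge0 // ltW.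
  have -> : MS S w i i = y i i w by rewrite !mxE (negbTE iS).
  have e1 : mX w ^+ 2 + (mY w - (\sum_j v j) * b) ^+ 2 <= F3 w.
    have -> : mY w - (\sum_j v j) * b = \sum_j v j * (res_im eta (MS U w) j j - b).
      by rewrite mulr_suml -sumrB; apply: eq_bigr => j _; ring.
    apply: (@le_trans _ _ ((\sum_j v j) * \sum_j v j * err j w)).
      have -> : \sum_j v j * err j w = \sum_j v j * res_re eta (MS U w) j j ^+ 2
          + \sum_j v j * (res_im eta (MS U w) j j - b) ^+ 2.
        by rewrite -big_split; apply: eq_bigr => j _; rewrite mulrDr.
      by rewrite mulrDr lerD //; exact: weighted_sum_sqr.
    rewrite ler_wpM2r // sumr_ge0 // => j _.
    by rewrite mulr_ge0 // addr_ge0 ?sqr_ge0.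
  have e2 : ((\sum_j v j - s) * b) ^+ 2 <= t.
    rewrite exprMn /t ler_pM ?sqr_ge0 //.
    rewrite -[leLHS]real_normK ?num_real // lerXn2r // nnegrE.
    exact: le_trans row_var_U.
  have e3 := y2_le i i w.
  set a := y i i w; set p1 := q _ w; set p2 := q _ w.
  have h4 : (a - p1) ^+ 2 <= 3 * (beta ^+ 2 + F1 w + mX w ^+ 2).
    have -> : a - p1 = a - (p1 - mX w) - mX w by ring.
    apply: le_trans (sum3_sqr _ _ _) _; rewrite !sqrrN ler_wpM2l //.
    by rewrite -/(F1 w) lerD2r lerD2r.
  have h5 : (p2 - s * b) ^+ 2 <= 3 * (F2 w + (mY w - (\sum_j v j) * b) ^+ 2 + t).
    have -> : p2 - s * b = (p2 - mY w) + (mY w - (\sum_j v j) * b) + (\sum_j v j - s) * b.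
      by ring.
    apply: le_trans (sum3_sqr _ _ _) _; rewrite ler_wpM2l //.
    by rewrite -/(F2 w) lerD2l.
  apply: le_trans (lerD h4 h5) _; rewrite -mulrDr ler_wpM2l //.
  move: e1; set z1 := mX w ^+ 2; set z2 := _ ^+ 2 => e1; lra.
rewrite ExZ // ler_wpM2l //.
rewrite !ExD ?Ex_cst //; try by do ?[exact: bmf_cst | apply: bmfD => //].
have E3 : Ex P F3 <= B2 ^+ 2 * e.
  rewrite ExZ; last by apply: bmf_sum => j _; exact: bmfZ.
  rewrite expr2 -mulrA ler_wpM2l // Ex_sum; last by move=> j _; exact: bmfZ.
  apply: (@le_trans _ _ (\sum_j v j * e)).
    apply: ler_sum => j _; rewrite ExZ //.
    have [jU|jU] := boolP (j \in U); last by rewrite ler_wpM2l //; exact: err_U.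
    have -> : v j = 0.
      rewrite /v -(Ex_cst P 0).
      by apply: eq_Rintegral => w _; rewrite /r jU expr0n.
    by rewrite !mul0r.
  by rewrite -mulr_suml ler_wpM2r.
by move: qX_conc qY_conc E3; rewrite -/(mX _); rewrite /F1 /F2 /mX /mY -/t; lra.
Qed.
End Step.
(** The bound of [res_err_step] without its recursive term, for at most [N] removed indices; it is
    the new error made at each step. *)
Definition res_rate (N : nat) : R := 3 * eta ^- 4 *
  (beta ^+ 2 + 20 * (B2 * beta ^+ 2 * eta ^- 2)
   + (delta + N%:R * beta ^+ 2) ^+ 2 * eta ^- 2).

Hypothesis contraction : 3 * eta ^- 4 * B2 ^+ 2 <= 2^-1.

Let B2_ge0 : 0 <= B2.
Proof. by rewrite -B2E mulr_ge0 ?sqr_ge0. Qed.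

Lemma res_rate_ge0 N : 0 <= res_rate N.
Proof.
have e2 : 0 <= eta ^- 2 by rewrite invr_ge0 exprn_ge0 // ltW.
rewrite /res_rate mulr_ge0 //; last first.
  by do ?[exact: sqr_ge0 | apply: addr_ge0 | apply: mulr_ge0 => //].
by rewrite mulr_ge0 // invr_ge0 exprn_ge0 // ltW.
Qed.

(** [k] is the number of steps still allowed. By [contraction] a step maps a bound [e] to
    [e / 2 + res_rate N], whose fixed point is [2 res_rate N]; the distance to it is halved each
    time. *)
Lemma res_err_iter N k (S : {set 'I_n}) i : i \notin S -> (#|S| + k <= N)%N ->
  res_err S i <= 2^-1 ^+ k * (2 * eta ^- 2) + 2 * res_rate N.
Proof.
have e2 : 0 <= eta ^- 2 by rewrite invr_ge0 exprn_ge0 // ltW.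
have e4 : 0 <= 3 * eta ^- 4 by rewrite mulr_ge0 // invr_ge0 exprn_ge0 // ltW.
elim: k S i => [|k IH] S i iS Sk.
  by rewrite mul1r (le_trans (res_err_le S i)) // lerDl mulr_ge0 ?res_rate_ge0.
have UE : #|i |: S| = #|S|.+1 by rewrite cardsU1 iS.
set e := 2^-1 ^+ k * (2 * eta ^- 2) + 2 * res_rate N.
have e0 : 0 <= e.
  apply: addr_ge0; apply: mulr_ge0 => //; last exact: res_rate_ge0.
  by rewrite mulr_ge0.
have step := @res_err_step S i e iS e0 _; rewrite UE in step.
apply: le_trans (step _) _ => [j jU|].
  by apply: IH => //; rewrite UE addSnnS.
have d0 : 0 <= delta by exact: le_trans (row_var i).
have h1 : (delta + #|S|.+1%:R * beta ^+ 2) ^+ 2 <= (delta + N%:R * beta ^+ 2) ^+ 2.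
  have pos k' : 0 <= delta + k'%:R * beta ^+ 2.
    by rewrite addr_ge0 // mulr_ge0 // sqr_ge0.
  rewrite lerXn2r ?nnegrE ?pos // lerD2l ler_wpM2r ?sqr_ge0 // ler_nat.
  by rewrite (leq_trans _ Sk) // addnS ltnS leq_addr.
have h2 := ler_wpM2r e0 contraction.
have h3 := ler_wpM2l e4 (ler_wpM2r e2 h1).
have -> : 2^-1 ^+ k.+1 * (2 * eta ^- 2) + 2 * res_rate N = res_rate N + 2^-1 * e.
  by rewrite /e exprS; field; rewrite gt_eqF.
rewrite /res_rate; move: h2 h3; set p := 3 * eta ^- 4; set z1 := _ * eta ^- 2.
set z2 := _ * eta ^- 2; lra.
Qed.

Lemma zero_rc0 (A : 'M[R]_n) : zero_rc A finset.set0 = A.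
Proof. by apply/matrixP => i j; rewrite !mxE !inE. Qed.

Lemma res_diag_err N i : Ex P (fun w =>
  res_re eta (M w) i i ^+ 2 + (res_im eta (M w) i i - b) ^+ 2)
  <= 2^-1 ^+ N * (2 * eta ^- 2) + 2 * res_rate N.
Proof.
have := @res_err_iter N N finset.set0 i; rewrite inE cards0 => /(_ isT (leqnn _)).
by rewrite /res_err; under eq_fun do rewrite zero_rc0.
Qed.

Let bX0 i j : bmf (fun w => res_re eta (M w) i j).
Proof. by have := bX finset.set0 i j; rewrite /MS; under eq_fun do rewrite zero_rc0. Qed.

Let bY0 i j : bmf (fun w => res_im eta (M w) i j).
Proof. by have := bY finset.set0 i j; rewrite /MS; under eq_fun do rewrite zero_rc0. Qed.

Lemma mean_sqr (f : 'I_n -> R) : (0 < n)%N ->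
  (n%:R^-1 * \sum_i f i) ^+ 2 <= n%:R^-1 * \sum_i f i ^+ 2.
Proof.
move=> n0; have n0' : 0 < n%:R :> R by rewrite ltr0n.
have s1 : \sum_(i < n) n%:R^-1 = 1 :> R.
  by rewrite sumr_const card_ord -[_ *+ _]mulr_natl mulfV // gt_eqF.
have := @weighted_sum_sqr R 'I_n (fun=> n%:R^-1) f (fun=> _).
by rewrite s1 mul1r -!mulr_sumr; apply; rewrite invr_ge0 ltW.
Qed.

Lemma res_trace_err N : (0 < n)%N ->
  bmf (fun w => n%:R^-1 * \tr (res_re eta (M w))) /\
  bmf (fun w => n%:R^-1 * \tr (res_im eta (M w))) /\
  Ex P (fun w => (n%:R^-1 * \tr (res_re eta (M w))) ^+ 2)
    <= 2^-1 ^+ N * (2 * eta ^- 2) + 2 * res_rate N /\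
  Ex P (fun w => (n%:R^-1 * \tr (res_im eta (M w)) - b) ^+ 2)
    <= 2^-1 ^+ N * (2 * eta ^- 2) + 2 * res_rate N.
Proof.
move=> n0; have n0' : 0 < n%:R :> R by rewrite ltr0n.
have b1 : bmf (fun w => n%:R^-1 * \tr (res_re eta (M w))).
  by apply/bmfZ/bmf_sum => i _; exact: bX0.
have b2 : bmf (fun w => n%:R^-1 * \tr (res_im eta (M w))).
  by apply/bmfZ/bmf_sum => i _; exact: bY0.
do 2!split=> //.
pose h i w := res_re eta (M w) i i ^+ 2 + (res_im eta (M w) i i - b) ^+ 2.
have bh i : bmf (h i).
  by apply: bmfD; apply: bmfX; [exact: bX0|apply: bmfB; [exact: bY0|exact: bmf_cst]].
have bs : bmf (fun w => n%:R^-1 * \sum_i h i w) by apply/bmfZ/bmf_sum.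
have Es : Ex P (fun w => n%:R^-1 * \sum_i h i w)
    <= 2^-1 ^+ N * (2 * eta ^- 2) + 2 * res_rate N.
  rewrite ExZ; last exact: bmf_sum.
  rewrite Ex_sum // mulrC ler_pdivrMr // mulr_natr.
  rewrite -[X in _ *+ X]card_ord -sumr_const; apply: ler_sum => i _.
  exact: res_diag_err.
split; apply: le_trans Es; apply: Ex_le => //.
- exact: bmfX.
- move=> w; apply: le_trans (mean_sqr _ n0) _; rewrite ler_wpM2l ?invr_ge0 ?(ltW n0') //.
  by apply: ler_sum => i _; rewrite lerDl sqr_ge0.
- by apply/bmfX/bmfB => //; exact: bmf_cst.
- move=> w.
  have -> : n%:R^-1 * \tr (res_im eta (M w)) - b
      = n%:R^-1 * \sum_i (res_im eta (M w) i i - b).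
    rewrite sumrB sumr_const card_ord -[b *+ n]mulr_natl mulrBr mulrA mulVf ?mul1r //.
    by rewrite gt_eqF.
  apply: le_trans (mean_sqr _ n0) _; rewrite ler_wpM2l ?invr_ge0 ?(ltW n0') //.
  by apply: ler_sum => i _; rewrite lerDr sqr_ge0.
Qed.
End Contraction.

(** * Approximation of step functions *)

Lemma bernoulli_ge (R : realDomainType) (y : R) N : 0 <= y <= 1 -> 1 - N%:R * y <= (1 - y) ^+ N.
Proof.
move=> /andP[y0 y1]; elim: N => [|N IH]; first by rewrite mul0r subr0.
rewrite exprS; apply: le_trans (_ : (1 - y) * (1 - N%:R * y) <= _); last first.
  by rewrite ler_wpM2l // subr_ge0.
have := mulr_ge0 (ler0n R N) (sqr_ge0 y); rewrite -natr1; lra.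
Qed.

Lemma bernoulli_le (R : realDomainType) (y : R) N : 0 <= y <= 1 -> (1 - y) ^+ N * (1 + N%:R * y) <= 1.
Proof.
move=> /andP[y0 y1]; elim: N => [|N IH]; first by rewrite mul0r addr0 mulr1.
apply: le_trans IH; rewrite exprSr -mulrA ler_wpM2l ?exprn_ge0 ?subr_ge0 //.
have := mulr_ge0 (ler0n R N) (sqr_ge0 y); have := sqr_ge0 y; rewrite -natr1; lra.
Qed.

(* The polynomial [(1 - X ^ k) ^ N] with [N] close to [c ^ -k] has a sharp drop at [c]. *)
Lemma step_poly (R : realType) (c del e : R) : 0 < c < 1 -> 0 < del -> 0 < e ->
  exists p : {poly R}, forall s, 0 <= s <= 1 ->
    [/\ 0 <= p.[s] <= 1, s <= c - del -> 1 - e <= p.[s] & c + del <= s -> p.[s] <= e].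
Proof.
move=> /andP[c0 c1] del0 e0.
(* [q] dominates [s / c] for [s <= c - del] and [c / s] for [s >= c + del], so [q ^+ k] makes both
   ratios small after [k] powers. *)
pose q := Num.max (1 - del / c) (c / (c + del)).
have cd0 : 0 < c + del by rewrite addr_gt0.
have q0 : 0 < q by rewrite lt_max [X in _ || X]divr_gt0 // orbT.
have q1 : q < 1.
  by rewrite gt_max ltrBlDr ltrDl divr_gt0 //= ltr_pdivrMr // mul1r ltrDl.
have [k qk] : exists k, q ^+ k <= e / 2.
  have : (fun k => q ^+ k) @ \oo --> (0 : R).
    by apply: cvg_expr; rewrite gtr0_norm.
  move/cvgr0Pnorm_le => /(_ (e / 2)); rewrite divr_gt0 // => /(_ isT) [k _ /(_ k (leqnn k))] /=.
  by rewrite gtr0_norm ?exprn_gt0 // => h; exists k.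
(* With [c^-k <= N <= 2 c^-k], left of the drop [N s^k <= 2 (s / c)^k] is at most [e], and right of
   it [(1 - s^k)^N <= 1 / (1 + N s^k) <= (c / s)^k]. *)
pose N := (Num.truncn (c ^- k)).+1.
have ck0 : 0 < c ^- k by rewrite invr_gt0 exprn_gt0.
have ck1 : 1 <= c ^- k by rewrite invf_ge1 ?exprn_gt0 // exprn_ile1 // ltW.
have [N1 N2] : c ^- k <= N%:R /\ N%:R <= 2 * c ^- k.
  have /andP[t1 t2] := truncn_itv (ltW ck0).
  split; first exact: ltW.
  rewrite /N -natr1; lra.
exists ((1 - 'X^k) ^+ N) => s /andP[s0 s1].
rewrite !hornerE.
have sk : 0 <= s ^+ k <= 1 by rewrite exprn_ge0 //= exprn_ile1.
have /andP[sk0 sk1] := sk.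
split.
- by rewrite exprn_ge0 ?subr_ge0 //= exprn_ile1 ?subr_ge0 // gerBl.
- move=> sc; apply: le_trans (bernoulli_ge N sk); rewrite lerD2l lerN2.
  apply: (@le_trans _ _ (2 * c ^- k * s ^+ k)); first by rewrite ler_wpM2r.
  rewrite -mulrA mulrC -ler_pdivlMr //; apply: le_trans qk.
  rewrite -exprVn -exprMn lerXn2r // ?nnegrE ?mulr_ge0 ?invr_ge0 ?(ltW c0) ?(ltW q0) //.
  rewrite le_max mulrC ler_pdivrMr // mulrBl mul1r mulfVK ?gt_eqF // sc //.
- move=> sc; have h := bernoulli_le N sk.
  have p0 : 0 < 1 + N%:R * s ^+ k by rewrite ltr_pwDl // mulr_ge0.
  rewrite -ler_pdivlMr // div1r in h; apply: le_trans h _.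
  have s_gt0 : 0 < s by exact: lt_le_trans sc.
  apply: (@le_trans _ _ ((c / s) ^+ k)).
    rewrite -[leRHS]invrK lef_pV2 ?posrE //; last by rewrite invr_gt0 exprn_gt0 // divr_gt0.
    rewrite -exprVn invf_div exprMn mulrC exprVn.
    have : c ^- k * s ^+ k <= N%:R * s ^+ k by rewrite ler_wpM2r.
    lra.
  apply: (@le_trans _ _ (q ^+ k)); last by lra.
  rewrite lerXn2r // ?nnegrE ?divr_ge0 ?(ltW c0) ?(ltW q0) ?(ltW s_gt0) //.
  rewrite le_max; apply/orP; right.
  by rewrite ler_wpM2l ?(ltW c0) // lef_pV2 ?posrE.
Qed.

Definition res_fun (R : realType) (v x : R) : R := x / (x ^+ 2 + v).

Lemma res_fun_increasing (R : realType) (C x y : R) : 0 < C ->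
  - C <= x -> x <= y -> y <= C -> res_fun (C ^+ 2) x <= res_fun (C ^+ 2) y.
Proof.
move=> C0 Cx xy yC.
have p (z : R) : 0 < z ^+ 2 + C ^+ 2 by rewrite ltr_wpDl ?sqr_ge0 // exprn_gt0.
rewrite /res_fun ler_pdivrMr // mulrAC ler_pdivlMr // -subr_ge0.
have -> : y * (x ^+ 2 + C ^+ 2) - x * (y ^+ 2 + C ^+ 2) = (y - x) * (C ^+ 2 - x * y) by ring.
rewrite mulr_ge0 ?subr_ge0 //.
have : `|x * y| <= C * C by rewrite normrM ler_pM // ler_norml; lra.
by rewrite -expr2; apply: le_trans; exact: ler_norm.
Qed.

(** This is [x^2 / (x^2 + v)], written as an affine function of the kernel [1 / (x^2 + v)], whose
    spectral means are under control. *)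
Definition tail_fun (R : realType) (v x : R) : R := 1 - v / (x ^+ 2 + v).

Lemma tail_fun_ge (R : realType) (C x : R) : 0 < C -> C <= `|x| -> 1 <= 2 * tail_fun (C ^+ 2) x.
Proof.
move=> C0 Cx; have p : 0 < x ^+ 2 + C ^+ 2 by rewrite ltr_wpDl ?sqr_ge0 // exprn_gt0.
have h : C ^+ 2 <= x ^+ 2.
  by rewrite -[leRHS]real_normK ?num_real // lerXn2r ?nnegrE // ltW.
have : C ^+ 2 / (x ^+ 2 + C ^+ 2) <= 2^-1 by rewrite ler_pdivrMr //; lra.
rewrite /tail_fun; lra.
Qed.

Lemma tail_fun_ge0 (R : realType) (v x : R) : 0 < v -> 0 <= tail_fun v x.
Proof.
move=> v0; rewrite subr_ge0 ler_pdivrMr ?mul1r ?lerDr ?sqr_ge0 //.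
by rewrite ltr_wpDl ?sqr_ge0.
Qed.

(** [u = C res_fun v + 1/2] takes its values in [[0, 1]] and increases on [[- C, C]], so a
    polynomial dropping between [u a] and [u b] approximates the step there. Outside, [u] comes back
    towards 1/2 and the polynomial is only known to lie in [[0, 1]]; that error is absorbed by
    [2 tail_fun v >= 1]. *)
Lemma step_test (R : realType) (a b e v0 : R) : a < b -> 0 < e ->
  exists v (p : {poly R}), [/\ v0 <= v, 1 <= v & forall x : R,
   (x <= a)%R%:R - e - 2 * tail_fun v x <= p.[res_fun v x]
     <= (x <= b)%R%:R + e + 2 * tail_fun v x].
Proof.
move=> ab e0.
(* [C] is at least 1 and [v0], hence so is [v = C^2 >= C]; it also exceeds [|a|] and [|b|], which
   places both points where [u] increases. *)
pose C := 1 + `|v0| + `|a| + `|b|.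
have C1 : 1 <= C by rewrite /C -!addrA lerDl !addr_ge0.
have C0 : 0 < C by exact: lt_le_trans C1.
pose v := C ^+ 2.
have Cv : C <= v by rewrite /v expr2 ler_peMl // ltW.
pose t := (a + b) / 2.
have la := ler_norm a; have lb := ler_norm b; have la' := ler_norm (- a); have lb' := ler_norm (- b).
rewrite !normrN in la' lb'; have n0 := normr_ge0 v0.
have v0C := ler_norm v0.
have na := normr_ge0 a; have nb := normr_ge0 b.
have vC : v0 <= C by rewrite /C; lra.
have Ca : `|a| < C by rewrite /C; lra.
have Cb : `|b| < C by rewrite /C; lra.
pose u x := C * res_fun v x + 2^-1.
have p (z : R) : 0 < z ^+ 2 + C ^+ 2 by rewrite ltr_wpDl ?sqr_ge0 // exprn_gt0.
have u01 x : 0 <= u x <= 1.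
  have h : `|C * res_fun v x| <= 2^-1.
    rewrite /res_fun /v normrM normf_div (gtr0_norm C0) (gtr0_norm (p x)) mulrA.
    rewrite ler_pdivrMr // -[x ^+ 2]real_normK ?num_real //.
    have := sqr_ge0 (C - `|x|); lra.
  by move: h; rewrite /u ler_norml; lra.
have u_mono x y : - C <= x -> x <= y -> y <= C -> u x <= u y.
  move=> *; rewrite /u lerD2r ler_wpM2l ?(ltW C0) //; exact: res_fun_increasing.
have u_strict : u a < u b.
  rewrite /u ltrD2r ltr_pM2l // /res_fun /v ltr_pdivrMr // mulrAC ltr_pdivlMr // -subr_gt0.
  have -> : b * (a ^+ 2 + C ^+ 2) - a * (b ^+ 2 + C ^+ 2) = (b - a) * (C ^+ 2 - a * b) by ring.
  rewrite mulr_gt0 ?subr_gt0 //.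
  have : `|a * b| < C * C by rewrite normrM ltr_pM.
  by rewrite -expr2; apply: le_lt_trans; exact: ler_norm.
pose c := (u a + u b) / 2; pose del := (u b - u a) / 2.
have del0 : 0 < del by rewrite divr_gt0 // subr_gt0.
have /andP[ua0 ua1] := u01 a; have /andP[ub0 ub1] := u01 b.
have c01 : 0 < c < 1 by rewrite /c; apply/andP; split; lra.
have [P hP] := step_poly c01 del0 e0.
exists v, (P \Po (C *: 'X + (2^-1)%:P)); split; [exact: le_trans Cv | exact: le_trans Cv |].
move=> x; have -> : (P \Po (C *: 'X + (2^-1)%:P)).[res_fun v x] = P.[u x].
  by rewrite horner_comp hornerD hornerZ hornerX hornerC.
have [/andP[P0 P1] Pa Pb] := hP _ (u01 x).
have T0 : 0 <= tail_fun v x by apply: tail_fun_ge0; rewrite exprn_gt0.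
have [Cx|xC] := leP C `|x|.
  have := tail_fun_ge C0 Cx; rewrite -/v.
  by case: (x <= a)%R; case: (x <= b)%R; rewrite /= => *; lra.
have /andP[x1 x2] : - C <= x <= C by rewrite -ler_norml ltW.
apply/andP; split.
  have [xa|xa] := leP x a; last by rewrite /=; lra.
  have : 1 - e <= P.[u x].
    apply: Pa; have -> : c - del = u a by rewrite /c /del; field.
    by apply: u_mono => //; lra.
  by rewrite /=; lra.
have [xb|xb] := leP x b; first by rewrite /=; lra.
have : P.[u x] <= e.
  apply: Pb; have -> : c + del = u b by rewrite /c /del; field.
  by apply: u_mono => //; [lra|exact: ltW].
by rewrite /=; lra.
Qed.

(** * The semicircle law *)

Section Antiderivative.
Variable R : realType.

Lemma is_derive_atan_div (f g : R -> R) (x df dg : R) : g x != 0 ->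
  is_derive x 1 f df -> is_derive x 1 g dg ->
  is_derive x 1 (fun y => atan (f y / g y)) ((df * g x - f x * dg) / (g x ^+ 2 + f x ^+ 2)).
Proof.
move=> g0 hf hg.
have hV : is_derive x 1 (fun y => (g y)^-1) (- (g x) ^- 2 *: dg) by exact: is_deriveV.
have hq := is_deriveM hf hV.
have := @is_derive1_comp _ (@atan R) (f * (fun y => (g y)^-1)) x _ _ (is_derive1_atan _) hq.
move/is_derive_eq; apply.
rewrite /GRing.scale /=.
have p : g x ^+ 2 + f x ^+ 2 != 0.
  by rewrite gt_eqF // ltr_pwDl ?sqr_ge0 // exprn_even_gt0.

have -> : (f * (fun y => (g y)^-1)) x = f x / g x by [].
by field; rewrite ?p ?g0.
Qed.

Variables a eta : R.
Hypotheses (a_gt0 : 0 < a) (eta_gt0 : 0 < eta).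
Let c := Num.sqrt (a ^+ 2 + eta ^+ 2).
Let w (x : R) : R := Num.sqrt (a ^+ 2 - x ^+ 2).
Let rho (x : R) : R := Num.sqrt (x ^+ 2 + eta ^+ 2).

(** A primitive of [w / (x^2 + eta^2)] on []- a, a[]. The classical one is [c / eta atan (c x / (eta
    w)) - atan (x / w)], singular at [x = a] and [x = - a], where [w = 0]. Half angles, from
    [w^2 + x^2 = a^2] and [(c x)^2 + (eta w)^2 = (a rho)^2], keep the denominators positive. *)
Definition semicircle_primitive (x : R) : R :=
  2 * c / eta * atan (c * x / (a * rho x + eta * w x)) - 2 * atan (x / (a + w x)).

Let F : R -> R := semicircle_primitive.

Let rho_gt0 x : 0 < rho x.
Proof. by rewrite sqrtr_gt0 ltr_wpDl ?sqr_ge0 // exprn_gt0. Qed.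

Let w_ge0 x : 0 <= w x. Proof. exact: sqrtr_ge0. Qed.

Let D_gt0 x : 0 < a * rho x + eta * w x.
Proof. by rewrite ltr_wpDr ?mulr_ge0 ?mulr_gt0 // ltW. Qed.

Let aw_gt0 x : 0 < a + w x. Proof. by rewrite ltr_wpDr. Qed.

Let cw x : {for x, continuous w}.
Proof.
apply: (@continuous_comp _ _ _ (fun x : R => a ^+ 2 - x ^+ 2) (@Num.sqrt R)).
  by apply: cvgB; [exact: cvg_cst|exact: exprn_continuous].
exact: sqrt_continuous.
Qed.

Let crho x : {for x, continuous rho}.
Proof.
apply: (@continuous_comp _ _ _ (fun x : R => x ^+ 2 + eta ^+ 2) (@Num.sqrt R)).
  by apply: cvgD; [exact: exprn_continuous|exact: cvg_cst].
exact: sqrt_continuous.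
Qed.

Let cF (x : R) : {for x, continuous F}.
Proof.
apply: cvgB; apply: cvgM; try exact: cvg_cst.
  apply: (@continuous_comp _ _ _ (fun x : R => c * x / (a * rho x + eta * w x)) (@atan R)).
    apply: cvgM; first by apply: cvgM; [exact: cvg_cst|exact: cvg_id].
    apply: cvgV; first by rewrite gt_eqF.
    by apply: cvgD; apply: cvgM; try exact: cvg_cst; [exact: crho|exact: cw].
  exact: continuous_atan.
apply: (@continuous_comp _ _ _ (fun x : R => x / (a + w x)) (@atan R)).
  apply: cvgM; first exact: cvg_id.
  apply: cvgV; first by rewrite gt_eqF.
  by apply: cvgD; [exact: cvg_cst|exact: cw].
exact: continuous_atan.
Qed.

Let w2 (x : R) : - a < x < a -> w x ^+ 2 = a ^+ 2 - x ^+ 2 /\ 0 < w x.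
Proof.
move=> xa; have h : 0 < a ^+ 2 - x ^+ 2.
  rewrite subr_sqr mulr_gt0 //; lra.
by rewrite sqrtr_gt0 sqr_sqrtr // ltW.
Qed.

Let dw (x : R) : - a < x < a -> is_derive x 1 w (- x / w x).
Proof.
move=> xa; have [w2x w0] := w2 xa.
have h1 : is_derive x 1 (fun x : R => a ^+ 2 - x ^+ 2) (- (2 * x)).
  by apply: is_derive_eq; rewrite /GRing.scale /=; ring.
have h2 : is_derive (a ^+ 2 - x ^+ 2) 1 Num.sqrt (2 * w x)^-1.
  by apply: is_derive1_sqrt; rewrite -w2x exprn_gt0.
have := @is_derive1_comp _ (@Num.sqrt R) (fun x : R => a ^+ 2 - x ^+ 2) x _ _ h2 h1.
move/is_derive_eq; apply; field; rewrite gt_eqF //.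
Qed.

Let drho (x : R) : is_derive x 1 rho (x / rho x).
Proof.
have h1 : is_derive x 1 (fun x : R => x ^+ 2 + eta ^+ 2) (2 * x).
  by apply: is_derive_eq; rewrite /GRing.scale /=; ring.
have h2 : is_derive (x ^+ 2 + eta ^+ 2) 1 Num.sqrt (2 * rho x)^-1.
  by apply: is_derive1_sqrt; rewrite ltr_wpDl ?sqr_ge0 // exprn_gt0.
have := @is_derive1_comp _ (@Num.sqrt R) (fun x : R => x ^+ 2 + eta ^+ 2) x _ _ h2 h1.
move/is_derive_eq; apply; field; rewrite gt_eqF //.
Qed.

Let dF (x : R) : - a < x < a -> is_derive x 1 F (w x / (x ^+ 2 + eta ^+ 2)).
Proof.
move=> xa; have [w2x w0] := w2 xa.
have rho2 : rho x ^+ 2 = x ^+ 2 + eta ^+ 2.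
  by rewrite sqr_sqrtr // addr_ge0 ?sqr_ge0.
have c2 : c ^+ 2 = a ^+ 2 + eta ^+ 2 by rewrite sqr_sqrtr // addr_ge0 ?sqr_ge0.
have hw := dw xa; have hr := drho x.
have h1 : is_derive x 1 (fun x => a + w x) (- x / w x).
  by apply: is_derive_eq; ring.
have h2 : is_derive x 1 (fun x => a * rho x + eta * w x)
    (a * (x / rho x) + eta * (- x / w x)).
  by apply: is_derive_eq; rewrite /GRing.scale /=; ring.
have h3 : is_derive x 1 (fun x : R => c * x) c.
  by apply: is_derive_eq; rewrite /GRing.scale /=; ring.
have h4 := @is_derive_atan_div id (fun x => a + w x) x _ _ (lt0r_neq0 (aw_gt0 x)) (is_derive_id x 1) h1.
have h5 := @is_derive_atan_div ( *%R c) (fun x => a * rho x + eta * w x) x _ _ (lt0r_neq0 (D_gt0 x)) h3 h2.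
have r0 := rho_gt0 x; have aw0 := aw_gt0 x; have D0 := D_gt0 x.
have e4 : (1 * (a + w x) - x * (- x / w x)) / ((a + w x) ^+ 2 + x ^+ 2) = (2 * w x)^-1.
  have -> : (a + w x) ^+ 2 + x ^+ 2 = 2 * a * (a + w x).
    have -> : x ^+ 2 = a ^+ 2 - w x ^+ 2 by rewrite w2x; ring.
    ring.
  have -> : 1 * (a + w x) - x * (- x / w x) = a * (a + w x) / w x.
    transitivity (((a + w x) * w x + x ^+ 2) / w x); first by field; rewrite gt_eqF.
    have -> : x ^+ 2 = a ^+ 2 - w x ^+ 2 by rewrite w2x; ring.
    by field; rewrite gt_eqF.
  by field; rewrite !gt_eqF.
have e5 : (c * (a * rho x + eta * w x) - c * x * (a * (x / rho x) + eta * (- x / w x)))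
    / ((a * rho x + eta * w x) ^+ 2 + (c * x) ^+ 2) = c * eta / (2 * rho x ^+ 2 * w x).
  have -> : (a * rho x + eta * w x) ^+ 2 + (c * x) ^+ 2
      = 2 * a * rho x * (a * rho x + eta * w x).
    transitivity (a ^+ 2 * rho x ^+ 2 + 2 * a * eta * rho x * w x + eta ^+ 2 * w x ^+ 2
       + c ^+ 2 * x ^+ 2); first by ring.
    by rewrite w2x c2 rho2; ring: rho2.
  have -> : c * (a * rho x + eta * w x) - c * x * (a * (x / rho x) + eta * (- x / w x))
      = c * eta * a * (a * rho x + eta * w x) / (rho x * w x).
    transitivity (c * (a * w x * (rho x ^+ 2 - x ^+ 2) + eta * rho x * (w x ^+ 2 + x ^+ 2))
       / (rho x * w x)); first by field; rewrite !gt_eqF.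
    by rewrite rho2 w2x; field; rewrite !gt_eqF.
  by field; rewrite !gt_eqF.
rewrite e4 in h4; rewrite e5 in h5.
rewrite /F /semicircle_primitive; apply: is_derive_eq.
rewrite /GRing.scale /= -rho2.
transitivity ((c ^+ 2 - rho x ^+ 2) / (rho x ^+ 2 * w x)); first by field; rewrite !gt_eqF.
have -> : c ^+ 2 - rho x ^+ 2 = w x ^+ 2 by rewrite c2 rho2 w2x; ring.
by field; rewrite !gt_eqF.
Qed.

(** At the endpoints [w = 0] and [rho = c], so every arctangent is taken at 1 or -1. The primitive
    is differentiable only inside the interval and merely continuous at its ends. *)
Lemma integral_semicircle_resolvent :
  (\int[lebesgue_measure]_(x in `[(- a)%R, a]) (w x / (x ^+ 2 + eta ^+ 2))%:E
   = (pi * (c - eta) / eta)%:E)%E.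
Proof.
have aa : - a < a by rewrite (lt_trans _ a_gt0) // oppr_lt0.
rewrite (continuous_FTC2 (F := F)) //.
- rewrite -EFinB; congr (_%:E).
  have wa : w a = 0 by rewrite /w subrr sqrtr0.
  have wNa : w (- a) = 0 by rewrite /w sqrrN subrr sqrtr0.
  have ra : rho a = c by [].
  have rNa : rho (- a) = c by rewrite /rho sqrrN.
  have c0 : 0 < c by rewrite -ra.
  have u1 : c * a / (a * c + eta * 0) = 1 by field; rewrite !gt_eqF.
  have u2 : c * - a / (a * c + eta * 0) = - 1 by field; rewrite !gt_eqF.
  have u3 : a / (a + 0) = 1 by field; rewrite !gt_eqF.
  have u4 : - a / (a + 0) = - 1 by field; rewrite !gt_eqF.
  rewrite /F /semicircle_primitive wa wNa ra rNa u1 u2 u3 u4 !atanN !atan1.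
  by field; rewrite gt_eqF.
- apply: continuous_subspaceT => x; apply: cvgM; first exact: cw.
  apply: cvgV; first by rewrite gt_eqF // ltr_wpDl ?sqr_ge0 // exprn_gt0.
  by apply: cvgD; [exact: exprn_continuous|exact: cvg_cst].
- split.
  + by move=> x; rewrite in_itv /= => /dF [].
  + exact/cvg_at_right_filter/cF.
  + exact/cvg_at_left_filter/cF.
- move=> x; rewrite in_itv /= => /dF h.
  by rewrite derive1E; apply/derive_val.
Qed.
End Antiderivative.

(** * Integrals against the semicircle density *)

Section SemicircleMean.
Variables (R : realType) (s : R).
Hypothesis s_gt0 : 0 < s.
Local Notation psi := (semicircle_pdf s).
Local Notation mu := (@lebesgue_measure R).
Let a : R := 2 * Num.sqrt s.

Definition sc_mean (h : R -> R) : R := Rintegral mu setT (fun x => h x * psi x).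

Let a_gt0 : 0 < a. Proof. by rewrite mulr_gt0 // sqrtr_gt0. Qed.

Let a2 : a ^+ 2 = 4 * s.
Proof. by rewrite exprMn sqr_sqrtr ?ltW //; ring. Qed.

Lemma semicircle_pdfE x : psi x = (2 * pi * s)^-1 * Num.sqrt (4 * s - x ^+ 2).
Proof.
rewrite /semicircle_pdf; case: leP => // h; rewrite ler0_sqrtr ?mulr0 //.
rewrite -a2 subr_le0 -[leRHS]real_normK ?num_real //.
by rewrite lerXn2r ?nnegrE ?(ltW a_gt0) // ltW.
Qed.

Lemma semicircle_pdf_ge0 x : 0 <= psi x.
Proof.
rewrite semicircle_pdfE mulr_ge0 ?sqrtr_ge0 // invr_ge0.
by rewrite !mulr_ge0 ?pi_ge0 ?ltW.
Qed.

Lemma continuous_semicircle_pdf : continuous psi.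
Proof.
have -> : psi = fun x => (2 * pi * s)^-1 * Num.sqrt (4 * s - x ^+ 2).
  by apply/funext => x; exact: semicircle_pdfE.
move=> x; apply: cvgM; first exact: cvg_cst.
apply: (@continuous_comp _ _ _ (fun x : R => 4 * s - x ^+ 2) (@Num.sqrt R)).
  by apply: cvgB; [exact: cvg_cst|exact: exprn_continuous].
exact: sqrt_continuous.
Qed.

Lemma bmf_semicircle_pdf : bmf psi.
Proof.
split; first exact: continuous_measurable_fun continuous_semicircle_pdf.
exists ((2 * pi * s)^-1 * Num.sqrt (4 * s)) => x.
rewrite ger0_norm ?semicircle_pdf_ge0 // semicircle_pdfE ler_wpM2l //.
  by rewrite invr_ge0 !mulr_ge0 ?pi_ge0 ?ltW.
by rewrite ler_wsqrtr // gerBl sqr_ge0.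
Qed.

Let psi0 x : x \notin `[(- a)%R, a] -> psi x = 0.
Proof. by rewrite in_itv /= -ler_norml /semicircle_pdf => /negbTE ->. Qed.

Let restrE (h : R -> R) : (fun x => h x * psi x) = (fun x => h x * psi x) \_ `[(- a)%R, a].
Proof.
apply/funext => x; rewrite patchE mem_setE; case: ifPn => // xa.
by rewrite psi0 ?mulr0.
Qed.

Lemma sc_meanE h : sc_mean h = \int[mu]_(x in `[(- a)%R, a]) (h x * psi x).
Proof. by rewrite [RHS]Rintegral_mkcond -restrE. Qed.

Lemma sc_integrable h : bmf h -> mu.-integrable setT (EFin \o (fun x => h x * psi x)).
Proof.
move=> bh; rewrite restrE -restrict_EFin -integrable_mkcond //.
have [mf [B fB]] := bmfM bh bmf_semicircle_pdf.
apply: measurable_bounded_integrable => //.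
- exact/compact_finite_measure/segment_compact.
- exact: measurable_funS mf.
exists B; split; first exact: num_real.
by move=> x Bx w _ /=; rewrite (le_trans (fB w)) // ltW.
Qed.

Lemma sc_meanD f g : bmf f -> bmf g -> sc_mean (fun x => f x + g x) = sc_mean f + sc_mean g.
Proof.
move=> bf bg; rewrite /sc_mean -RintegralD //; [|exact: sc_integrable..].
by apply: eq_Rintegral => x _; rewrite mulrDl.
Qed.

Lemma sc_meanZ c f : bmf f -> sc_mean (fun x => c * f x) = c * sc_mean f.
Proof.
move=> bf; rewrite /sc_mean -RintegralZl //; last exact: sc_integrable.
by apply: eq_Rintegral => x _; rewrite mulrA.
Qed.

Lemma sc_mean_le f g : bmf f -> bmf g -> (forall x, f x <= g x) -> sc_mean f <= sc_mean g.
Proof.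
move=> bf bg fg; apply: le_Rintegral => //; [exact: sc_integrable..|].
by move=> x _; rewrite ler_wpM2r ?semicircle_pdf_ge0.
Qed.

(** The positive root [b] of [eta b + s b^2 = 1]; [i b] is the Stieltjes transform of the law at
    [i eta]. *)
Definition sc_root (eta : R) := (Num.sqrt (4 * s + eta ^+ 2) - eta) / (2 * s).

Lemma sc_root_gt0 eta : 0 < eta -> 0 < sc_root eta.
Proof.
move=> e0; rewrite divr_gt0 ?mulr_gt0 // subr_gt0.
rewrite -{1}[eta]gtr0_norm // -sqrtr_sqr ltr_sqrt ?ltrDr ?mulr_gt0 //.
by rewrite ltr_wpDr ?sqr_ge0 ?mulr_gt0.
Qed.

Lemma sc_root_eq eta : eta * sc_root eta + s * sc_root eta ^+ 2 = 1.
Proof.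
rewrite /sc_root; set r := Num.sqrt _.
have r2 : r ^+ 2 = 4 * s + eta ^+ 2.
  by rewrite sqr_sqrtr // addr_ge0 ?sqr_ge0 // mulr_ge0 // ltW.
transitivity ((r ^+ 2 - eta ^+ 2) / (4 * s)); first by field; rewrite gt_eqF.
by rewrite r2; field; rewrite gt_eqF.
Qed.

Lemma bmf_res_im_fun eta : 0 < eta -> bmf (fun x : R => eta / (x ^+ 2 + eta ^+ 2)).
Proof.
move=> e0; have p (x : R) : 0 < x ^+ 2 + eta ^+ 2 by rewrite ltr_wpDl ?sqr_ge0 // exprn_gt0.
split.
  apply: continuous_measurable_fun => x; apply: cvgM; first exact: cvg_cst.
  apply: cvgV; first by rewrite gt_eqF.
  by apply: cvgD; [exact: exprn_continuous|exact: cvg_cst].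
exists eta^-1 => x; rewrite gtr0_norm ?divr_gt0 // ler_pdivrMr //.
by rewrite mulrDr expr2 mulKf ?gt_eqF // lerDr mulr_ge0 ?sqr_ge0 // invr_ge0 ltW.
Qed.

Lemma bmf_res_re_fun eta : 0 < eta -> bmf (fun x : R => x / (x ^+ 2 + eta ^+ 2)).
Proof.
move=> e0; have p (x : R) : 0 < x ^+ 2 + eta ^+ 2 by rewrite ltr_wpDl ?sqr_ge0 // exprn_gt0.
split.
  apply: continuous_measurable_fun => x; apply: cvgM; first exact: cvg_id.
  apply: cvgV; first by rewrite gt_eqF.
  by apply: cvgD; [exact: exprn_continuous|exact: cvg_cst].
exists eta^-1 => x; rewrite normrM normfV [`|_ + _|]gtr0_norm // ler_pdivrMr //.
rewrite -(ler_pM2l e0) mulrA divff ?gt_eqF // mul1r -[x ^+ 2]real_normK ?num_real //.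
have := sqr_ge0 (`|x| - eta); have := sqr_ge0 `|x|; have := sqr_ge0 eta; lra.
Qed.

Lemma sc_mean_res_im eta : 0 < eta -> sc_mean (fun x => eta / (x ^+ 2 + eta ^+ 2)) = sc_root eta.
Proof.
move=> e0; rewrite sc_meanE.
have p0 : 0 < 2 * pi * s by rewrite !mulr_gt0 // pi_gt0.
pose g (x : R) := Num.sqrt (a ^+ 2 - x ^+ 2) / (x ^+ 2 + eta ^+ 2).
transitivity (\int[mu]_(x in `[(- a)%R, a]) (eta / (2 * pi * s) * g x)).
  apply: eq_Rintegral => x _; rewrite semicircle_pdfE -a2 /g.
  have px : x ^+ 2 + eta ^+ 2 != 0 by rewrite gt_eqF // ltr_wpDl ?sqr_ge0 // exprn_gt0.
  move: (pi : R) (lt0r_neq0 (pi_gt0 R)) => p pN0.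
  by field; rewrite px (lt0r_neq0 s_gt0) pN0.
rewrite RintegralZl //; last first.
  apply: continuous_compact_integrable; first exact: segment_compact.
  apply: continuous_subspaceT => x; apply: cvgM.
    apply: (@continuous_comp _ _ _ (fun x : R => a ^+ 2 - x ^+ 2) (@Num.sqrt R)).
      by apply: cvgB; [exact: cvg_cst|exact: exprn_continuous].
    exact: sqrt_continuous.
  apply: cvgV; first by rewrite gt_eqF // ltr_wpDl ?sqr_ge0 // exprn_gt0.
  by apply: cvgD; [exact: exprn_continuous|exact: cvg_cst].
rewrite /Rintegral integral_semicircle_resolvent //= a2 /sc_root.
move: (pi : R) (lt0r_neq0 (pi_gt0 R)) => p pN0.
by field; rewrite (lt0r_neq0 s_gt0) (lt0r_neq0 e0) pN0.
Qed.

Lemma sc_mean_res_re eta : 0 < eta -> sc_mean (fun x => x / (x ^+ 2 + eta ^+ 2)) = 0.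
Proof.
move=> e0; pose g x := x / (x ^+ 2 + eta ^+ 2) * psi x.
have cg : continuous g.
  move=> x; apply: cvgM; last exact: continuous_semicircle_pdf.
  apply: cvgM; first exact: cvg_id.
  apply: cvgV; first by rewrite gt_eqF // ltr_wpDl ?sqr_ge0 // exprn_gt0.
  by apply: cvgD; [exact: exprn_continuous|exact: cvg_cst].
suff h : sc_mean (fun x => x / (x ^+ 2 + eta ^+ 2)) = - sc_mean (fun x => x / (x ^+ 2 + eta ^+ 2)).
  lra.
rewrite -mulN1r -sc_meanZ; last exact: bmf_res_re_fun.
rewrite !sc_meanE.
transitivity (\int[mu]_(x in `[(- a)%R, - - a]) g x); first by rewrite opprK.
rewrite /Rintegral integration_by_substitution_oppr; last 2 first.
- by rewrite ge0_cp // ltW.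
- exact: continuous_subspaceT.
congr fine; apply: eq_integral => x _; congr (_%:E).
by rewrite /= /g !semicircle_pdfE sqrrN !mulNr mul1r.
Qed.

(** The kernel [eta^2 / (x^2 + eta^2)] has mean [eta b = 1 - s b^2], between [1 - s / eta^2] and 1.
    It is at most 1, and at least [1 - 4 s / eta^2] on the support; large [eta] squeezes the mass to
    1. *)
Lemma sc_mean1 : sc_mean (fun=> 1) = 1.
Proof.
set I := sc_mean _.
have b1 : bmf (fun=> 1 : R) := bmf_cst R 1.
have main eta : 0 < eta -> 1 - s * eta ^- 2 <= I /\ I * (1 - 4 * s * eta ^- 2) <= 1.
  move=> e0; have he := sc_root_eq eta; have hb := sc_root_gt0 e0.
  have be := sc_mean_res_im e0; have bb := bmf_res_im_fun e0.
  have Eb : sc_mean (fun x => eta * (eta / (x ^+ 2 + eta ^+ 2))) = eta * sc_root eta.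
    by rewrite sc_meanZ // be.
  have p (x : R) : 0 < x ^+ 2 + eta ^+ 2 by rewrite ltr_wpDl ?sqr_ge0 // exprn_gt0.
  have b_le : sc_root eta <= eta^-1.
    by rewrite -[_^-1]mul1r ler_pdivlMr // mulrC -he lerDl mulr_ge0 ?sqr_ge0 // ltW.
  have b2_le : sc_root eta ^+ 2 <= eta ^- 2.
    by rewrite -exprVn lerXn2r // nnegrE ?invr_ge0 ltW.
  have sb : s * sc_root eta ^+ 2 <= s * eta ^- 2 by rewrite ler_wpM2l // ltW.
  split.
    apply: (@le_trans _ _ (eta * sc_root eta)); first by lra.
    rewrite -Eb; apply: sc_mean_le => //; first exact: bmfZ.
    move=> x; rewrite mulrA -expr2 ler_pdivrMr // mul1r lerDr sqr_ge0 //.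
  apply: (@le_trans _ _ (eta * sc_root eta)); last first.
    have := mulr_ge0 (ltW s_gt0) (sqr_ge0 (sc_root eta)); lra.
  rewrite -Eb mulrC -sc_meanZ // !sc_meanE; apply: le_Rintegral => //.
  - by apply: integrableS (sc_integrable (bmfZ _ b1)).
  - by apply: integrableS (sc_integrable (bmfZ _ bb)).
  move=> x; rewrite /= in_itv /= -ler_norml => xa.
  rewrite ler_wpM2r ?semicircle_pdf_ge0 // mulr1.
  have x2 : x ^+ 2 <= 4 * s.
    by rewrite -a2 -[leLHS]real_normK ?num_real // lerXn2r ?nnegrE // ltW.
  rewrite mulrA -expr2 ler_pdivlMr // mulrBl mul1r.
  have h1 : 4 * s * eta ^- 2 * eta ^+ 2 = 4 * s.
    by rewrite -mulrA mulVf ?mulr1 // expf_neq0 // gt_eqF.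
  rewrite mulrDr h1.
  have : 0 <= 4 * s * eta ^- 2 * x ^+ 2.
    by rewrite mulr_ge0 ?sqr_ge0 // mulr_ge0 ?invr_ge0 ?sqr_ge0 // mulr_ge0 // ltW.
  lra.
have I0 : 0 <= I by apply: Rintegral_ge0 => x _; rewrite mul1r semicircle_pdf_ge0.
apply/eqP; rewrite eq_le; apply/andP; split; apply/ler_addgt0Pr => e e0.
  (* Makes [4 s / k^2 = e / (I + 1)], so that the loss [I e / (I + 1)] is at most [e]. *)
  pose k := Num.sqrt (4 * s * (I + 1) / e).
  have k0 : 0 < k by rewrite sqrtr_gt0 divr_gt0 // !mulr_gt0 // ltr_wpDl.
  have k2 : k ^+ 2 = 4 * s * (I + 1) / e by rewrite sqr_sqrtr // divr_ge0 ?mulr_ge0 ?addr_ge0 // ltW.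
  have [_] := main k k0; rewrite k2.
  have -> : 4 * s * (4 * s * (I + 1) / e)^-1 = e / (I + 1).
    by field; rewrite !gt_eqF // ltr_wpDl.
  have : I * (e / (I + 1)) <= e.
    rewrite mulrCA ger_pMr // ler_pdivrMr ?ltr_wpDl //; lra.
  lra.
pose k := Num.sqrt (s / e).
have k0 : 0 < k by rewrite sqrtr_gt0 divr_gt0.
have k2 : k ^+ 2 = s / e by rewrite sqr_sqrtr // divr_ge0 // ltW.
have [+ _] := main k k0; rewrite k2 invf_div mulrCA divff ?gt_eqF // mulr1; lra.
Qed.

Lemma semicircle_cdfE t : semicircle_cdf s t = sc_mean (fun x => (x <= t)%R%:R).
Proof.
rewrite /semicircle_cdf Rintegral_mkcond; apply: eq_Rintegral => x _.
rewrite patchE mem_setE in_itv /=.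
by case: leP => _; rewrite ?mul1r ?mul0r.
Qed.
End SemicircleMean.

(** * From resolvents to distribution functions *)

Lemma pow_diff_le (R : realDomainType) (u u' h : R) k : 0 <= u' -> u' <= u -> u <= 1 -> 0 <= h ->
  u - u' = h * u * u' -> 0 <= u ^+ k - u' ^+ k <= k%:R * h.
Proof.
move=> u'0 u'u u1 h0 hE; have u0 : 0 <= u by exact: le_trans u'u.
elim: k => [|k /andP[IH0 IH1]]; first by rewrite subrr mul0r lexx.
have -> : u ^+ k.+1 - u' ^+ k.+1 = u * (u ^+ k - u' ^+ k) + u' ^+ k * (u - u').
  by rewrite !exprS; ring.
have uk0 : 0 <= u' ^+ k by rewrite exprn_ge0.
have uk1 : u' ^+ k <= 1 by rewrite exprn_ile1 // (le_trans u'u).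
have d0 : 0 <= u - u' by rewrite subr_ge0.
have d1 : u - u' <= h.
  rewrite hE -mulrA ler_piMr // -[leRHS]mul1r ler_pM // (le_trans u'u) //.
rewrite addr_ge0 ?mulr_ge0 //= -natr1 mulrDl mul1r lerD //.
  by rewrite (le_trans _ IH1) // ler_piMl.
by rewrite (le_trans _ d1) // ler_piMl.
Qed.

(** Taylor's formula in [v]: the relation holds for [u = 1 / (x^2 + v)] and
    [u' = 1 / (x^2 + v + h)], and [- k u^(k+1)] is the derivative of [u^k]. The factor [u] kept in
    the error later compensates a factor growing like [x^2]. *)
Lemma pow_diff_quotient (R : realDomainType) (u u' h : R) k :
  0 <= u' -> u' <= u -> u <= 1 -> 0 <= h -> u - u' = h * u * u' ->
  0 <= k%:R * h * u ^+ k.+1 - (u ^+ k - u' ^+ k) <= k%:R ^+ 2 * h ^+ 2 * u.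
Proof.
move=> u'0 u'u u1 h0 hE; have u0 : 0 <= u by exact: le_trans u'u.
elim: k => [|k /andP[IH0 IH1]].
  by rewrite !mul0r subrr subr0 expr0n !mul0r lexx.
set D := _ - _ in IH0 IH1; set z := u ^+ k.+1 - u' ^+ k.+1.
have /andP[z0 z1] := pow_diff_le k.+1 u'0 u'u u1 h0 hE.
rewrite -/z in z0 z1.
have -> : k.+1%:R * h * u ^+ k.+2 - z = u * D + h * u * z.
  have zE : z = u * (u ^+ k - u' ^+ k) + u' ^+ k * (h * u * u').
    by rewrite -hE /z !exprS; ring.
  by rewrite {1}zE /z /D -natr1 !exprS; ring.
have hu : 0 <= h * u by rewrite mulr_ge0.
apply/andP; split; first by rewrite addr_ge0 // mulr_ge0.
have h1 := ler_wpM2l u0 IH1.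
have h2 := ler_wpM2l hu z1.
have h3 : u * (k%:R ^+ 2 * h ^+ 2 * u) <= k%:R ^+ 2 * h ^+ 2 * u.
  by rewrite ler_piMl // mulr_ge0 // mulr_ge0 ?sqr_ge0.
have h4 : 0 <= k%:R * (h ^+ 2 * u) by rewrite mulr_ge0 // mulr_ge0 ?sqr_ge0.
move: h2; rewrite -natr1; move: (k%:R) h1 h3 h4 => q; lra.
Qed.

Lemma Ex_indic d (T : measurableType d) (R : realType) (P : probability T R) (A : set T) :
  measurable A -> Ex P (\1_A) = fine (P A).
Proof. by move=> mA; rewrite /Ex /Rintegral integral_indic // setIT. Qed.

Lemma sqr_half_le (R : realFieldType) (e y : R) : 0 <= e -> e / 2 <= y -> e ^+ 2 <= y ^+ 2 * 4.
Proof.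
move=> e0 hy; have : (e / 2) ^+ 2 <= y ^+ 2.
  by rewrite lerXn2r ?nnegrE ?divr_ge0 // (le_trans _ hy) // divr_ge0.
by rewrite expr_div_n; lra.
Qed.

Lemma sqrD_le (R : realDomainType) (x y : R) : (x + y) ^+ 2 <= 2 * x ^+ 2 + 2 * y ^+ 2.
Proof. by have := sqr_ge0 (x - y); lra. Qed.

(** If [L] is off by more than [e], then [G1] exceeds its mean, or [G2] falls below its own, by at
    least [e / 2]. This is the pointwise inequality behind the Chebyshev estimate. *)
Lemma sandwich_sqr (R : realFieldType) (e L c G1 G2 m1 m2 : R) : 0 < e ->
  L <= G1 -> G2 <= L -> m1 <= c + e / 2 -> c - e / 2 <= m2 -> e < `|L - c| ->
  e ^+ 2 <= 4 * ((G1 - m1) ^+ 2 + (G2 - m2) ^+ 2).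
Proof.
move=> e0 h1 h2 h3 h4; have s1 := sqr_ge0 (G1 - m1); have s2 := sqr_ge0 (G2 - m2).
rewrite lter_normr => /orP[h|h].
  have /(sqr_half_le (ltW e0)) : e / 2 <= G1 - m1 by lra.
  lra.
have /(sqr_half_le (ltW e0)) : e / 2 <= - (G2 - m2) by lra.
by rewrite sqrrN; lra.
Qed.

(** * Mean square convergence of spectral means *)

Section MeanSquareConvergence.
Variables (R : realType) (s : R).
Hypothesis s_gt0 : 0 < s.
Context (d : nat -> measure_display) (T : forall n, measurableType (d n)).
Variables (P : forall n, probability (T n) R) (E : forall n, T n -> seq R).
Hypothesis sizeE : forall n w, size (@E n w) = n.

Definition spec_mean n (h : R -> R) (w : T n) : R := n%:R^-1 * \sum_(a <- E w) h a.

Lemma spec_meanE n h w : @spec_mean n h w = n%:R^-1 * \sum_(a <- E w) h a.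
Proof. by []. Qed.

Lemma spec_meanD n f g w : @spec_mean n (fun x => f x + g x) w = spec_mean f w + spec_mean g w.
Proof. by rewrite /spec_mean big_split mulrDr. Qed.

Lemma spec_meanZ n c f w : @spec_mean n (fun x => c * f x) w = c * spec_mean f w.
Proof. by rewrite /spec_mean -mulr_sumr mulrCA. Qed.

Lemma spec_mean_le n f g w : (forall x, f x <= g x) -> @spec_mean n f w <= spec_mean g w.
Proof. by move=> fg; rewrite ler_wpM2l ?invr_ge0 // ler_sum. Qed.

Lemma spec_mean_cst n c w : (0 < n)%N -> @spec_mean n (fun=> c) w = c.
Proof.
move=> n0; rewrite /spec_mean big_const_seq count_predT sizeE iter_addr_0 -[c *+ n]mulr_natl.
by rewrite mulKf // pnatr_eq0 -lt0n.
Qed.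

Lemma spec_mean0 h w : @spec_mean 0 h w = 0.
Proof. by rewrite /spec_mean invr0 mul0r. Qed.

Lemma spec_mean_dist n f g e w : 0 <= e -> (forall x, `|f x - g x| <= e) ->
  `|@spec_mean n f w - spec_mean g w| <= e.
Proof.
move=> e0 fg; case: (posnP n) => [n0|n0].
  by subst n; rewrite !spec_mean0 subrr normr0.
have h1 : spec_mean f w <= spec_mean g w + e.
  rewrite -[X in _ + X](spec_mean_cst e w n0) -spec_meanD; apply: spec_mean_le => x.
  by have := fg x; rewrite ler_norml; lra.
have h2 : spec_mean g w <= spec_mean f w + e.
  rewrite -[X in _ + X](spec_mean_cst e w n0) -spec_meanD; apply: spec_mean_le => x.
  by have := fg x; rewrite ler_norml; lra.
by rewrite ler_norml; lra.
Qed.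

Lemma sc_mean_cst (c : R) : sc_mean s (fun=> c) = c.
Proof.
have := sc_meanZ s_gt0 c (bmf_cst R 1); rewrite (sc_mean1 s_gt0) mulr1 => {2}<-.
by congr (sc_mean s _); apply/funext => x; rewrite mulr1.
Qed.

Lemma sc_mean_dist f g e : bmf f -> bmf g -> (forall x, `|f x - g x| <= e) ->
  `|sc_mean s f - sc_mean s g| <= e.
Proof.
move=> bf bg fg.
have be : bmf (fun=> e : R) := bmf_cst R e.
have h1 : sc_mean s f <= sc_mean s g + e.
  rewrite -[X in _ + X]sc_mean_cst -sc_meanD //; apply: sc_mean_le => //; first exact: bmfD.
  by move=> x; have := fg x; rewrite ler_norml; lra.
have h2 : sc_mean s g <= sc_mean s f + e.
  rewrite -[X in _ + X]sc_mean_cst -sc_meanD //; apply: sc_mean_le => //; first exact: bmfD.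
  by move=> x; have := fg x; rewrite ler_norml; lra.
by rewrite ler_norml; lra.
Qed.

Lemma spec_meanN0 n w : @spec_mean n (fun=> 0) w = 0.
Proof. by rewrite spec_meanE big1 ?mulr0. Qed.

Opaque spec_mean sc_mean Ex.

(** The class of admissible test functions. It is a vector space closed under uniform limits, and
    includes the measurability of the spectral mean, which is known only for functions built from
    resolvent kernels. *)
Definition sqcvg (h : R -> R) := [/\ bmf h, forall n, measurable_fun setT (@spec_mean n h)
  & forall e, 0 < e -> \forall n \near \oo,
     Ex (P n) (fun w => (spec_mean h w - sc_mean s h) ^+ 2) <= e].

Lemma bmf_spec_mean n h : bmf h -> measurable_fun setT (@spec_mean n h) -> bmf (@spec_mean n h).
Proof.
move=> [_ [B hB]] mh; split=> //; exists B => w.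
have B0 : 0 <= B by exact: le_trans (hB 0).
have := @spec_mean_dist n h (fun=> 0) B w B0 _.
rewrite spec_meanN0.
by rewrite subr0; apply => x; rewrite subr0.
Qed.

Lemma sqcvg_cst c : sqcvg (fun=> c).
Proof.
split; first exact: bmf_cst.
- case=> [|n].
    rewrite (_ : @spec_mean 0 _ = cst 0); first exact: measurable_cst.
    by apply/funext => w; exact: spec_mean0.
  rewrite (_ : @spec_mean n.+1 _ = cst c); first exact: measurable_cst.
  by apply/funext => w; exact: spec_mean_cst.
- move=> e e0; exists 1%N => // n /= n1; rewrite sc_mean_cst.
  under eq_fun do rewrite spec_mean_cst // subrr.
  by rewrite Ex_cst expr0n /= ltW.
Qed.

Lemma sqcvg_spec_bmf n h : sqcvg h -> bmf (@spec_mean n h).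
Proof. by case=> bh mh _; exact: bmf_spec_mean. Qed.

Lemma sqcvgD f g : sqcvg f -> sqcvg g -> sqcvg (fun x => f x + g x).
Proof.
move=> gf gg; have [bf mf cf] := gf; have [bg mg cg] := gg.
have bfg := bmfD bf bg; split; first exact: bfg.
- move=> n; rewrite (_ : @spec_mean n _ = fun w => spec_mean f w + spec_mean g w).
    exact: measurable_funD.
  by apply/funext => w; exact: spec_meanD.
- move=> e e0; have e4 : 0 < e / 4 by rewrite divr_gt0.
  move: (cf _ e4) (cg _ e4); apply: filterS2 => n h1 h2.
  have b1 : bmf (fun w : T n => (spec_mean f w - sc_mean s f) ^+ 2).
    by apply/bmfX/bmfB; [exact: sqcvg_spec_bmf|exact: bmf_cst].
  have b2 : bmf (fun w : T n => (spec_mean g w - sc_mean s g) ^+ 2).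
    by apply/bmfX/bmfB; [exact: sqcvg_spec_bmf|exact: bmf_cst].
  apply: (@le_trans _ _ (Ex (P n) (fun w => 2 * (spec_mean f w - sc_mean s f) ^+ 2
     + 2 * (spec_mean g w - sc_mean s g) ^+ 2))).
    apply: Ex_le.
    + apply/bmfX/bmfB; last exact: bmf_cst.
      rewrite (_ : spec_mean _ = fun w => spec_mean f w + spec_mean g w).
        by apply: bmfD; exact: sqcvg_spec_bmf.
      by apply/funext => w; exact: spec_meanD.
    + by apply: bmfD; exact: bmfZ.
    move=> w; rewrite spec_meanD (sc_meanD s_gt0 bf bg) opprD addrACA.
    exact: sqrD_le.
  rewrite ExD ?ExZ //; [|exact: bmfZ..].
  by move: h1 h2; move: (Ex _ _) (Ex _ _) => z1 z2; lra.
Qed.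

Lemma sqcvgZ c f : sqcvg f -> sqcvg (fun x => c * f x).
Proof.
move=> gf; have [bf mf cf] := gf.
split; first exact: bmfZ.
- move=> n; rewrite (_ : @spec_mean n _ = fun w => c * spec_mean f w).
    by apply: measurable_funM => //; exact: mf.
  by apply/funext => w; exact: spec_meanZ.
- move=> e e0; have e1 : 0 < e / (c ^+ 2 + 1) by rewrite divr_gt0 // ltr_wpDl ?sqr_ge0.
  near=> n.
  have b1 : bmf (fun w : T n => (spec_mean f w - sc_mean s f) ^+ 2).
    by apply/bmfX/bmfB; [exact: sqcvg_spec_bmf|exact: bmf_cst].
  rewrite sc_meanZ //.
  under eq_fun do rewrite spec_meanZ -mulrBr exprMn.
  rewrite ExZ //.
  have h1 : Ex (P n) (fun w => (spec_mean f w - sc_mean s f) ^+ 2) <= e / (c ^+ 2 + 1).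
    by near: n; exact: (cf _ e1).
  apply: le_trans (ler_wpM2l (sqr_ge0 c) h1) _.
  rewrite mulrCA ger_pMr // ler_pdivrMr ?mul1r ?lerDl //.
  by rewrite ltr_wpDl ?sqr_ge0.
Unshelve. all: by end_near. Qed.

Lemma sqcvg_sum (I : Type) (r : seq I) (f : I -> R -> R) :
  (forall i, sqcvg (f i)) -> sqcvg (fun x => \sum_(i <- r) f i x).
Proof.
move=> gf; elim: r => [|i r IH].
  by under eq_fun do rewrite big_nil; exact: sqcvg_cst.
by under eq_fun do rewrite big_cons; exact: (sqcvgD (gf i) IH).
Qed.

(** A spectral mean is a finite sum, so pointwise convergence of the test functions is enough. This
    reaches discontinuous functions, which uniform limits cannot. *)
Lemma spec_mean_measurable_lim n (h : R -> R) (g : nat -> R -> R) :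
  (forall k, sqcvg (g k)) -> (forall x, g k x @[k --> \oo] --> h x) ->
  measurable_fun setT (@spec_mean n h).
Proof.
move=> gg lg; apply: (@measurable_fun_cvg _ _ _ setT (fun k => @spec_mean n (g k))).
  by move=> k; have [_ + _] := gg k; exact.
move=> w _; rewrite spec_meanE; under eq_fun do rewrite spec_meanE.
apply: cvgM; first exact: cvg_cst.
elim: (E w) => [|a l IH].
  by rewrite big_nil; under eq_fun do rewrite big_nil; exact: cvg_cst.
by rewrite big_cons; under eq_fun do rewrite big_cons; apply: cvgD; [exact: lg|exact: IH].
Qed.

Lemma sqcvg_closed h : bmf h ->
  (forall e, 0 < e -> exists2 g, sqcvg g & forall x, `|h x - g x| <= e) -> sqcvg h.
Proof.
move=> bh hg; have mh n : measurable_fun setT (@spec_mean n h).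
  have /choice[g gP] : forall k : nat, exists g, sqcvg g /\ forall x, `|h x - g x| <= k.+1%:R^-1.
    by move=> k; have [|g gg hh] := hg k.+1%:R^-1; [rewrite invr_gt0|exists g].
  apply: (@spec_mean_measurable_lim n h g) => [k|x]; first by have [] := gP k.
  apply/cvgrPdist_le => e e0.
  have : (fun k : nat => k.+1%:R^-1 : R) @ \oo --> 0 by exact: cvg_harmonic.
  move/cvgr0Pnorm_le => /(_ e e0); apply: filterS => k hk.
  have [_ hk'] := gP k; apply: le_trans (hk' x) _.
  by apply: le_trans hk; exact: ler_norm.
split=> // e e0.
(* [e1^2 <= e / 9], so [3 (e / 9) + 6 e1^2 <= e] after the three-term splitting. *)
pose e1 := Num.min 1 (e / 9).
have e10 : 0 < e1 by rewrite lt_min ltr01 divr_gt0.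
have [g gg hgx] := hg e1 e10.
have [bg mg cg] := gg.
have e12 : e1 ^+ 2 <= e / 9.
  have le1 : e1 <= 1 by rewrite ge_min lexx.
  have le9 : e1 <= e / 9 by rewrite ge_min lexx orbT.
  by rewrite expr2 (le_trans _ le9) // ler_piMl // ltW.
have e9 : 0 < e / 9 by rewrite divr_gt0.
near=> n.
have b1 : bmf (fun w : T n => (spec_mean g w - sc_mean s g) ^+ 2).
  by apply/bmfX/bmfB; [exact: sqcvg_spec_bmf|exact: bmf_cst].
apply: (@le_trans _ _ (Ex (P n) (fun w => 3 * (spec_mean g w - sc_mean s g) ^+ 2 + 6 * e1 ^+ 2))).
  apply: Ex_le.
  - by apply/bmfX/bmfB; [exact: bmf_spec_mean|exact: bmf_cst].
  - by apply: bmfD; [exact: bmfZ|exact: bmf_cst].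
  move=> w.
  have -> : spec_mean h w - sc_mean s h = (spec_mean h w - spec_mean g w)
      + (spec_mean g w - sc_mean s g) + (sc_mean s g - sc_mean s h) by ring.
  apply: le_trans (sum3_sqr _ _ _) _.
  have h1 := spec_mean_dist w (ltW e10) hgx.
  have h2 := sc_mean_dist bh bg hgx; rewrite distrC in h2.
  have sq (z : R) : `|z| <= e1 -> z ^+ 2 <= e1 ^+ 2.
    by move=> hz; rewrite -[leLHS]real_normK ?num_real // lerXn2r ?nnegrE // ltW.
  by have := sq _ h1; have := sq _ h2; lra.
have h1 : Ex (P n) (fun w => (spec_mean g w - sc_mean s g) ^+ 2) <= e / 9.
  by near: n; exact: (cg _ e9).
rewrite (ExD _ (bmfZ 3 b1) (bmf_cst _ _)) (ExZ _ _ b1) Ex_cst.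
by move: h1; move: (Ex _ _) => z1; lra.
Unshelve. all: by end_near. Qed.

Lemma sqcvg_ext f g : (forall x, f x = g x) -> sqcvg f -> sqcvg g.
Proof. by move=> /funext ->. Qed.

Variable v0 : R.
Hypothesis v0_ge1 : 1 <= v0.
Local Notation r v x := ((x ^+ 2 + v)^-1).

Let p (v x : R) : v0 <= v -> 0 < x ^+ 2 + v.
Proof. by move=> h; rewrite ltr_wpDl ?sqr_ge0 // (lt_le_trans _ h) // (lt_le_trans _ v0_ge1). Qed.

Lemma sqcvg_res_pow (a : R -> R) : (forall x, `|a x| <= x ^+ 2 + 1) ->
  (forall v, v0 <= v -> bmf (fun x : R => r v x)) ->
  (forall v, v0 <= v -> sqcvg (fun x => a x * r v x)) ->
  forall k v, v0 <= v -> sqcvg (fun x => a x * r v x ^+ k.+1).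
Proof.
move=> ale br ga; elim=> [|k IH] v vv0; first exact: ga.
apply: sqcvg_closed.
  have [ba _ _] := ga v vv0.
  have := bmfM ba (bmfX k.+1 (br v vv0)).
  by congr bmf; apply/funext => x; rewrite [in RHS]exprS mulrA.
move=> e e0.
pose h := e / k.+1%:R.
have h0 : 0 < h by rewrite divr_gt0.
have vh : v0 <= v + h by rewrite (le_trans vv0) // lerDl ltW.
exists (fun x => (k.+1%:R * h)^-1 * (a x * r v x ^+ k.+1 + - 1 * (a x * r (v + h) x ^+ k.+1))).
  by apply/sqcvgZ/sqcvgD; [exact: IH|apply/sqcvgZ/IH].
move=> x; set u := r v x; set u' := r (v + h) x.
have pv := p x vv0; have pvh := p x vh.
have u'0 : 0 <= u' by rewrite invr_ge0 ltW.
have u'u : u' <= u by rewrite lef_pV2 ?posrE // addrA lerDl ltW.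
have x1 : 1 <= x ^+ 2 + v by have := sqr_ge0 x; have := v0_ge1; lra.
have u1 : u <= 1 by rewrite invf_le1.
have uE : u - u' = h * u * u'.
  by rewrite /u /u'; field; rewrite !gt_eqF.
have /andP[D0 D1] := pow_diff_quotient k.+1 u'0 u'u u1 (ltW h0) uE.
have au : `|a x| * u <= 1.
  rewrite ler_pdivrMr // mul1r (le_trans (ale x)) // lerD2l.
  exact: le_trans vv0.
have kh : 0 < k.+1%:R * h by rewrite mulr_gt0.
have -> : a x * u ^+ k.+2 - (k.+1%:R * h)^-1 * (a x * u ^+ k.+1 + -1 * (a x * u' ^+ k.+1))
   = a x * ((k.+1%:R * h)^-1 * (k.+1%:R * h * u ^+ k.+2 - (u ^+ k.+1 - u' ^+ k.+1))).
  by rewrite mulrBr mulKf ?gt_eqF //; ring.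
rewrite normrM [X in _ * X]ger0_norm ?mulr_ge0 ?invr_ge0 ?(ltW kh) //.
apply: (@le_trans _ _ (`|a x| * ((k.+1%:R * h)^-1 * (k.+1%:R ^+ 2 * h ^+ 2 * u)))).
  by rewrite ler_wpM2l // ler_wpM2l // invr_ge0 ltW.
have -> : `|a x| * ((k.+1%:R * h)^-1 * (k.+1%:R ^+ 2 * h ^+ 2 * u)) = e * (`|a x| * u).
  rewrite /h; move: (ltr0Sn R k) => k0; field; rewrite !gt_eqF //.
by rewrite ger_pMr.
Qed.

Hypothesis sqcvg_im : forall v, v0 <= v -> sqcvg (fun x => r v x).
Hypothesis sqcvg_re : forall v, v0 <= v -> sqcvg (fun x => x * r v x).

(** [x^2 r = 1 - v r] with [r = 1 / (x^2 + v)], so [x^(k+2) r^(m+1) = x^k r^m - v x^k r^(m+1)]: the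
    degree drops by two, and the induction carries two consecutive degrees down to 0 and 1. *)
Lemma sqcvg_monomial v j i : v0 <= v -> (j <= i)%N -> sqcvg (fun x => x ^+ j * r v x ^+ i).
Proof.
move=> vv0.
have br w : v0 <= w -> bmf (fun x : R => r w x) by move=> /sqcvg_im [].
have g0 k : sqcvg (fun x => r v x ^+ k).
  case: k => [|k]; first exact: sqcvg_cst.
  apply: (@sqcvg_ext (fun x => 1 * r v x ^+ k.+1)) => [x|]; first by rewrite mul1r.
  apply: (@sqcvg_res_pow (fun=> 1) _ br _ k v vv0).
    by move=> x; rewrite normr1 lerDr sqr_ge0.
  by move=> w /sqcvg_im; apply: sqcvg_ext => x; rewrite mul1r.
have g1 k : sqcvg (fun x => x * r v x ^+ k.+1).
  apply: (@sqcvg_res_pow id _ br sqcvg_re k v vv0) => x.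
  have := sqr_ge0 (`|x| - 1); rewrite -[x ^+ 2]real_normK ?num_real //.
  have := sqr_ge0 `|x|; lra.
suff h : forall j, (forall i, (j <= i)%N -> sqcvg (fun x => x ^+ j * r v x ^+ i)) /\
    (forall i, (j.+1 <= i)%N -> sqcvg (fun x => x ^+ j.+1 * r v x ^+ i)).
  by move=> ji; exact: (h j).1.
elim=> [|k [IH0 IH1]]; split=> //.
- by move=> k _; apply: sqcvg_ext (g0 k) => x; rewrite mul1r.
- by case=> [|k] k1; [rewrite ltn0 in k1|apply: sqcvg_ext (g1 k) => x; rewrite expr1].
case=> [|m] km; first by rewrite ltn0 in km.
have h1 := IH0 m (ltnW (ltnSE km)).
have h2 := sqcvgZ (- v) (IH0 m.+1 (ltnW (ltnW km))).
apply: sqcvg_ext (sqcvgD h1 h2) => x.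
have pv := p x vv0; rewrite !exprS.
move: (x ^+ k) (r v x ^+ m) => y z; field; rewrite gt_eqF //.
Qed.

Lemma sqcvg_poly v (q : {poly R}) : v0 <= v -> sqcvg (fun x => q.[res_fun v x]).
Proof.
move=> vv0.
apply: (@sqcvg_ext (fun x => \sum_(i < size q) q`_i * (x ^+ i * r v x ^+ i))) => [x|].
  by rewrite horner_coef; apply: eq_bigr => i _; rewrite /res_fun exprMn.
by apply: sqcvg_sum => i; apply: sqcvgZ; exact: sqcvg_monomial.
Qed.

Lemma sqcvg_tail v : v0 <= v -> sqcvg (tail_fun v).
Proof.
move=> vv0; apply: (@sqcvg_ext (fun x => 1 + (- v) * r v x)) => [x|].
  by rewrite /tail_fun mulNr.
by apply: sqcvgD; [exact: sqcvg_cst|apply: sqcvgZ; exact: sqcvg_im].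
Qed.

(** With [eta^2 = v] the mean is [1 - eta b = s b^2], and [b <= 1 / eta]. *)
Lemma sc_mean_tail v : v0 <= v -> 0 <= sc_mean s (tail_fun v) <= s / v.
Proof.
move=> vv0; pose eta := Num.sqrt v.
have vg : 0 < v by rewrite (lt_le_trans _ vv0) // (lt_le_trans _ v0_ge1).
have e0 : 0 < eta by rewrite sqrtr_gt0.
have e2 : eta ^+ 2 = v by rewrite sqr_sqrtr // ltW.
have bi := bmf_res_im_fun e0.
have -> : sc_mean s (tail_fun v) = s * sc_root s eta ^+ 2.
  rewrite (_ : tail_fun v = fun x => 1 + - eta * (eta / (x ^+ 2 + eta ^+ 2))); last first.
    by apply/funext => x; rewrite /tail_fun mulrA mulNr -expr2 e2 mulNr.
  rewrite sc_meanD //; [|exact: bmf_cst|exact: bmfZ].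
  rewrite sc_meanZ // sc_mean_res_im // sc_mean_cst.
  have := sc_root_eq s_gt0 eta; lra.
rewrite mulr_ge0 ?sqr_ge0 ?(ltW s_gt0) //= ler_wpM2l ?(ltW s_gt0) //.
have hb := sc_root_gt0 s_gt0 e0.
rewrite -e2 -exprVn lerXn2r // ?nnegrE ?invr_ge0 ?(ltW hb) ?(ltW e0) //.
rewrite -[_^-1]mul1r ler_pdivlMr // mulrC -(sc_root_eq s_gt0 eta) lerDl.
by rewrite mulr_ge0 ?sqr_ge0 // ltW.
Qed.

Definition step (t x : R) : R := (x <= t)%R%:R.

Lemma bmf_step t : bmf (step t).
Proof.
split.
  have -> : step t = \1_`]-oo, t].
    apply/funext => x; rewrite indicE mem_setE in_itv /=.
    by rewrite /step.
  exact: measurable_indic.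
by exists 1 => x; rewrite /step; case: (x <= t)%R; rewrite ?normr1 ?normr0.
Qed.

(** The step is the pointwise limit of polynomials from [step_test], with window and error
    [1 / (k+1)] and [v >= k+1]: at a fixed [x] the tail is at most [x^2 / (k+1)]. *)
Lemma spec_mean_step_measurable n t : measurable_fun setT (@spec_mean n (step t)).
Proof.
have /choice[q qP] : forall k : nat, exists vq : R * {poly R}, [/\ v0 <= vq.1, k.+1%:R <= vq.1 &
    forall x, step t x - k.+1%:R^-1 - 2 * tail_fun vq.1 x <= vq.2.[res_fun vq.1 x]
     <= step (t + k.+1%:R^-1) x + k.+1%:R^-1 + 2 * tail_fun vq.1 x].
  move=> k; have k0 : 0 < k.+1%:R^-1 :> R by rewrite invr_gt0.
  have tk : t < t + k.+1%:R^-1 by rewrite ltrDl.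
  have [v [q [vm _ hq]]] := step_test (Num.max v0 k.+1%:R) tk k0.
  by exists (v, q); split => //=; rewrite (le_trans _ vm) // le_max lexx ?orbT.
apply: (@spec_mean_measurable_lim n (step t) (fun k x => (q k).2.[res_fun (q k).1 x])).
  by move=> k; apply: sqcvg_poly; have [] := qP k.
move=> x; apply/cvgrPdist_le => e e0.
have c1 : (fun k : nat => k.+1%:R^-1 : R) @ \oo --> 0 by exact: cvg_harmonic.
have ex : 0 < e / (1 + 2 * x ^+ 2) by rewrite divr_gt0 // ltr_pwDl // mulr_ge0 ?sqr_ge0.
have n1 : \forall k \near \oo, (k.+1%:R^-1 : R) <= e / (1 + 2 * x ^+ 2).
  move/cvgr0Pnorm_le : c1 => /(_ _ ex); apply: filterS => k hk.
  by apply: le_trans hk; exact: ler_norm.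
(* Right continuity of the step in its threshold: the windows must shrink to [t] from the right. *)
have n2 : \forall k \near \oo, step (t + k.+1%:R^-1) x = step t x.
  have [xt|tx] := leP x t.
    near=> k; rewrite /step xt; congr (_%:R); congr nat_of_bool.
    by rewrite (le_trans xt) // lerDl invr_ge0.
  have : 0 < x - t by rewrite subr_gt0.
  move=> xt; move/cvgr0Pnorm_lt : c1 => /(_ _ xt); apply: filterS => k hk.
  rewrite /step; congr (_%:R); congr nat_of_bool; rewrite [RHS]leNgt tx /=.
  apply/negbTE; rewrite -ltNge -ltrBrDl; apply: le_lt_trans hk; exact: ler_norm.
near=> k.
have [qv qk hq] := qP k.
have k0 : 0 < k.+1%:R^-1 :> R by rewrite invr_gt0.
have tail : tail_fun (q k).1 x <= x ^+ 2 * k.+1%:R^-1.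
  have pv := p x qv.
  have -> : tail_fun (q k).1 x = x ^+ 2 / (x ^+ 2 + (q k).1).
    by rewrite /tail_fun; field; rewrite gt_eqF.
  rewrite ler_wpM2l ?sqr_ge0 // lef_pV2 ?posrE // (le_trans qk) // lerDr sqr_ge0 //.
have := hq x; have -> : step (t + k.+1%:R^-1) x = step t x by near: k; exact: n2.
have : k.+1%:R^-1 * (1 + 2 * x ^+ 2) <= e.
  have q0 : 0 < 1 + 2 * x ^+ 2 by rewrite ltr_pwDl // mulr_ge0 ?sqr_ge0.
  by rewrite -ler_pdivlMr //; near: k; exact: n1.
move: tail; rewrite ler_norml; move: (k.+1%:R^-1) => z h1 h2 /andP[h3 h4].
apply/andP; split; lra.
Unshelve. all: by end_near. Qed.

(** [g1] and [g2] enclose the step and converge in mean square, while their semicircle means are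
    within [eps / 2] of the limit on the relevant sides. Chebyshev's inequality concludes. *)
Lemma spec_mean_cvg_in_probability t : {for t, continuous (semicircle_cdf s)} ->
  forall eps, 0 < eps ->
  P n [set w | eps < `|@spec_mean n (step t) w - semicircle_cdf s t|] @[n --> \oo] --> 0%E.
Proof.
move=> ct eps eps0.
have e4 : 0 < eps / 4 by rewrite divr_gt0.
have [del /= del0 hdel] : exists2 del : R, 0 < del & forall y, `|t - y| <= del ->
    `|semicircle_cdf s t - semicircle_cdf s y| <= eps / 4.
  have /cvgrPdist_le /(_ _ e4) [dd /= dd0 hd] := ct.
  exists (dd / 2); first by rewrite divr_gt0.
  by move=> y ty; apply: hd => /=; rewrite (le_lt_trans ty) // ltr_pdivrMr // mulr2n mulrDr mulr1 ltrDl.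
pose e := eps / 16; have e0 : 0 < e by rewrite divr_gt0.
(* Ensures [s / v <= eps / 32]. The budget of [eps / 2] is then [eps / 4] by continuity at [t],
   [2 e = eps / 8], and four tail means, again [eps / 8]. *)
pose V := Num.max v0 (32 * s / eps).
have tail_small v : V <= v -> v0 <= v /\ sc_mean s (tail_fun v) <= eps / 32.
  rewrite ge_max => /andP[vv0 vs]; split=> //; have /andP[_ h] := sc_mean_tail vv0.
  have vg : 0 < v by rewrite (lt_le_trans _ vv0) // (lt_le_trans _ v0_ge1).
  apply: le_trans h _; rewrite ler_pdivrMr //.
  move: vs; rewrite ler_pdivrMr //; lra.
have tt1 : t < t + del by rewrite ltrDl.
have tt2 : t - del < t by rewrite ltrBlDr ltrDl.
have [v1 [q1 [Vv1 _ hq1]]] := step_test V tt1 e0.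
have [v2 [q2 [Vv2 _ hq2]]] := step_test V tt2 e0.
have [v01 t1] := tail_small _ Vv1; have [v02 t2] := tail_small _ Vv2.
pose g1 x := q1.[res_fun v1 x] + (e + 2 * tail_fun v1 x).
pose g2 x := q2.[res_fun v2 x] + (- e + - 2 * tail_fun v2 x).
have gg1 : sqcvg g1.
  apply: sqcvgD; first exact: sqcvg_poly.
  by apply: sqcvgD; [exact: sqcvg_cst|apply: sqcvgZ; exact: sqcvg_tail].
have gg2 : sqcvg g2.
  apply: sqcvgD; first exact: sqcvg_poly.
  by apply: sqcvgD; [exact: sqcvg_cst|apply: sqcvgZ; exact: sqcvg_tail].
have [bg1 _ cg1] := gg1; have [bg2 _ cg2] := gg2.
have [bt1 _ _] := sqcvg_tail v01; have [bt2 _ _] := sqcvg_tail v02.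
have m1 : sc_mean s g1 <= semicircle_cdf s t + eps / 2.
  have h : sc_mean s g1 <= sc_mean s (fun x => step (t + del) x + (2 * e + 4 * tail_fun v1 x)).
    apply: sc_mean_le => //.
      by do ?[exact: bmf_step | exact: bmf_cst | exact: bmfZ | apply: bmfD].
    move=> x; have := hq1 x; rewrite /g1 -/(step _ _) => /andP[_]; rewrite -/(step _ _); lra.
  apply: le_trans h _; rewrite sc_meanD ?sc_meanD ?sc_meanZ ?sc_mean_cst //;
    try by do ?[exact: bmf_step | exact: bmf_cst | exact: bmfZ | apply: bmfD].
  rewrite -(semicircle_cdfE s).
  have := hdel (t + del); rewrite opprD addrA subrr add0r normrN gtr0_norm // => /(_ (lexx _)).
  rewrite ler_norml /e; lra.
have m2 : semicircle_cdf s t - eps / 2 <= sc_mean s g2.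
  have h : sc_mean s (fun x => step (t - del) x + (- (2 * e) + - 4 * tail_fun v2 x)) <= sc_mean s g2.
    apply: sc_mean_le => //.
      by do ?[exact: bmf_step | exact: bmf_cst | exact: bmfZ | apply: bmfD].
    move=> x; have := hq2 x; rewrite /g2 -/(step _ _) => /andP[]; rewrite -/(step _ _); lra.
  apply: le_trans h; rewrite sc_meanD ?sc_meanD ?sc_meanZ ?sc_mean_cst //;
    try by do ?[exact: bmf_step | exact: bmf_cst | exact: bmfZ | apply: bmfD].
  rewrite -(semicircle_cdfE s).
  have := hdel (t - del); rewrite opprB addrCA subrr addr0 gtr0_norm // => /(_ (lexx _)).
  rewrite ler_norml /e; lra.
have le1 x : step t x <= g1 x.
  by have /andP[+ _] := hq1 x; rewrite /g1 -/(step t x); lra.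
have le2 x : g2 x <= step t x.
  by have /andP[_ +] := hq2 x; rewrite /g2 -/(step t x); lra.
pose A n := [set w | eps < `|@spec_mean n (step t) w - semicircle_cdf s t|].
have mL n : measurable_fun setT (fun w => `|@spec_mean n (step t) w - semicircle_cdf s t|).
  apply: measurableT_comp => //; apply: measurable_funB; last exact: measurable_cst.
  exact: spec_mean_step_measurable.
have mA n : measurable (A n) by exact: measurable_superlevel.
have PA n : fine (P n (A n)) = Ex (P n) (\1_(A n)).
  by rewrite Ex_indic.
apply: cvg_EFin; first by apply: nearW => n; exact: fin_num_measure.
apply/cvgr0Pnorm_le => z z0.
(* Two errors of this size, multiplied by the Chebyshev factor [4 / eps^2], add up to [z]. *)
have z1 : 0 < z * eps ^+ 2 / 8 by rewrite divr_gt0 // mulr_gt0 // exprn_gt0.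
move: (cg1 _ z1) (cg2 _ z1); apply: filterS2 => n h1 h2.
rewrite -[X in `|X|]/(fine (P n (A n))) PA ger0_norm; last by apply: Ex_ge0 => w; rewrite indicE.
have b1 : bmf (fun w : T n => (spec_mean g1 w - sc_mean s g1) ^+ 2).
  by apply/bmfX/bmfB; [exact: sqcvg_spec_bmf|exact: bmf_cst].
have b2 : bmf (fun w : T n => (spec_mean g2 w - sc_mean s g2) ^+ 2).
  by apply/bmfX/bmfB; [exact: sqcvg_spec_bmf|exact: bmf_cst].
apply: (@le_trans _ _ (Ex (P n) (fun w => 4 / eps ^+ 2 * ((spec_mean g1 w - sc_mean s g1) ^+ 2
   + (spec_mean g2 w - sc_mean s g2) ^+ 2)))).
  apply: Ex_le.
  - split; first exact: measurable_indic.
    by exists 1 => w; rewrite indicE; case: (_ \in _); rewrite ?normr1 ?normr0.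
  - by apply/bmfZ/bmfD.
  move=> w; rewrite mulrC mulrA ler_pdivlMr ?exprn_gt0 // indicE.
  have s1 := sqr_ge0 (spec_mean g1 w - sc_mean s g1).
  have s2 := sqr_ge0 (spec_mean g2 w - sc_mean s g2).
  have [|_] := boolP (w \in A n); last by rewrite mul0r mulr_ge0 // addr_ge0.
  rewrite inE /A /= mul1r => hw.
  have l1 := spec_mean_le w le1; have l2 := spec_mean_le w le2.
  rewrite mulrC; exact: (sandwich_sqr eps0 l1 l2 m1 m2 hw).
rewrite ExZ; last exact: bmfD.
rewrite ExD //.
have -> : z = 4 / eps ^+ 2 * (z * eps ^+ 2 / 8 + z * eps ^+ 2 / 8).
  by field; rewrite gt_eqF.
apply: ler_wpM2l; first by rewrite divr_ge0 // sqr_ge0.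
exact: lerD h1 h2.
Qed.
End MeanSquareConvergence.

(** * Random multipartite matrices *)

Section Clip.
Variables (R : realType) (K : R).
Hypothesis K_ge0 : 0 <= K.

(* The entries are bounded by [K] only almost surely; clipping makes the bound hold everywhere. *)
Definition clip (z : R) : R := Num.max (- K) (Num.min K z).

Lemma clip_le z : `|clip z| <= K.
Proof.
rewrite /clip ler_norml le_max lexx /= ge_max ge_min lexx /= andbT.
by rewrite (le_trans _ K_ge0) // oppr_le0.
Qed.

Lemma clip_id z : `|z| <= K -> clip z = z.
Proof. by rewrite ler_norml => /andP[h1 h2]; rewrite /clip min_r // max_r. Qed.

Lemma measurable_clip : measurable_fun setT clip.
Proof.
apply: measurable_maxr; first exact: measurable_cst.
by apply: measurable_minr; [exact: measurable_cst|exact: measurable_id].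
Qed.

Context d (T : measurableType d) (P : probability T R).
Variables (X : {RV P >-> R}) (F : probability (measurableTypeR R) R).
Hypothesis XF : forall A, measurable A -> distribution P X A = F A.
Hypothesis XK : {ae P, forall w, `|X w| <= K}.

Lemma bmf_comp_clip (f : R -> R) B : measurable_fun setT f ->
  (forall z, `|z| <= K -> `|f z| <= B) -> bmf (fun w => f (clip (X w))).
Proof.
move=> mf fB; split; last by exists B => w; apply/fB/clip_le.
by apply: measurableT_comp => //; apply: measurableT_comp => //; exact: measurable_clip.
Qed.

(** [F] is the law of [X], hence carried by [[- K, K]], where clipping is the identity; the rest is
    the change of variables to [P]. *)
Lemma law_transfer (f : R -> R) B : measurable_fun setT f ->
  (forall z, `|z| <= K -> `|f z| <= B) ->
  fine (\int[F]_z (f z)%:E) = Ex P (fun w => f (clip (X w))).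
Proof.
move=> mf fB; have bf := bmf_comp_clip mf fB.
have mfc : measurable_fun setT (f \o clip).
  by apply: measurableT_comp => //; exact: measurable_clip.
transitivity (fine (\int[F]_z (f (clip z))%:E)).
  congr fine; apply: ae_eq_integral => //; [exact/measurable_EFinP..|].
  have mN : measurable [set z : R | K < `|z|].
    by apply: measurable_superlevel; exact: normr_measurable.
  exists [set z : R | K < `|z|]; split => //.
    apply: (etrans (esym (XF mN))); case: XK => N [mN0 N0 hN].
    apply: (subset_measure0 _ mN0 _ N0).
      by rewrite -[X in measurable X]setTI; exact: measurable_funP.
    by apply: subset_trans hN => w /= h; rewrite leNgt => /negP; apply.
  move=> z /= h; rewrite ltNge; apply/negP => zK; apply: h => _.
  by rewrite clip_id.
have mX : @measurable_fun _ _ T (measurableTypeR R) setT X := measurable_funP X.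
pose X' : {RV P >-> measurableTypeR R} :=
  @mfun_Sub _ _ T (measurableTypeR R) X (mem_set mX).
have mfc' : @measurable_fun _ _ (measurableTypeR R) (\bar R) setT (fun z => (f (clip z))%:E).
  exact/measurable_EFinP.
rewrite (eq_measure_integral (distribution P X')); last by move=> A mA _; exact/esym/XF.
rewrite integral_distribution //.
exact: bmf_integrable.
Qed.

Lemma law_meanE : law_mean F = Ex P (fun w => clip (X w)).
Proof. by rewrite /law_mean unlock (law_transfer (f := id) (B := K)). Qed.

Lemma law_varianceE : law_variance F = Ex P (fun w => (clip (X w) - law_mean F) ^+ 2).
Proof.
rewrite /law_variance /variance covariance.unlock -/(law_mean F) unlock.
have mf : measurable_fun setT (fun z : R => (z - law_mean F) ^+ 2).
  by apply/measurable_funX/measurable_funB; [exact: measurable_id|exact: measurable_cst].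
rewrite -(law_transfer (B := (K + `|law_mean F|) ^+ 2) mf) => [|z zK].
  by congr fine; apply: eq_integral => z _; rewrite expr2.
rewrite normrX lerXn2r ?nnegrE ?addr_ge0 //.
by rewrite (le_trans (ler_normB _ _)) // lerD2r.
Qed.

Lemma law_mean_le : `|law_mean F| <= K.
Proof.
rewrite law_meanE ler_norml -(Ex_cst P (- K)) -{2}(Ex_cst P K).
have bc : bmf (fun w => clip (X w)) by apply: (@bmf_comp_clip id K) => //; exact: measurable_id.
apply/andP; split; apply: Ex_le => //; try exact: bmf_cst.
  by move=> w; have := clip_le (X w); rewrite ler_norml => /andP[].
by move=> w; have := clip_le (X w); rewrite ler_norml => /andP[].
Qed.
End Clip.

(** * Clipped, centered and normalized entries *)

Section Model.
Context (R : realType) (d : measure_display) (T : measurableType d) (P : probability T R).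
Variables (n m : nat) (V : 'I_n -> 'I_m).
Variables (F1 F2 : probability (measurableTypeR R) R) (K : R).
Variable x : 'I_n -> 'I_n -> {RV P >-> R}.
Hypothesis hx : random_multipartite V F1 F2 K x.

Definition entry_law (i j : 'I_n) := if V i == V j then F1 else F2.

(** Clipping at [|K|] gives a nonnegative level whatever the sign of [K]. *)
Definition normalized_entry (i j : 'I_n) (z : R) : R :=
  (Num.sqrt n%:R)^-1 * (clip `|K| z - law_mean (entry_law i j)).

Let X (e : 'I_n * 'I_n) : {RV P >-> R} := x e.1 e.2.
Local Notation phi := normalized_entry.

Lemma edge_entry i j w : X (edge i j) w = x i j w.
Proof. by rewrite /X /edge; case: ifP => //= _; rewrite (entries_symmetric hx). Qed.

Lemma entry_lawC i j : entry_law i j = entry_law j i.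
Proof. by rewrite /entry_law eq_sym. Qed.

Lemma edge_law i j A : measurable A -> distribution P (X (edge i j)) A = entry_law i j A.
Proof.
move=> mA; have h k l : distribution P (x k l) A = entry_law k l A.
  rewrite /entry_law; case: eqP => Vkl.
    exact: (entries_within_parts hx Vkl mA).
  exact: (entries_between_parts hx Vkl mA).
by rewrite /X /edge; case: ifP => _ //=; rewrite entry_lawC.
Qed.

Lemma edge_bounded i j : {ae P, forall w, `|X (edge i j) w| <= `|K|}.
Proof.
apply: filterS (entries_bounded hx (edge i j).1 (edge i j).2) => w h.
exact: le_trans h (ler_norm K).
Qed.

Let K0 : 0 <= `|K| := normr_ge0 K.

Lemma bmf_normalized_entry i j : bmf (phi i j).
Proof.
apply: bmfZ; apply: bmfB; last exact: bmf_cst.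
by split; [exact: measurable_clip|exists `|K| => z; exact: clip_le].
Qed.

Lemma normalized_entryC i j : phi i j = phi j i.
Proof. by apply/funext => z; rewrite /normalized_entry entry_lawC. Qed.

Local Notation y := (wigner_entry X phi).

Lemma entry_mean i j : law_mean (entry_law i j) = Ex P (fun w => clip `|K| (X (edge i j) w)).
Proof. exact: (law_meanE K0 (edge_law i j) (edge_bounded i j)). Qed.

Let bclip i j : bmf (fun w => clip `|K| (X (edge i j) w)).
Proof. by apply: (@bmf_comp_clip _ _ K0 _ _ P (X (edge i j)) id `|K|) => //; exact: measurable_id. Qed.

Lemma wigner_entry_le i j w : `|y i j w| <= 2 * `|K| / Num.sqrt n%:R.
Proof.
rewrite /wigner_entry /normalized_entry normrM normfV (ger0_norm (sqrtr_ge0 _)) mulrC.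
rewrite ler_wpM2r ?invr_ge0 ?sqrtr_ge0 // (le_trans (ler_normB _ _)) //.
have := clip_le K0 (X (edge i j) w).
have := law_mean_le K0 (edge_law i j) (edge_bounded i j).
lra.
Qed.

Lemma wigner_entry_mean i j : Ex P (y i j) = 0.
Proof.
rewrite /wigner_entry /normalized_entry ExZ; last first.
  by apply: bmfB; [exact: bclip|exact: bmf_cst].
by rewrite ExB ?Ex_cst ?entry_mean ?subrr ?mulr0 //; exact: bmf_cst.
Qed.

Lemma wigner_entry_variance i j :
  Ex P (fun w => y i j w ^+ 2) = n%:R^-1 * law_variance (entry_law i j).
Proof.
rewrite (law_varianceE K0 (edge_law i j) (edge_bounded i j)) -ExZ; last first.
  by apply/bmfX/bmfB; [exact: bclip|exact: bmf_cst].
apply: eq_Rintegral => w _.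
by rewrite /wigner_entry /normalized_entry exprMn exprVn sqr_sqrtr.
Qed.

Lemma row_variance i : (0 < n)%N -> \sum_j Ex P (fun w => y i j w ^+ 2) =
  law_variance F2 + part_fraction R V (V i) * (law_variance F1 - law_variance F2).
Proof.
move=> n0; have nN0 : n%:R != 0 :> R by rewrite pnatr_eq0 -lt0n.
transitivity (\sum_(j < n) (n%:R^-1 * law_variance F2
   + n%:R^-1 * (law_variance F1 - law_variance F2) * (V j == V i)%:R)).
  apply: eq_bigr => j _; rewrite wigner_entry_variance /entry_law eq_sym.
  by case: (V j == V i) => /=; ring.
rewrite big_split /= sumr_const card_ord -[_ *+ n]mulr_natl mulVKf // -mulr_sumr.
have -> : \sum_(j < n) (V j == V i)%:R = #|[set p | V p == V i]%SET|%:R :> R.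
  rewrite -sum1_card natr_sum [in RHS]big_mkcond /=; apply: eq_bigr => j _.
  by rewrite inE; case: (V j == V i).
by rewrite /part_fraction; congr (_ + _); ring.
Qed.

(** Off a null set clipping changes nothing, so expectations computed for the everywhere bounded
    matrix hold for the given one. *)
Lemma wigner_mx_ae : {ae P, forall w, wigner_mx X phi w = (Num.sqrt n%:R)^-1 *:
  centered_mx V (law_mean F1) (law_mean F2) (sample_mx (fun i j => x i j : T -> R) w)}.
Proof.
have h : {ae P, forall w, forall i j, `|x i j w| <= `|K|}.
  apply: filter_forall => i; apply: filter_forall => j.
  apply: filterS (entries_bounded hx i j) => w h; exact: le_trans h (ler_norm K).
apply: filterS h => w h; apply/matrixP => i j.
rewrite !mxE /wigner_entry edge_entry /normalized_entry clip_id // /entry_law.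
by case: (V i == V j) => /=; ring.
Qed.
End Model.

Lemma Ex_ae d (T : measurableType d) (R : realType) (P : probability T R) (f g : T -> R) :
  bmf f -> bmf g -> {ae P, forall w, f w = g w} -> Ex P f = Ex P g.
Proof.
move=> [mf _] [mg _] fg; congr fine; apply: ae_eq_integral => //; [exact/measurable_EFinP..|].
by apply: filterS fg => w /= -> _.
Qed.

(** The order of choice matters: [N] makes the geometric term small, then [delta] is fixed, and only
    then is [n] large enough for [beta^2 = B2 / n] to be negligible even after multiplication by
    [N]. *)
Lemma rate_small (R : realType) (B2 eta e : R) : 0 <= B2 -> 1 <= eta -> 0 < e ->
  exists N delta, 0 < delta /\ \forall n \near \oo, forall beta : R, n%:R * beta ^+ 2 = B2 ->
    2^-1 ^+ N * (2 * eta ^- 2) + 2 * res_rate beta eta delta B2 N <= e.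
Proof.
move=> B0 eta1 e0; have e4 : 0 < e / 4 by rewrite divr_gt0.
have eta0 : 0 < eta by exact: lt_le_trans eta1.
have [N hN] : exists N, (2^-1 : R) ^+ N <= e / 4.
  have : (fun k => (2^-1 : R) ^+ k) @ \oo --> (0 : R).
    by apply: cvg_expr; rewrite gtr0_norm ?invr_gt0 // invf_lt1 // ltr1n.
  move/cvgr0Pnorm_le => /(_ _ e4) [k _ /(_ k (leqnn k))] /=.
  by rewrite gtr0_norm ?exprn_gt0 ?invr_gt0 // => h; exists k.
(* [(2 delta)^2 <= 4 delta <= e / 24], once [N beta^2 <= delta]. *)
pose delta := Num.min 1 (e / 96).
have d0 : 0 < delta by rewrite lt_min ltr01 divr_gt0.
have d1 : delta <= 1 by rewrite ge_min lexx.
have d2 : delta <= e / 96 by rewrite ge_min lexx orbT.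
exists N, delta; split=> //.
(* The two bounds on [beta^2] give [beta^2 (1 + 20 B2) <= e / 24] and [N beta^2 <= delta]; hence
   [res_rate <= 3 (e / 24 + e / 24) = e / 4]. *)
pose z := Num.min (e / (24 * (1 + 20 * B2))) (delta / (N%:R + 1)).
have B1 : 0 < 24 * (1 + 20 * B2) by rewrite mulr_gt0 // ltr_wpDr // mulr_ge0.
have N1 : 0 < N%:R + 1 :> R by rewrite ltr_wpDl.
have z0 : 0 < z by rewrite lt_min !divr_gt0.
near=> n => beta hb.
have n0 : 0 < n%:R :> R by rewrite ltr0n; near: n; exact: nbhs_infty_gt.
have b0 := sqr_ge0 beta.
have bz : beta ^+ 2 <= z.
  rewrite -(ler_pM2l n0) hb mulrC -ler_pdivrMl // mulrC.
  by near: n; exact: nbhs_infty_ger.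
have h1 : beta ^+ 2 * (24 * (1 + 20 * B2)) <= e.
  by rewrite -ler_pdivlMr // (le_trans bz) // ge_min lexx.
have h2 : N%:R * beta ^+ 2 <= delta.
  have : beta ^+ 2 * (N%:R + 1) <= delta.
    by rewrite -ler_pdivlMr // (le_trans bz) // ge_min lexx orbT.
  lra.
have h3 : (delta + N%:R * beta ^+ 2) ^+ 2 <= e / 24.
  apply: (@le_trans _ _ ((2 * delta) ^+ 2)).
    have nb : 0 <= N%:R * beta ^+ 2 by rewrite mulr_ge0.
    rewrite lerXn2r ?nnegrE //; [exact: addr_ge0 (ltW d0) nb|by rewrite mulr_ge0 // ltW|lra].
  have : delta ^+ 2 <= delta by rewrite expr2 ler_piMl // ltW.
  rewrite exprMn; lra.
have i0 k : 0 <= eta ^- k <= 1.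
  by rewrite invr_ge0 exprn_ge0 ?(ltW eta0) //= invf_le1 ?exprn_gt0 // exprn_ege1.
have /andP[i20 i21] := i0 2; have /andP[i40 i41] := i0 4.
have r1 : 2^-1 ^+ N * (2 * eta ^- 2) <= e / 2.
  apply: (@le_trans _ _ (e / 4 * 2)); last by lra.
  have p0 : 0 <= (2^-1 : R) ^+ N by rewrite exprn_ge0 // invr_ge0.
  have q0 : 0 <= 2 * eta ^- 2 by rewrite mulr_ge0.
  by apply: ler_pM => //; lra.
have r2 : res_rate beta eta delta B2 N <= e / 4.
  rewrite /res_rate.
  apply: (@le_trans _ _ (3 * (beta ^+ 2 + 20 * (B2 * beta ^+ 2)
      + (delta + N%:R * beta ^+ 2) ^+ 2))); last by lra.
  have q0 : 0 <= beta ^+ 2 + 20 * (B2 * beta ^+ 2 * eta ^- 2)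
      + (delta + N%:R * beta ^+ 2) ^+ 2 * eta ^- 2.
    by do ?[exact: sqr_ge0 | apply: addr_ge0 | apply: mulr_ge0 => //].
  rewrite -mulrA ler_wpM2l // (le_trans (ler_piMl q0 i41)) //.
  apply: lerD; last by rewrite ler_piMr ?sqr_ge0.
  by rewrite lerD2l ler_wpM2l // ler_piMr // mulr_ge0.
lra.
Unshelve. all: by end_near. Qed.

(** * Sequences of matrices whose row variances converge *)

Section Sequence.
Variables (R : realType) (d : nat -> measure_display) (T : forall n, measurableType (d n)).
Variables (P : forall n, probability (T n) R) (m : nat -> nat) (V : forall n, 'I_n -> 'I_(m n)).
Variables (F1 F2 : probability (measurableTypeR R) R) (K : R).
Variable x : forall n, 'I_n -> 'I_n -> {RV (P n) >-> R}.
Arguments V : clear implicits.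
Arguments x : clear implicits.
Hypothesis hx : forall n, random_multipartite (V n) F1 F2 K (x n).
Variable s : R.
Hypothesis s_gt0 : 0 < s.
Hypothesis row_cvg : forall delta, 0 < delta -> \forall n \near \oo, forall i : 'I_n,
  `|law_variance F2 + part_fraction R (V n) (V n i) * (law_variance F1 - law_variance F2) - s|
    <= delta.

Let M n (w : T n) : 'M[R]_n := (Num.sqrt n%:R)^-1 *:
  centered_mx (V n) (law_mean F1) (law_mean F2) (sample_mx (fun i j => x n i j : T n -> R) w).

Let E n (w : T n) : seq R := eigenvalues (M w).

Let sM n (w : T n) : (M w)^T = M w.
Proof.
apply/matrixP => i j; rewrite !mxE (entries_symmetric (hx n)).
by rewrite [V n j == _]eq_sym.
Qed.

Let mM n : measurable_mx (@M n).
Proof.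
move=> i j; rewrite /M /centered_mx /sample_mx; under eq_fun do rewrite !mxE.
apply: measurable_funM => //; apply: measurable_funB => //; exact: measurable_funB.
Qed.

Let sizeE n (w : T n) : size (E w) = n.
Proof.
have [l [/perm_size + _]] := eigenvalues_symmetric (sM w).
by rewrite size_map size_enum_ord.
Qed.

Let spec_re n eta (w : T n) : 0 < eta ->
  spec_mean E (fun y => y / (y ^+ 2 + eta ^+ 2)) w = n%:R^-1 * \tr (res_re eta (M w)).
Proof.
move=> e0; have [l [pl /(_ eta e0) [-> _]]] := eigenvalues_symmetric (sM w).
by rewrite spec_meanE (perm_big _ pl) big_map big_enum.
Qed.

Let spec_im n eta (w : T n) : 0 < eta ->
  spec_mean E (fun y => eta / (y ^+ 2 + eta ^+ 2)) w = n%:R^-1 * \tr (res_im eta (M w)).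
Proof.
move=> e0; have [l [pl /(_ eta e0) [_ ->]]] := eigenvalues_symmetric (sM w).
by rewrite spec_meanE (perm_big _ pl) big_map big_enum.
Qed.

Let W n w := wigner_mx (fun e : 'I_n * 'I_n => x n e.1 e.2) (normalized_entry (V n) F1 F2 K) w.
(** [n beta^2] for the entry bound [beta = 2 |K| / sqrt n]. The threshold [v0] below gives
    [eta^4 >= eta^2 >= 6 B2^2], that is, a contraction factor [3 eta^-4 B2^2] of at most 1/2. *)
Let B2 : R := 4 * K ^+ 2.
Let v0 : R := 1 + 6 * B2 ^+ 2.

Let contraction eta : 0 < eta -> v0 <= eta ^+ 2 -> 3 * eta ^- 4 * B2 ^+ 2 <= 2^-1.
Proof.
move=> e0 h; have b0 := sqr_ge0 B2.
have h1 : 1 <= eta ^+ 2 by rewrite /v0 in h; lra.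
have h2 : 6 * B2 ^+ 2 <= eta ^+ 4.
  apply: (@le_trans _ _ (eta ^+ 2)); first by rewrite /v0 in h; lra.
  by rewrite -[4%N]/(2 + 2)%N exprD ler_peMl // (le_trans _ h1).
rewrite mulrAC ler_pdivrMr ?exprn_gt0 //; lra.
Qed.

Let trace_rate eta e : 0 < eta -> v0 <= eta ^+ 2 -> 0 < e -> \forall n \near \oo,
  Ex (P n) (fun w => (n%:R^-1 * \tr (res_re eta (W w))) ^+ 2) <= e /\
  Ex (P n) (fun w => (n%:R^-1 * \tr (res_im eta (W w)) - sc_root s eta) ^+ 2) <= e.
Proof.
move=> e0 hv eps0.
have B0 : 0 <= B2 by rewrite /B2 mulr_ge0 ?sqr_ge0.
have eta1 : 1 <= eta.
  rewrite leNgt; apply/negP => h; have : eta ^+ 2 < 1 by rewrite exprn_ilt1 // ltW.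
  have := sqr_ge0 B2; rewrite /v0 in hv; lra.
have [N [delta [del0 hN]]] := rate_small B0 eta1 eps0.
near=> n.
have n0 : (0 < n)%N by near: n; exact: nbhs_infty_gt.
pose beta := 2 * `|K| / Num.sqrt n%:R.
have bE : n%:R * beta ^+ 2 = B2.
  rewrite /beta expr_div_n exprMn real_normK ?num_real // sqr_sqrtr // /B2.
  by rewrite mulrC divfK ?pnatr_eq0 -?lt0n // -natrX.
have rate : 2^-1 ^+ N * (2 * eta ^- 2) + 2 * res_rate beta eta delta B2 N <= e.
  by move: beta bE; near: n; exact: hN.
have row i : `|\sum_j Ex (P n) (fun w => wigner_entry (fun e : 'I_n * 'I_n => x n e.1 e.2)
    (normalized_entry (V n) F1 F2 K) i j w ^+ 2) - s| <= delta.
  by rewrite (row_variance (hx n) i n0); move: i; near: n; exact: row_cvg.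
have [_ [_ [h1 h2]]] := res_trace_err (entries_independent (hx n))
  (@bmf_normalized_entry _ _ _ (V n) F1 F2 K) (@normalized_entryC _ _ _ (V n) F1 F2 K)
  (wigner_entry_le (hx n)) (wigner_entry_mean (hx n)) e0 (ltW s_gt0) (sc_root_gt0 s_gt0 e0)
  (sc_root_eq s_gt0 eta) bE row (contraction e0 hv) N n0.
by split; [exact: le_trans h1 rate|exact: le_trans h2 rate].
Unshelve. all: by end_near. Qed.

Let bmf_trace_re n (A : T n -> 'M[R]_n) eta : 0 < eta -> (forall w, (A w)^T = A w) ->
  measurable_mx A -> bmf (fun w => n%:R^-1 * \tr (res_re eta (A w))).
Proof. by move=> e0 sA mA; apply/bmfZ/bmf_sum => i _; exact: bmf_res_re. Qed.

Let bmf_trace_im n (A : T n -> 'M[R]_n) eta : 0 < eta -> (forall w, (A w)^T = A w) ->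
  measurable_mx A -> bmf (fun w => n%:R^-1 * \tr (res_im eta (A w))).
Proof. by move=> e0 sA mA; apply/bmfZ/bmf_sum => i _; exact: bmf_res_im. Qed.

Let sW n w : (@W n w)^T = W w.
Proof. by apply: wigner_mx_sym => i j; exact: normalized_entryC. Qed.

Let mW n : measurable_mx (@W n).
Proof.
move=> i j; rewrite /W /wigner_mx; under eq_fun do rewrite mxE.
apply: (@measurableT_comp _ _ _ _ _ _ (normalized_entry (V n) F1 F2 K i j)) => //.
by have [] := @bmf_normalized_entry _ _ _ (V n) F1 F2 K i j.
Qed.

Let WM n : {ae P n, forall w, W w = M w} := wigner_mx_ae (hx n).

Let v0_ge1 : 1 <= v0. Proof. by rewrite /v0 lerDl mulr_ge0 // sqr_ge0. Qed.

Let v_sqrt v : v0 <= v -> 0 < Num.sqrt v /\ Num.sqrt v ^+ 2 = v.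
Proof.
move=> h; have v_gt0 : 0 < v by rewrite (lt_le_trans _ h) // (lt_le_trans _ v0_ge1).
by rewrite sqrtr_gt0 sqr_sqrtr // ltW.
Qed.

Let sqcvg_re v : v0 <= v -> sqcvg s P E (fun y => y / (y ^+ 2 + v)).
Proof.
move=> hv; have [e0 ev] := v_sqrt hv; rewrite -ev in hv *.
move: (Num.sqrt v) e0 hv => eta e0 hv {v ev}.
have specE n : @spec_mean R d T E n (fun y => y / (y ^+ 2 + eta ^+ 2))
    = fun w => n%:R^-1 * \tr (res_re eta (M w)).
  by apply/funext => w; exact: spec_re.
split; first exact: bmf_res_re_fun.
  by move=> n; rewrite specE; have [] := bmf_trace_re e0 (@sM n) (@mM n).
move=> e eps0; have := trace_rate e0 hv eps0; apply: filterS => n [h _].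
apply: le_trans h; rewrite specE (sc_mean_res_re s_gt0 e0).
rewrite le_eqVlt; apply/orP; left; apply/eqP; apply: Ex_ae.
- by apply/bmfX/bmfB; [exact: bmf_trace_re|exact: bmf_cst].
- exact/bmfX/bmf_trace_re.
- by apply: filterS (WM n) => w ->; rewrite subr0.
Qed.

Let sqcvg_im v : v0 <= v -> sqcvg s P E (fun y => (y ^+ 2 + v)^-1).
Proof.
move=> hv; have [e0 ev] := v_sqrt hv; rewrite -ev in hv *.
move: (Num.sqrt v) e0 hv => eta e0 hv {v ev}.
apply: (@sqcvg_ext _ _ _ _ _ _ (fun y => eta^-1 * (eta / (y ^+ 2 + eta ^+ 2)))) => [y|].
  by rewrite mulKf // gt_eqF.
apply: sqcvgZ => //.
have specE n : @spec_mean R d T E n (fun y => eta / (y ^+ 2 + eta ^+ 2))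
    = fun w => n%:R^-1 * \tr (res_im eta (M w)).
  by apply/funext => w; exact: spec_im.
split; first exact: bmf_res_im_fun.
  by move=> n; rewrite specE; have [] := bmf_trace_im e0 (@sM n) (@mM n).
move=> e eps0; have := trace_rate e0 hv eps0; apply: filterS => n [_ h].
apply: le_trans h; rewrite specE (sc_mean_res_im s_gt0 e0).
rewrite le_eqVlt; apply/orP; left; apply/eqP; apply: Ex_ae.
- by apply/bmfX/bmfB; [exact: bmf_trace_im|exact: bmf_cst].
- by apply/bmfX/bmfB; [exact: bmf_trace_im|exact: bmf_cst].
- by apply: filterS (WM n) => w ->.
Qed.

(** Both cases of the theorem reduce to this statement: the partition matters only through the row
    variances, which must converge to [s] uniformly over the rows. *)
Lemma esd_cvg_semicircle : cvg_weakly_in_probability P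
  (fun n (w : T n) => esd ((Num.sqrt n%:R)^-1 *:
      centered_mx (V n) (law_mean F1) (law_mean F2)
        (sample_mx (fun i j => x n i j : T n -> R) w)))
  (semicircle_cdf s).
Proof.
move=> t ct eps eps0.
apply: cvg_trans (spec_mean_cvg_in_probability s_gt0 sizeE v0_ge1 sqcvg_im sqcvg_re ct eps0).
apply: near_eq_cvg; apply: nearW => n; congr (P n _); apply/funext => w; congr (_ < `|_ - _|).
have stepE : \sum_(a <- E w) step t a = (count (fun a => a <= t)%R (E w))%:R.
  rewrite -sum1_count natr_sum [in RHS]big_mkcond /=; apply: eq_bigr => a _.
  by rewrite /step; case: (a <= t)%R.
by rewrite spec_meanE stepE /esd mulrC.
Qed.
End Sequence.

(** * Part fractions and balanced partitions *)

Lemma part_fraction_sum (R : realType) n m (V : 'I_n -> 'I_m) : (0 < n)%N ->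
  \sum_i part_fraction R V i = 1.
Proof.
move=> n0; rewrite /part_fraction -mulr_suml -natr_sum.
have -> : (\sum_i #|[set p | V p == i]%SET|)%N = n.
  rewrite -[RHS]card_ord -sum1_card (partition_big V xpredT) //=.
  apply: eq_bigr => i _; rewrite -sum1_card; apply: eq_bigl => j; rewrite inE //.
by rewrite mulfV // pnatr_eq0 -lt0n.
Qed.

Lemma part_fraction_ge0 (R : realType) n m (V : 'I_n -> 'I_m) i : 0 <= part_fraction R V i.
Proof. by rewrite /part_fraction divr_ge0. Qed.

Lemma part_fraction_le_max (R : realType) n m (V : 'I_n -> 'I_m) i :
  part_fraction R V i <= max_part_fraction R V.
Proof. by rewrite /max_part_fraction; apply: (le_bigmax _ (part_fraction R V)). Qed.

Section Balanced.
Variables (R : realType) (n m : nat) (V : 'I_n -> 'I_m) (e : R).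
Hypotheses (n_gt0 : (0 < n)%N) (m_gt0 : (0 < m)%N) (e_ge0 : 0 <= e) (e_le1 : e <= 1).
Hypothesis ratio : forall i j, `|part_fraction R V i / part_fraction R V j - 1| < e.
Local Notation nu := (part_fraction R V).
Local Notation M := (max_part_fraction R V).

(** Division by 0 yields 0, so an empty part would have ratio 0 with itself, at distance 1 from
    1. *)
Let nu_gt0 j : 0 < nu j.
Proof.
rewrite lt_def part_fraction_ge0 andbT; apply/negP => /eqP nu0.
have := ratio j j; rewrite nu0 invr0 mulr0 sub0r normrN1 => /lt_le_trans /(_ e_le1).
by rewrite ltxx.
Qed.

Let max_le j : M <= (1 + e) * nu j.
Proof.
apply: bigmax_le => [|i _].
  by rewrite mulr_ge0 ?addr_ge0 // ltW.
have := ratio i j; rewrite ltr_norml => /andP[_].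
by rewrite ltrBlDr ltr_pdivrMr // addrC => /ltW.
Qed.

(** The fractions sum to 1, and each lies between [M / (1 + e)] and [M]. *)
Lemma balanced_max : 1 <= m%:R * M <= 1 + e.
Proof.
have s1 := part_fraction_sum R V n_gt0.
have cst (z : R) : \sum_(i < m) z = m%:R * z by rewrite sumr_const card_ord mulr_natl.
apply/andP; split.
  rewrite -cst -[X in X <= _]s1.
  by apply: ler_sum => i _; exact: part_fraction_le_max.
rewrite -cst; have -> : 1 + e = \sum_(i < m) (1 + e) * nu i by rewrite -mulr_sumr s1 mulr1.
by apply: ler_sum => i _; exact: max_le.
Qed.

(** [m nu_i] lies between [1 / (1 + e)], which is at least [1 - e], and [1 + e]; dividing by
    [m >= 1] keeps the error at most [e]. *)
Lemma balanced_fraction i : `|nu i - m%:R^-1| <= e.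
Proof.
have m0 : 0 < m%:R :> R by rewrite ltr0n.
have m1 : 1 <= m%:R :> R by rewrite ler1n.
have /andP[h1 h2] := balanced_max; have h3 := max_le i; have h4 := part_fraction_le_max R V i.
have h5 := nu_gt0 i.
have u1 : m%:R * nu i <= 1 + e by apply: le_trans h2; rewrite ler_pM2l.
have u2 : 1 <= (1 + e) * (m%:R * nu i).
  by apply: le_trans h1 _; rewrite mulrCA ler_pM2l.
have u3 : 1 - e <= m%:R * nu i.
  have := mulr_ge0 e_ge0 e_ge0.
  have : (1 - e) * 1 <= (1 - e) * ((1 + e) * (m%:R * nu i)).
    by rewrite ler_wpM2l // subr_ge0.
  have := mulr_ge0 (mulr_ge0 e_ge0 e_ge0) (ltW (mulr_gt0 m0 h5)).
  lra.
have -> : nu i - m%:R^-1 = (m%:R * nu i - 1) / m%:R by field; rewrite gt_eqF.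
rewrite normrM normfV (gtr0_norm m0) ler_pdivrMr //.
have : e * 1 <= e * m%:R by rewrite ler_wpM2l.
by rewrite mulr1; apply: le_trans; rewrite ler_norml; lra.
Qed.
End Balanced.

(** Eventually [m c] is within O(e) of 1, while two distinct integers [a < a'] have
    [a' c >= a c + c]. Once [e] is small compared with [c], two late values of [m] must coincide. *)
Lemma eventually_constant_of_inverse (R : realType) (m : nat -> nat) (M : nat -> R) (c : R) :
  0 < c -> M n @[n --> \oo] --> c ->
  (forall e, 0 < e -> \forall n \near \oo, 1 <= (m n)%:R * M n <= 1 + e) ->
  exists m0, \forall n \near \oo, m n = m0.
Proof.
move=> c0 Mc hm.
(* [e <= 1/8] gives [a c <= 9/7]; the spread of the admissible values is then about [4 e], at most
   about [c / 2], below the gap [(1 - e) c >= 7 c / 8]. *)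
pose e := Num.min (8^-1) (c / 8).
have e0 : 0 < e by rewrite lt_min invr_gt0 divr_gt0 ?andbT //= ltr0n.
have e1 : e <= 8^-1 by rewrite ge_min lexx.
have e2 : e <= c / 8 by rewrite ge_min lexx orbT.
have ec0 : 0 < e * c by rewrite mulr_gt0.
have key a a' Ma Ma' : 1 <= a%:R * Ma <= 1 + e -> 1 <= a'%:R * Ma' <= 1 + e ->
    `|c - Ma| <= e * c -> `|c - Ma'| <= e * c -> (a' <= a)%N.
  move=> /andP[h1 h2] /andP[h3 h4]; rewrite !ler_norml => /andP[h5 h6] /andP[h7 h8].
  rewrite leqNgt; apply/negP => aa'.
  have an : a%:R + 1 <= a'%:R :> R by rewrite natr1 ler_nat.
  have a0 : 0 <= a%:R :> R by [].
  have a'0 : 0 <= a'%:R :> R by [].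
  set z := a%:R * c.
  have z1 : 1 <= (1 + e) * z.
    apply: le_trans h1 _; rewrite /z mulrCA ler_wpM2l //; lra.
  have z2 : (1 - e) * z <= 1 + e.
    by apply: le_trans h2; rewrite /z mulrCA ler_wpM2l //; lra.
  have z3 : (1 - e) * (a'%:R * c) <= 1 + e.
    by apply: le_trans h4; rewrite mulrCA ler_wpM2l //; lra.
  have ac : z + c <= a'%:R * c.
    by rewrite /z -[X in _ + X]mul1r -mulrDl ler_wpM2r // ltW.
  have z4 : (1 - e) * (z + c) <= 1 + e.
    by apply: le_trans z3; rewrite ler_wpM2l //; lra.
  have z0 : 0 <= z by rewrite mulr_ge0 // ltW.
  have z5 : z <= 9 / 7.
    have : (7 / 8) * z <= (1 - e) * z by rewrite ler_wpM2r //; lra.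
    lra.
  have z6 : (1 + e) * 1 <= (1 + e) * ((1 + e) * z) by rewrite ler_wpM2l //; lra.
  have z7 : (7 / 8) * c <= (1 - e) * c by rewrite ler_wpM2r ?(ltW c0) //; lra.
  have z8 : e * z <= e * (9 / 7) by rewrite ler_wpM2l // ltW.
  have z9 : e * (e * z) <= 8^-1 * (e * z) by rewrite ler_wpM2r // mulr_ge0 // ltW.
  lra.
have near_ : \forall n \near \oo, 1 <= (m n)%:R * M n <= 1 + e /\ `|c - M n| <= e * c.
  move/cvgrPdist_le : Mc => /(_ _ ec0) h; move: (hm _ e0) h.
  by apply: filterS2 => n h1 h2.
have [N _ hN] := near_.
exists (m N); exists N => // n /= Nn.
have [h1 h2] := hN N (leqnn N); have [h3 h4] := hN n Nn.
by apply/eqP; rewrite eqn_leq (key _ _ _ _ h1 h3 h2 h4) (key _ _ _ _ h3 h1 h4 h2).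
Qed.

Theorem theorem3p1 (R : realType)
    (d : nat -> measure_display) (T : forall n, measurableType (d n))
    (P : forall n, probability (T n) R)
    (m : nat -> nat) (hm : forall n, (2 <= m n)%N)
    (V : forall n, 'I_n -> 'I_(m n))
    (F1 F2 : probability (measurableTypeR R) R) (K : R)
    (x : forall n, 'I_n -> 'I_n -> {RV (P n) >-> R})
    (hx : forall n, random_multipartite (V n) F1 F2 K (x n)) :
  let Phi := fun n (w : T n) =>
    esd ((Num.sqrt n%:R)^-1 *:
      centered_mx (V n) (law_mean F1) (law_mean F2)
        (sample_mx (fun i j => x n i j : T n -> R) w)) in
  ((exists2 c : R, 0 < c &
      max_part_fraction R (V n) @[n --> \oo] --> c) ->
   (forall eps : R, 0 < eps -> \forall n \near \oo, forall i j : 'I_(m n),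
      `|part_fraction R (V n) i / part_fraction R (V n) j - 1| < eps) ->
   exists m0 : nat, (\forall n \near \oo, m n = m0) /\
     (0 < Delta2 (law_variance F1) (law_variance F2) m0 ->
      cvg_weakly_in_probability P Phi
        (semicircle_cdf
          (Delta2 (law_variance F1) (law_variance F2) m0))))
  /\
  (max_part_fraction R (V n) @[n --> \oo] --> (0 : R) ->
   0 < law_variance F2 ->
   cvg_weakly_in_probability P Phi (semicircle_cdf (law_variance F2))).
Proof.
move=> Phi; set v1 := law_variance F1; set v2 := law_variance F2; split.
  move=> [c c0 Mc] ratio.
  have bal e : 0 < e -> e <= 1 -> \forall n \near \oo,
      1 <= (m n)%:R * max_part_fraction R (V n) <= 1 + e /\
      forall i, `|part_fraction R (V n) i - (m n)%:R^-1| <= e.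
    move=> e0 e1; move: (nbhs_infty_gt 0) (ratio e e0); apply: filterS2 => n n0 hr.
    have m0 : (0 < m n)%N by exact: leq_trans (hm n).
    split; first exact: balanced_max n0 (ltW e0) e1 hr.
    by move=> i; exact: balanced_fraction n0 m0 (ltW e0) e1 hr i.
  have [m0 hm0] : exists m0, \forall n \near \oo, m n = m0.
    apply: eventually_constant_of_inverse c0 Mc _ => e e0; pose e' := Num.min 1 e.
    have e'0 : 0 < e' by rewrite lt_min ltr01.
    have e'1 : e' <= 1 by rewrite ge_min lexx.
    apply: filterS (bal _ e'0 e'1) => n [/andP[h1 h2] _]; rewrite h1 (le_trans h2) //.
    by rewrite lerD2l ge_min lexx orbT.
  exists m0; split=> // D0; apply: (esd_cvg_semicircle hx D0) => del del0.
  (* The row variance differs from the limit by [(nu_i - 1/m0) (v1 - v2)]; adding 1 to [|v1 - v2|]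
     keeps the denominator positive when the variances agree. *)
  pose e := Num.min 1 (del / (`|v1 - v2| + 1)).
  have e0 : 0 < e by rewrite lt_min ltr01 divr_gt0 // ltr_wpDl.
  have e1 : e <= 1 by rewrite ge_min lexx.
  apply: (filterS2 _ _ hm0 (bal _ e0 e1)) => n mn [_ hn] i.
  have h : `|part_fraction R (V n) (V n i) - m0%:R^-1| <= e by rewrite -mn; exact: hn.
  have m0_gt0 : (0 < m0)%N by rewrite -mn; exact: leq_trans (hm n).
  rewrite -/v1 -/v2 /Delta2.
  have -> : v2 + part_fraction R (V n) (V n i) * (v1 - v2) - (v1 + (m0%:R - 1) * v2) / m0%:R
      = (part_fraction R (V n) (V n i) - m0%:R^-1) * (v1 - v2).
    by field; rewrite pnatr_eq0 -lt0n.
  rewrite normrM; apply: (@le_trans _ _ (e * (`|v1 - v2| + 1))).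
    by rewrite ler_pM // lerDl.
  by rewrite -ler_pdivlMr ?ltr_wpDl // ge_min lexx orbT.
move=> Mc v20; apply: (esd_cvg_semicircle hx v20) => del del0.
have e0 : 0 < del / (`|v1 - v2| + 1) by rewrite divr_gt0 // ltr_wpDl.
move/cvgr0Pnorm_le : Mc => /(_ _ e0); apply: filterS => n hn i.
rewrite -/v1 -/v2 addrAC subrr add0r normrM.
rewrite (ger0_norm (part_fraction_ge0 _ _ _)).
apply: (@le_trans _ _ (del / (`|v1 - v2| + 1) * (`|v1 - v2| + 1))).
  rewrite ler_pM ?part_fraction_ge0 ?lerDl //.
  apply: le_trans (part_fraction_le_max _ _ _) _.
  exact: le_trans (ler_norm _) hn.
by rewrite divfK // gt_eqF // ltr_wpDl.
Qed.
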